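(* Let $u_0\in H^1(0,1)$, let $\varepsilon\in(0,1)$, and let $u_0^\varepsilon\in H^1(0,1)$ satisfy $\|u_0^\varepsilon-u_0\|_{H^1(0,1)}\le\varepsilon$ and $u_0^\varepsilon(0)=u_0^\varepsilon(1)=0$. Let $\beta=\beta(\varepsilon)\in(0,1)$ and let $\mathbf{P}_\varepsilon^\beta:H^1(0,1)\to L^2(0,1)$ be a stabilized operator. Then the regularized problem $$\partial_x^2u_\beta^\varepsilon-\partial_y^2u_\beta^\varepsilon+\mathbf{P}_\varepsilon^\beta u_\beta^\varepsilon=0\ \text{ in }(0,1)\times(0,1),$$ $$u_\beta^\varepsilon(x,0)=u_\beta^\varepsilon(x,1)=0\ (x\in[0,1]),\qquad u_\beta^\varepsilon(0,y)=u_0^\varepsilon(y),\ \ \partial_xu_\beta^\varepsilon(0,y)=0\ (y\in[0,1])$$ admits a unique weak solution $u_\beta^\varepsilon$.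
   Context: All functions are real-valued. $\|\cdot\|$ is the norm of $L^2(0,1)$ (in the variable $y$), and $\langle\cdot,\cdot\rangle$ is the $L^2(0,1)$ inner product or the duality pairing between $H^{-1}(0,1)$ and $H_0^1(0,1)$. Functions of $(x,y)$ are viewed as functions of $x\in[0,1]$ with values in function spaces in $y\in(0,1)$; $\mathbf{P}_\varepsilon^\beta$ acts in the variable $y$. Auxiliary function: $\gamma:(0,1)\to\mathbb{R}$ with $\gamma(\beta)\ge1$ for all $\beta\in(0,1)$ and $\lim_{\beta\to0}\gamma(\beta)=\infty$. The regularization parameter $\beta=\beta(\varepsilon)\in(0,1)$ satisfies $\beta\to0$ as $\varepsilon\to0$. Stabilized operator: a linear map $\mathbf{P}_\varepsilon^\beta:H^1(0,1)\to L^2(0,1)$ for which there is a constant $C_1>0$ independent of $\varepsilon$ with $\|\mathbf{P}_\varepsilon^\beta u\|\le C_1\log(\gamma(\beta))\|u\|_{H^1(0,1)}$ for all $u\in H^1(0,1)$. Weak solution: a function $u_\beta^\varepsilon:[0,1]\to H_0^1(0,1)$ such that (i) $u_\beta^\varepsilon\in C([0,1];H_0^1(0,1))$, $\partial_xu_\beta^\varepsilon\in C([0,1];L^2(0,1))$, $\partial_x^2u_\beta^\varepsilon\in L^2(0,1;H^{-1}(0,1))$; (ii) for every $\psi\in H_0^1(0,1)$, $\langle\partial_x^2u_\beta^\varepsilon,\psi\rangle+\langle\partial_yu_\beta^\varepsilon,\partial_y\psi\rangle+\langle\mathbf{P}_\varepsilon^\beta u_\beta^\varepsilon,\psi\rangle=0$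 for a.e. $x\in(0,1)$; (iii) $u_\beta^\varepsilon(0)=u_0^\varepsilon$ and $\partial_xu_\beta^\varepsilon(0)=0$. *)

(* Defs.v *)
From HB Require Import structures.
From mathcomp Require Import all_boot all_order all_algebra.
From mathcomp Require Import all_classical all_reals all_analysis.

Set Implicit Arguments.
Unset Strict Implicit.
Unset Printing Implicit Defensive.

Import Order.TTheory GRing.Theory Num.Theory.
Import numFieldNormedType.Exports.

Local Open Scope classical_set_scope.
Local Open Scope ring_scope.

(* Elements of L^2(0,1) and of its subspaces are represented by functions
   [R -> R], Borel measurable on the line; their values outside ]0, 1[ are
   irrelevant, and two representatives are identified when they are equal
   [%[ae mu01 R]].  A function of (x, y) is a function of x with values in
   such functions of y. *)

Section SobolevSpaces.
Variable R : realType.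

Definition mu01 : {measure set (measurableTypeR R) -> \bar R} :=
  mrestr (@lebesgue_measure R) (measurable_itv `]0%R, 1%R[).

Definition L2 : set (R -> R) := [set f | f \in Lfun mu01 2%:E].

Definition L2norm (f : R -> R) : R := fine 'N[mu01]_2[EFin \o f].

Definition L2inner (f g : R -> R) : R := \int[mu01]_y (f y * g y).

Definition Ccinfty : set (R -> R) :=
  [set phi | (forall n y, derivable (derive1n n phi) y 1) /\
     exists a b : R, [/\ 0 < a, b < 1 & forall y, y \notin `[a, b] -> phi y = 0]].

Definition weak_derivative (f g : R -> R) : Prop :=
  forall phi, Ccinfty phi ->
    \int[mu01]_y (f y * derive1 phi y) = - \int[mu01]_y (g y * phi y).

Definition H1 : set (R -> R) :=
  [set f | L2 f /\ exists2 g, L2 g & weak_derivative f g].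

(* A choice of weak derivative, meaningful for f in H1, where it is unique up
   to equality almost everywhere. *)
Definition wderiv (f : R -> R) : R -> R :=
  xget (cst 0) [set g | L2 g /\ weak_derivative f g].

Definition H1norm (f : R -> R) : R :=
  Num.sqrt (L2norm f ^+ 2 + L2norm (wderiv f) ^+ 2).

Definition H10 : set (R -> R) :=
  [set f | H1 f /\ forall e : R, 0 < e ->
     exists2 phi, Ccinfty phi & H1norm (f \- phi) < e].

(* f(0) = f(1) = 0, where f in H1 is evaluated through its continuous
   representative on [0, 1]. *)
Definition vanishes_at_endpoints (f : R -> R) : Prop :=
  exists g : R -> R, [/\ {within `[0, 1], continuous g},
    f = g %[ae mu01], g 0 = 0 & g 1 = 0].

(* The dual space of H10.  A functional is only relevant through its values on
   H10; that it does not distinguish functions equal almost everywhere follows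
   from boundedness. *)
Definition Hm1 : set ((R -> R) -> R) :=
  [set l | (forall (a : R) f g, H10 f -> H10 g ->
              l (fun y => a * f y + g y) = a * l f + l g) /\
           exists C : R, forall f, H10 f -> `|l f| <= C * H1norm f].

Definition Hm1norm (l : (R -> R) -> R) : R :=
  sup [set `|l f| | f in [set f | H10 f /\ H1norm f <= 1]].

(* Simple functions of x in ]0, 1[ with values in H^-1. *)
Definition Hm1_simple (s : R -> (R -> R) -> R) : Prop :=
  exists (n : nat) (A : 'I_n -> set (measurableTypeR R))
         (l : 'I_n -> (R -> R) -> R),
    (forall i, measurable (A i) /\ Hm1 (l i)) /\
    forall x f, s x f = \sum_(i < n) \1_(A i) x * l i f.

Definition Hm1_strongly_measurable (w : R -> (R -> R) -> R) : Prop :=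
  exists2 s : nat -> R -> (R -> R) -> R, (forall n, Hm1_simple (s n)) &
    forall x, x \in `]0, 1[ ->
      Hm1norm (s n x \- w x) @[n --> \oo] --> (0 : R).

(* Bochner space L^2(0, 1; H^-1). *)
Definition L2_Hm1 (w : R -> (R -> R) -> R) : Prop :=
  [/\ forall x, x \in `]0, 1[ -> Hm1 (w x),
      Hm1_strongly_measurable w &
      (\int[mu01]_x (Hm1norm (w x) ^+ 2)%:E < +oo)%E].

(* C([0, 1]; E) for the space E with norm N. *)
Definition continuous_into (E : set (R -> R)) (N : (R -> R) -> R)
    (u : R -> R -> R) : Prop :=
  forall x, x \in `[0, 1] -> E (u x) /\
    N (u t \- u x) @[t --> within `[0, 1] (nbhs x)] --> (0 : R).

(* v is the derivative of u : [0, 1] -> L^2(0,1), one-sided at 0 and 1. *)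
Definition L2_derivative (u v : R -> R -> R) : Prop :=
  forall x, x \in `[0, 1] ->
    L2norm (fun y => (u t y - u x y) / (t - x) - v x y)
      @[t --> within `[0, 1] x^'] --> (0 : R).

(* w is the H^-1-valued distributional derivative of v on ]0, 1[, L^2(0,1)
   being embedded in H^-1 by its inner product.  The Bochner integrals against
   the scalar test function phi are evaluated at psi; evaluation commutes with
   the Bochner integral, and elements of H^-1 are equal when they agree at
   every psi. *)
Definition Hm1_weak_derivative (v : R -> R -> R) (w : R -> (R -> R) -> R) :
    Prop :=
  forall phi, Ccinfty phi -> forall psi, H10 psi ->
    \int[mu01]_x (derive1 phi x * L2inner (v x) psi) =
    - \int[mu01]_x (phi x * w x psi).

Definition weak_solution (P : (R -> R) -> (R -> R)) (u0e : R -> R)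
    (u : R -> R -> R) : Prop :=
  exists (ux : R -> R -> R) (uxx : R -> (R -> R) -> R),
    [/\ [/\ continuous_into H10 H1norm u,
            L2_derivative u ux /\ continuous_into L2 L2norm ux &
            Hm1_weak_derivative ux uxx /\ L2_Hm1 uxx],
        forall psi, H10 psi -> {ae mu01, forall x,
          uxx x psi + L2inner (wderiv (u x)) (wderiv psi)
            + L2inner (P (u x)) psi = 0} &
        u 0 = u0e %[ae mu01] /\ ux 0 = cst 0 %[ae mu01]].

(* Linearity on classes is equality almost everywhere; that P e respects
   almost-everywhere equality follows from linearity and the bound. *)
Definition linear_H1_L2 (P : (R -> R) -> (R -> R)) : Prop :=
  (forall f, H1 f -> L2 (P f)) /\
  forall (a : R) f g, H1 f -> H1 g ->
    P (fun y => a * f y + g y) = (fun y => a * P f y + P g y) %[ae mu01].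

(* The family e |-> P e of stabilized operators, with parameter beta e; the
   constant C1 is the same for all e. *)
Definition stabilized (gamma beta : R -> R) (P : R -> (R -> R) -> (R -> R)) :
    Prop :=
  (forall e, 0 < e < 1 -> linear_H1_L2 (P e)) /\
  exists2 C1 : R, 0 < C1 & forall e, 0 < e < 1 -> forall f, H1 f ->
    L2norm (P e f) <= C1 * ln (gamma (beta e)) * H1norm f.

End SobolevSpaces.

(* Main.v *)
(* Expansion in the sine basis turns the problem into a perturbed wave equation
   b_k' = om_k d_k, d_k' = - om_k b_k - <P u, sn_k> for b_k = om_k <u, sn_k> and
   d_k = <u_x, sn_k>.  By the Fourier characterisation of H10 the H1 norm of u is
   equivalent to the l2 norm of b, so P acts on b as a bounded operator of l2 and
   the energy sum (b_k^2 + d_k^2) obeys a Gronwall estimate uniform in the number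
   of modes.  Picard iteration in a weighted sup norm yields a solution of the
   system, and dominated convergence in l2 turns coordinatewise continuity and
   differentiability into the regularity required of a weak solution.
   Conversely, testing a weak solution against sn_k and applying the
   du Bois-Reymond lemma in x shows that its coefficients solve the system, so
   the same energy estimate applied to a difference gives uniqueness. *)
Require Import Defs.
From mathcomp Require Import all_boot all_order all_algebra.
From mathcomp Require Import all_classical all_reals all_analysis.
From mathcomp Require Import measurable_realfun ring lra.

Set Implicit Arguments.
Unset Strict Implicit.
Unset Printing Implicit Defensive.

Import Order.TTheory GRing.Theory Num.Theory.
Import numFieldNormedType.Exports.

Local Open Scope classical_set_scope.
Local Open Scope ring_scope.

(** * Square-integrable functions on the unit interval *)

(** A weak solution is too rough for the usual energy argument: u_x takes values in L2 only, so it
    cannot be tested against the equation, whose terms lie in H^-1. Coordinates remove this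
    obstacle, because [sn k] is an admissible test function and each coefficient obeys a classical
    differential equation. The factor om k in b_k makes the unperturbed system a rotation in every
    (b_k, d_k) plane, so the unbounded frequencies cancel in the energy. Only the source remains,
    and it couples all modes, since P need not be diagonal in the sine basis. H10 is defined by
    density of test functions, not by coefficients. Its characterisation says that the derivative
    has mean zero and that its cosine coefficients are om k times the sine coefficients of the
    function; hence the cosine system has to be used together with its constant mode. The space l2
    is handled through bounds on partial sums that are uniform in the number of terms. The constant
    K = 2 C^2 + 1 in the source bound has its factor 2 from the estimate of the squared H1 norm by 2
    sum b_k^2. *)

Section integral_mu01.
Context {R : realType}.
Local Notation mu := (mu01 R).
Local Notation I01 := (`]0, 1[%classic : set (measurableTypeR R)).
Implicit Types f g h : R -> R.

Lemma mu01_sub (A : set R) : A `<=` I01 -> mu A = lebesgue_measure A.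
Proof. by move=> sA; rewrite /= /mrestr setIidl. Qed.

Lemma mu01_setT : mu setT = 1%E.
Proof.
by rewrite /= /mrestr setTI lebesgue_measure_itv/= lte_fin ltr01 sube0.
Qed.

Lemma mu01_compl : mu (~` I01) = 0%E.
Proof. by rewrite /= /mrestr setICl measure0. Qed.

Lemma ae_mu01 (P : R -> Prop) :
  (forall x, 0 < x < 1 -> P x) -> {ae mu, forall x, P x}.
Proof.
move=> h; exists (~` I01); split.
- by apply: measurableC; exact: measurable_itv.
- exact: mu01_compl.
- by move=> x /=; apply: contra_not => xI; apply: h; move: xI; rewrite in_itv.
Qed.

Import HBNNSimple.

Let sintegral_mu01 (h : {nnsfun measurableTypeR R >-> R})
    (mD : measurable I01) :
  sintegral mu (proj_nnsfun h mD) = sintegral mu h.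
Proof.
rewrite !sintegralET; apply: eq_fsbigr => r _.
have [->|r0] := eqVneq r 0; first by rewrite !mul0e.
congr (_ * _)%E; rewrite -(mrestrict h mD) /= /mrestr; congr lebesgue_measure.
by apply/seteqP; split => x [] /= + xI; rewrite patchE mem_set.
Qed.

(** Cutting a simple function off outside ]0, 1[ keeps its integral against [mu], so both suprema
    run over the same values. Arguing on simple functions covers nonmeasurable [f]; later integrands
    with values prescribed only on ]0, 1[ rely on this. *)
Let nnintegral_mu01 (f : R -> \bar R) : (forall x, 0 <= f x)%E ->
  [set sintegral mu h | h in
    [set h : {nnsfun measurableTypeR R >-> R} | (forall x, (h x)%:E <= f x)%E]]
  = [set sintegral mu h | h in
    [set h : {nnsfun measurableTypeR R >-> R}
       | (forall x, (h x)%:E <= (f \_ I01) x)%E]].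
Proof.
have mD : measurable I01 by exact: measurable_itv.
move=> f0; apply/seteqP; split => _ [h /= hf <-]; last first.
  exists h => // x; apply: le_trans (hf x) _; rewrite patchE.
  by case: ifP.
exists (proj_nnsfun h mD); last by rewrite sintegral_mu01.
by move=> x; rewrite -(mrestrict h mD) !patchE; case: ifP.
Qed.

Lemma integral_mu01 (f : R -> \bar R) :
  (\int[mu]_x f x = \int[lebesgue_measure]_(x in I01) f x)%E.
Proof.
transitivity (\int[mu]_(x in I01) f x)%E; last first.
  by apply: eq_measure_integral => A _ sA; exact: mu01_sub.
rewrite /integral !patch_setT funepos_restrict funeneg_restrict.
by rewrite -!nnintegral_mu01.
Qed.

End integral_mu01.

(** * L2(0, 1) as an inner product space *)

Section L2_space.
Context {R : realType}.
Local Notation mu := (mu01 R).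
Local Notation I01 := (`]0, 1[%classic : set (measurableTypeR R)).
Implicit Types f g h : R -> R.

Lemma Rintegral_mu01 f :
  \int[mu]_x f x = \int[lebesgue_measure]_(x in I01) f x.
Proof. by rewrite /Rintegral integral_mu01. Qed.

Lemma integrable_mu01 (f : R -> \bar R) :
  measurable_fun setT f ->
  lebesgue_measure.-integrable I01 f -> mu.-integrable setT f.
Proof.
move=> mf /integrableP[_ fi]; apply/integrableP; split => //.
by rewrite integral_mu01.
Qed.

Lemma integrable_lebesgue01 (f : R -> \bar R) :
  mu.-integrable setT f -> lebesgue_measure.-integrable I01 f.
Proof.
move=> /integrableP[mf fi]; apply/integrableP; split.
  exact: measurable_funS mf.
by rewrite integral_mu01 in fi.
Qed.

Lemma bounded_integrable_mu01 f (M : R) : measurable_fun setT f ->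
  (forall x, 0 < x < 1 -> `|f x| <= M) -> mu.-integrable setT (EFin \o f).
Proof.
move=> mf fM; apply: integrable_mu01; first exact/measurable_EFinP.
apply: measurable_bounded_integrable.
- exact: measurable_itv.
- by rewrite /= lebesgue_measure_itv/= lte_fin ltr01 sube0 ltry.
- exact: measurable_funS mf.
- exists M; split; rewrite ?num_real// => N MN x /=; rewrite in_itv/= => x01.
  exact/ltW/(le_lt_trans _ MN)/fM.
Qed.

Lemma le_Rintegral_mu01 f g :
  mu.-integrable setT (EFin \o f) -> mu.-integrable setT (EFin \o g) ->
  (forall x, 0 < x < 1 -> f x <= g x) -> \int[mu]_x f x <= \int[mu]_x g x.
Proof.
move=> fi gi fg; rewrite !Rintegral_mu01; apply: le_Rintegral => //.
- exact: integrable_lebesgue01.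
- exact: integrable_lebesgue01.
Qed.

Global Instance ae_mu01_filter : Filter (nbhs (almost_everywhere mu)) :=
  ae_filter_ringOfSetsType mu.

Lemma ae_eq_Rintegral f g : measurable_fun setT f -> measurable_fun setT g ->
  f = g %[ae mu] -> \int[mu]_x f x = \int[mu]_x g x.
Proof.
move=> mf mg fg; congr fine; apply: ae_eq_integral => //.
- exact/measurable_EFinP.
- exact/measurable_EFinP.
- by apply: filterS fg => x /[apply] ->.
Qed.

Lemma Rintegral_mu01_cst (r : R) : \int[mu]_x (cst r x) = r.
Proof. by rewrite Rintegral_cst// mu01_setT mulr1. Qed.

Lemma L2_mfun f : L2 f -> measurable_fun setT f.
Proof. by rewrite /L2/= inE => /andP[+ _]; rewrite inE. Qed.

Lemma L2_integrable_sqr f : L2 f ->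
  mu.-integrable setT (EFin \o (fun x => f x ^+ 2)).
Proof. exact: Lfun2_integrable_sqr. Qed.

Lemma L2_integrableM f g : L2 f -> L2 g ->
  mu.-integrable setT (EFin \o (fun x => f x * g x)).
Proof. by move=> Lf Lg; apply/Lfun1_integrable; exact: Lfun2_mul_Lfun1. Qed.

Let powR2 (x : R) : `|x| `^ 2 = x ^+ 2.
Proof. by rewrite powR_mulrn// real_normK// num_real. Qed.

Let Lnorm2E f : ('N[mu]_2[EFin \o f] = (\int[mu]_x (f x ^+ 2)%:E) `^ 2^-1)%E.
Proof.
rewrite unlock; congr (_ `^ _)%E; apply: eq_integral => x _ /=.
by rewrite powR2.
Qed.

Lemma integrable_sqr_L2 f : measurable_fun setT f ->
  mu.-integrable setT (EFin \o (fun x => f x ^+ 2)) -> L2 f.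
Proof.
move=> mf /integrableP[_ fi]; rewrite /L2/= inE; apply/andP; split.
  by rewrite inE.
rewrite inE/= /finite_norm Lnorm2E poweR_lty//.
apply: le_lt_trans fi; apply: ge0_le_integral => //=.
- by move=> x _; rewrite lee_fin sqr_ge0.
- exact/measurable_EFinP/measurable_funX.
- exact/measurable_EFinP/measurableT_comp/measurable_funX.
- by move=> x _; rewrite lee_fin ler_norm.
Qed.

Lemma L2norm_ge0 f : 0 <= L2norm f.
Proof. by rewrite /L2norm fine_ge0// Lnorm_ge0. Qed.

Lemma L2norm_sqr f : L2 f -> L2norm f ^+ 2 = L2inner f f.
Proof.
move=> Lf; rewrite /L2norm Lnorm2E /L2inner/= /Rintegral.
under [in RHS]eq_integral do rewrite -expr2.
have := integrable_fin_num measurableT (L2_integrable_sqr Lf).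
have : (0 <= \int[mu]_x (f x ^+ 2)%:E)%E.
  by apply: integral_ge0 => x _; rewrite lee_fin sqr_ge0.
rewrite /comp; case: (\int[mu]_x _)%E => // r r0 _ /=.
by rewrite -powR_mulrn ?powR_ge0// -powRrM mulVf// powRr1.
Qed.

Lemma bounded_L2 f (M : R) : measurable_fun setT f ->
  (forall x, 0 < x < 1 -> `|f x| <= M) -> L2 f.
Proof.
move=> mf fM; apply: integrable_sqr_L2 => //.
apply: (@bounded_integrable_mu01 _ (M ^+ 2)); first exact: measurable_funX.
move=> x /fM fxM; rewrite normrX lerXn2r// nnegrE//.
exact: le_trans fxM.
Qed.

Lemma continuous_L2 f : continuous f -> L2 f.
Proof.
move=> cf; have mf : measurable_fun setT f by exact: continuous_measurable_fun.
have [M fM] : exists M, forall x, x \in `[0, 1] -> `|f x| <= M.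
  have [c _ fc] := @EVT_max R (fun x => `|f x|) 0 1 ler01
    (continuous_subspaceT (fun x => continuous_comp (cf x) (@norm_continuous _ _ _))).
  by exists `|f c|.
apply: (@bounded_L2 _ M) => // x /andP[x0 x1]; apply: fM.
by rewrite in_itv/= !ltW.
Qed.

Lemma L2_lin (a : R) f g : L2 f -> L2 g -> L2 (a *: f + g).
Proof.
move=> Lf Lg; rewrite /L2/=.
have p1 : (1 <= 2%:E :> \bar R)%E by rewrite lee_fin ler1n.
by have [_] := Lfun_submod_closed mu p1; exact.
Qed.

Lemma L2_0 : L2 (0 : R -> R).
Proof. apply: (@bounded_L2 _ 0); first exact: measurable_cst.
by move=> x _; rewrite normr0. Qed.

Lemma L2D f g : L2 f -> L2 g -> L2 (f + g).
Proof. by move=> Lf Lg; rewrite -[f]scale1r; exact: L2_lin. Qed.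

Lemma L2Z (a : R) f : L2 f -> L2 (a *: f).
Proof. by move=> Lf; rewrite -[a *: f]addr0; apply: L2_lin => //; exact: L2_0. Qed.

Lemma L2B f g : L2 f -> L2 g -> L2 (f - g).
Proof. by move=> Lf Lg; rewrite -scaleN1r addrC; exact: L2_lin. Qed.

Lemma L2_sum n (F : nat -> R -> R) : (forall k, L2 (F k)) ->
  L2 (\sum_(k < n) F k).
Proof.
by move=> LF; elim/big_rec: _ => [|i f _]; [exact: L2_0|exact: L2D].
Qed.

Lemma L2innerC f g : L2inner f g = L2inner g f.
Proof. by apply: eq_Rintegral => x _; rewrite mulrC. Qed.

Lemma L2inner_linl (a : R) f g h : L2 f -> L2 g -> L2 h ->
  L2inner (a *: f + g) h = a * L2inner f h + L2inner g h.
Proof.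
move=> Lf Lg Lh; rewrite /L2inner -RintegralZl//; last exact: L2_integrableM.
rewrite -RintegralD//.
- by apply: eq_Rintegral => x _; rewrite /= mulrDl mulrA.
- have := L2_integrableM (L2Z a Lf) Lh; apply: eq_integrable => // x _ /=.
  by rewrite -mulrA.
- exact: L2_integrableM.
Qed.

Lemma L2innerDl f g h : L2 f -> L2 g -> L2 h ->
  L2inner (f + g) h = L2inner f h + L2inner g h.
Proof. by move=> *; rewrite -[f]scale1r L2inner_linl// mul1r scale1r. Qed.

Lemma L2inner0l h : L2inner 0 h = 0.
Proof.
rewrite /L2inner (_ : (fun _ => _) = cst 0) ?Rintegral_mu01_cst//.
by apply/funext => x /=; rewrite mul0r.
Qed.

Lemma L2innerZl (a : R) f h : L2 f -> L2 h ->
  L2inner (a *: f) h = a * L2inner f h.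
Proof.
move=> *; rewrite -[a *: f]addr0 L2inner_linl//; last exact: L2_0.
by rewrite L2inner0l addr0.
Qed.

Lemma L2innerBl f g h : L2 f -> L2 g -> L2 h ->
  L2inner (f - g) h = L2inner f h - L2inner g h.
Proof.
by move=> *; rewrite -scaleN1r addrC L2inner_linl// mulN1r addrC.
Qed.

Lemma L2inner_suml n (F : nat -> R -> R) h : (forall k, L2 (F k)) -> L2 h ->
  L2inner (\sum_(k < n) F k) h = \sum_(k < n) L2inner (F k) h.
Proof.
move=> LF Lh; elim: n => [|n IH]; first by rewrite !big_ord0 L2inner0l.
by rewrite !big_ord_recr/= L2innerDl// ?IH//; exact: L2_sum.
Qed.

Lemma L2inner_ae f g h : L2 f -> L2 g -> L2 h -> f = g %[ae mu] ->
  L2inner f h = L2inner g h.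
Proof.
move=> /L2_mfun mf /L2_mfun mg /L2_mfun mh fg; apply: ae_eq_Rintegral.
- exact: measurable_funM.
- exact: measurable_funM.
- by apply: filterS fg => x /[apply] ->.
Qed.

Lemma L2innerDr f g h : L2 f -> L2 g -> L2 h ->
  L2inner h (f + g) = L2inner h f + L2inner h g.
Proof. by move=> *; rewrite !(L2innerC h) L2innerDl. Qed.

Lemma L2innerBr f g h : L2 f -> L2 g -> L2 h ->
  L2inner h (f - g) = L2inner h f - L2inner h g.
Proof. by move=> *; rewrite !(L2innerC h) L2innerBl. Qed.

Lemma L2innerZr (a : R) f h : L2 f -> L2 h ->
  L2inner h (a *: f) = a * L2inner h f.
Proof. by move=> *; rewrite !(L2innerC h) L2innerZl. Qed.

Lemma L2inner_ge0 f : 0 <= L2inner f f.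
Proof. by apply: Rintegral_ge0 => x _; rewrite -expr2 sqr_ge0. Qed.

Lemma L2norm_ae f g : L2 f -> L2 g -> f = g %[ae mu] -> L2norm f = L2norm g.
Proof.
move=> Lf Lg fg; apply/eqP; rewrite -(@eqrXn2 _ 2)// ?L2norm_ge0//.
by rewrite !L2norm_sqr// (L2inner_ae _ Lg)// L2innerC (L2inner_ae _ Lg).
Qed.

Lemma L2_cauchy_schwarz f g : L2 f -> L2 g ->
  `|L2inner f g| <= L2norm f * L2norm g.
Proof.
move=> Lf Lg; rewrite -(@ler_pXn2r _ 2)// ?nnegrE ?mulr_ge0 ?L2norm_ge0//.
rewrite exprMn !L2norm_sqr// real_normK ?num_real//.
set a := L2inner f f; set b := L2inner f g; set c := L2inner g g.
have h (s t : R) : 0 <= s ^+ 2 * a + 2 * s * t * b + t ^+ 2 * c.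
  have := L2inner_ge0 (s *: f + t *: g).
  have Lt := L2Z t Lg; have Ls := L2_lin s Lf Lt.
  rewrite L2inner_linl// L2innerZl// ![L2inner _ (_ + _)]L2innerC.
  rewrite !L2inner_linl// !L2innerZl// -/a -/c (L2innerC g f) -/b.
  by congr (_ <= _); ring.
have c0 : 0 <= c by exact: L2inner_ge0.
have [c_eq0|cN0] := eqVneq c 0.
  (* For c = 0 the form is s^2 a + 2 s t b. At this pair (s, t) it equals - (1 + a) (a^2 + 5 a + 2)
     b^2, which forces b = 0. *)
  have := h ((1 + a) * b) (- (1 + a) ^+ 2 - a); have a0 : 0 <= a by exact: L2inner_ge0.
  have := h 1 (- (1 + a) * b); rewrite c_eq0.
  have b2 := sqr_ge0 b; rewrite mulr0; nra.
(* At (c, - b) the form equals c (a c - b^2), the discriminant inequality multiplied by c. *)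
rewrite -subr_ge0 -(@pmulr_rge0 _ c) ?lt_def ?cN0//.
have := h c (- b); congr (_ <= _); ring.
Qed.

Lemma L2normD f g : L2 f -> L2 g -> L2norm (f + g) <= L2norm f + L2norm g.
Proof.
move=> Lf Lg; have Lfg := L2D Lf Lg.
rewrite -(@ler_pXn2r _ 2)// ?nnegrE ?addr_ge0 ?L2norm_ge0//.
rewrite sqrrD !L2norm_sqr// L2innerDl// !L2innerDr// (L2innerC g f).
have := L2_cauchy_schwarz Lf Lg.
by have := ler_norm (L2inner f g); lra.
Qed.

Lemma L2normZ (a : R) f : L2 f -> L2norm (a *: f) = `|a| * L2norm f.
Proof.
move=> Lf; have La := L2Z a Lf.
apply/eqP; rewrite -(@eqrXn2 _ 2)// ?mulr_ge0 ?L2norm_ge0//.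
rewrite exprMn real_normK ?num_real// !L2norm_sqr//.
by rewrite L2innerZl// L2innerZr// mulrA expr2.
Qed.

Lemma L2norm0 : L2norm (0 : R -> R) = 0.
Proof.
by have := L2normZ 0 L2_0; rewrite scaler0 normr0 mul0r.
Qed.

Lemma L2normN f : L2 f -> L2norm (- f) = L2norm f.
Proof. by move=> Lf; rewrite -scaleN1r L2normZ// normrN normr1 mul1r. Qed.

Lemma L2normBC f g : L2 f -> L2 g -> L2norm (f - g) = L2norm (g - f).
Proof. by move=> Lf Lg; rewrite -L2normN ?opprB//; exact: L2B. Qed.

Lemma L2norm_bound f (M : R) : measurable_fun setT f -> 0 <= M ->
  (forall x, 0 < x < 1 -> `|f x| <= M) -> L2norm f <= M.
Proof.
move=> mf M0 fM; have Lf := bounded_L2 mf fM.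
rewrite -(@ler_pXn2r _ 2)// ?nnegrE ?L2norm_ge0// L2norm_sqr//.
rewrite -[leRHS]Rintegral_mu01_cst; apply: le_Rintegral_mu01.
- exact: L2_integrableM.
- apply: (@bounded_integrable_mu01 _ (M ^+ 2)); first exact: measurable_cst.
  by move=> x _; rewrite ger0_norm// sqr_ge0.
- move=> x /fM fx; rewrite -expr2 -[f x ^+ 2]real_normK ?num_real//.
  by rewrite lerXn2r// nnegrE.
Qed.

End L2_space.

(** * Completeness of L2(0, 1) *)

Section L2_completeness.
Context {R : realType}.
Local Notation mu := (mu01 R).
Implicit Types f g h : R -> R.

Let sum_geometric n : \sum_(j < n) (2^-1 ^+ j : R) <= 2.
Proof.
suff -> : \sum_(j < n) (2^-1 ^+ j : R) = 2 - 2 * 2^-1 ^+ n.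
  by rewrite lerBlDr lerDl mulr_ge0 ?exprn_ge0.
elim: n => [|n IH]; first by rewrite big_ord0 expr0 mulr1 subrr.
by rewrite big_ord_recr/= IH exprS; field.
Qed.

(** On a space of mass 1 the L1 norm is at most the L2 norm, so the sum of the increments |T_(j+1) -
    T_j| is integrable, hence finite almost everywhere, and there the telescoping series converges
    absolutely. *)
Lemma fast_cauchy_ae (T : nat -> R -> R) : (forall j, L2 (T j)) ->
  (forall j, L2norm (T j.+1 - T j) <= 2^-1 ^+ j) ->
  exists2 f : R -> R, measurable_fun setT f & {ae mu, forall x, T j x @[j --> \oo] --> f x}.
Proof.
move=> LT hT; pose h j (x : R) : R := `|T j.+1 x - T j x|.
have h0 j x : (0 <= (h j x)%:E)%E by rewrite lee_fin /h.
have LB j : L2 (T j.+1 - T j) by exact: L2B.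
have mh j : measurable_fun setT (h j).
  by apply: measurableT_comp => //; exact: (L2_mfun (LB j)).
have hint j : (\int[mu]_x (h j x)%:E <= (2^-1 ^+ j : R)%:E)%E.
  have Lh : L2 (h j).
    apply: integrable_sqr_L2 => //.
    apply: eq_integrable (L2_integrable_sqr (LB j)) => // x _ /=.
    by rewrite real_normK// num_real.
  have L1 : L2 (cst 1 : R -> R) by apply: continuous_L2 => x; exact: cvg_cst.
  have hi : mu.-integrable setT (EFin \o h j).
    have := L2_integrableM Lh L1.
    by apply: eq_integrable => // x _ /=; rewrite mulr1.
  rewrite -[leLHS]fineK ?(integrable_fin_num _ hi)// lee_fin.
  apply: le_trans (hT j).
  have -> : L2norm (T j.+1 - T j) = L2norm (h j).
    apply/eqP; rewrite -(@eqrXn2 _ 2)// ?L2norm_ge0// !L2norm_sqr//.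
    apply/eqP; apply: eq_Rintegral => x _.
    by rewrite -!expr2 real_normK// num_real.
  have n1 : L2norm (cst 1 : R -> R) <= 1.
    by apply: L2norm_bound => // x _; rewrite normr1.
  have := L2_cauchy_schwarz Lh L1.
  rewrite (_ : L2inner _ _ = fine (\int[mu]_x (h j x)%:E)); last first.
    by apply: eq_Rintegral => x _; rewrite mulr1.
  move=> /(le_trans (ler_norm _)) /le_trans; apply.
  by rewrite -[leRHS]mulr1 ler_pM ?L2norm_ge0.
have hfin : mu.-integrable setT (fun x => \sum_(0 <= j <oo) (h j x)%:E)%E.
  apply/integrableP; split.
    apply: ge0_emeasurable_sum => [j x _ _|j _]; first exact: h0.
    by apply/measurable_EFinP; exact: mh.
  under eq_integral do rewrite gee0_abs ?nneseries_ge0//.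
  rewrite integral_nneseries//; last first.
    by move=> j; apply/measurable_EFinP; exact: mh.
  apply: le_lt_trans (ltry 2); apply: lime_le.
    by apply: is_cvg_nneseries => j _ _; apply: integral_ge0 => x _; exact: h0.
  apply: nearW => n; rewrite big_mkord.
  apply: (@le_trans _ _ (\sum_(j < n) (2^-1 ^+ j : R)%:E)%E).
    by apply: lee_sum => j _; exact: hint.
  by rewrite sumEFin lee_fin sum_geometric.
(* The upper limit is measurable on the whole line and agrees with the limit wherever the latter
   exists. *)
exists (fun x => fine (limn_esup (fun j => (T j x)%:E))).
  apply/measurableT_comp => //.
  apply: measurable_fun_limn_esup => j; apply/measurable_EFinP.
  exact: (L2_mfun (LT j)).
have := integrable_ae measurableT hfin; apply: filterS => x /(_ I) xfin.
have cT : cvgn (T ^~ x).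
  have cs : cvgn (series (fun j => T j.+1 x - T j x)).
    apply: normed_cvg.
    apply: nondecreasing_is_cvgn.
      by apply: nondecreasing_series => n _ _; exact: normr_ge0.
    exists (fine (\sum_(0 <= j <oo) (h j x)%:E)%E) => _ [n _ <-].
    rewrite -lee_fin fineK// /series/= -sumEFin.
    by apply: (nneseries_lim_ge (u_ := fun j => (h j x)%:E)) => j _ _; exact: h0.
  have -> : T ^~ x = fun n => series (fun j => T j.+1 x - T j x) n + T 0%N x.
    apply/funext => n; rewrite /series/= telescope_sumr//.
    by rewrite subrK.
  by apply: is_cvgD => //; exact: is_cvg_cst.
move/cvg_ex : cT => [l Tl].
have /cvg_limn_einf_sup[_ ->] : (T j x)%:E @[j --> \oo] --> l%:E by apply: cvg_EFin => //; exact: nearW.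
exact: Tl.
Qed.

(** A fast subsequence converges almost everywhere; Fatou's lemma along it shows that its limit is
    also the L2 limit of the full sequence. *)
Lemma L2_complete (S : nat -> R -> R) : (forall n, L2 (S n)) ->
  (forall e : R, 0 < e -> exists N, forall m n, (N <= m)%N -> (N <= n)%N ->
     L2norm (S m - S n) <= e) ->
  exists2 f, L2 f & forall e : R, 0 < e -> exists N, forall n, (N <= n)%N ->
     L2norm (f - S n) <= e.
Proof.
move=> LS hS.
have /choice[phi hphi] : forall j, exists N, forall m n, (N <= m)%N ->
    (N <= n)%N -> L2norm (S m - S n) <= 2^-1 ^+ j.
  by move=> j; apply: hS; rewrite exprn_gt0.
(* The sum makes [N] nondecreasing with N j >= phi j, and the summand [j] makes it tend to
   infinity. *)
pose N j := (j + \sum_(i < j.+1) phi i)%N.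
have phiN j : (phi j <= N j)%N.
  by rewrite /N big_ord_recr/= addnA leq_addl.
have NS j : (N j <= N j.+1)%N.
  by rewrite /N [in leqRHS]big_ord_recr/= leq_add// leq_addr.
have jN j n : (N j <= n)%N -> forall m, (N j <= m)%N ->
    L2norm (S m - S n) <= 2^-1 ^+ j.
  by move=> jn m jm; apply: hphi; exact: leq_trans (phiN j) _.
have [f mf fS] := fast_cauchy_ae (fun j => LS (N j))
  (fun j => jN j (N j) (leqnn _) (N j.+1) (NS j)).
(* A bound on the distance from S n to the tail of the subsequence passes to its limit by Fatou. *)
have key n (e : R) : 0 < e -> (exists M, forall i, (M <= i)%N ->
    L2norm (S (N i) - S n) <= e) -> L2 (f - S n) /\ L2norm (f - S n) <= e.
  move=> e0 [M hM].
  have mS := L2_mfun (LS n).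
  have m2 : measurable_fun setT (fun x => (f x - S n x) ^+ 2).
    by apply: measurable_funX; exact: measurable_funB.
  have F : (\int[mu]_x ((f x - S n x) ^+ 2)%:E <= (e ^+ 2)%:E)%E.
    have -> : (\int[mu]_x ((f x - S n x) ^+ 2)%:E =
      \int[mu]_x limn_einf (fun i => ((S (N i) x - S n x) ^+ 2)%:E))%E.
      apply: ae_eq_integral => //.
      - exact/measurable_EFinP.
      - apply: measurableT_comp => //.
        apply: measurable_fun_limn_esup => i.
        apply: measurableT_comp => //; apply/measurable_EFinP.
        apply: measurable_funX; apply: measurable_funB => //.
        exact: L2_mfun.
      - apply: filterS fS => x Sf _; apply/esym.
        suff : ((S (N i) x - S n x) ^+ 2)%:E @[i --> \oo] -->
          ((f x - S n x) ^+ 2)%:E by move=> /cvg_limn_einf_sup[].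
        apply: cvg_EFin; first exact: nearW.
        by apply: cvgM; apply: cvgB => //; exact: cvg_cst.
    apply: le_trans (fatou _ _ _ _) _ => //.
    - move=> i; apply/measurable_EFinP/measurable_funX/measurable_funB => //.
      exact: L2_mfun.
    - by move=> i x _; rewrite lee_fin sqr_ge0.
    rewrite limn_einf_lim; apply: lime_le; first exact: is_cvg_einfs.
    apply: nearW => k.
    apply: (@le_trans _ _ (\int[mu]_x ((S (N (k + M)) x - S n x) ^+ 2)%:E)%E).
      by apply: ereal_inf_lbound; exists (k + M)%N => //=; rewrite leq_addr.
    have LB := L2B (LS (N (k + M)%N)) (LS n).
    rewrite -[leLHS]fineK; last exact: (integrable_fin_num _ (L2_integrable_sqr LB)).
    rewrite lee_fin.
    have := L2norm_sqr LB; rewrite /L2inner.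
    rewrite (_ : Rintegral _ _ _ = \int[mu]_x ((S (N (k + M)%N) x - S n x) ^+ 2)); last first.
      by apply: eq_Rintegral => x _; rewrite expr2.
    rewrite /Rintegral => <-; rewrite lerXn2r ?nnegrE ?L2norm_ge0 ?(ltW e0)//.
    by apply: hM; rewrite leq_addl.
  have LB : L2 (f - S n).
    apply: integrable_sqr_L2; first exact: measurable_funB.
    apply/integrableP; split; first exact/measurable_EFinP.
    apply: le_lt_trans (ltry (e ^+ 2)); apply: le_trans F.
    by under eq_integral do rewrite gee0_abs ?lee_fin ?sqr_ge0//.
  split=> //; rewrite -(@ler_pXn2r _ 2)// ?nnegrE ?L2norm_ge0 ?(ltW e0)//.
  rewrite L2norm_sqr// -lee_fin; apply: le_trans F.
  rewrite /L2inner /Rintegral fineK; last exact: (integrable_fin_num _ (L2_integrableM LB LB)).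
  by under eq_integral do rewrite -expr2.
have Nle i j : (i <= j)%N -> (N i <= N j)%N.
  by elim: j => [|j IH]; [rewrite leqn0 => /eqP ->|rewrite leq_eqVlt ltnS =>
    /predU1P[->//|/IH /leq_trans]; apply].
exists f.
  have [|Lf _] := key (N 0%N) 1 ltr01.
    exists 0%N => i _; have := jN 0%N (N 0%N) (leqnn _) (N i) (Nle _ _ (leq0n i)).
    by rewrite expr0.
  by rewrite -[f](subrK (S (N 0%N))); exact: L2D.
move=> e e0; have [M hM] := hS e e0.
exists M => n Mn; apply: (proj2 (key n e e0 _)).
by exists M => i Mi; apply: hM => //; apply: leq_trans Mi _; exact: leq_addr.
Qed.

End L2_completeness.

(** Some partial sum comes within [e] of the supremum of all of them. In this form a bound on
    partial sums yields small tails without any infinite series. *)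
Lemma bounded_sum_tail {R : realType} (u : nat -> R) (M : R) :
  (forall k, 0 <= u k) -> (forall n, \sum_(k < n) u k <= M) ->
  forall e, 0 < e -> exists N, forall n, \sum_(N <= k < n) u k <= e.
Proof.
move=> u0 uM e e0; pose s n := \sum_(k < n) u k.
have hs : has_sup (range s).
  split; first by exists (s 0%N), 0%N.
  by exists M => _ [n _ <-]; exact: uM.
have [_ [N _ <-] sN] := sup_adherent e0 hs.
exists N => n; have [nN|Nn] := leqP n N; first by rewrite big_geq// ltW.
have : s n <= sup (range s) by apply: ub_le_sup; [exact: hs.2|exists n].
rewrite /s -!(big_mkord xpredT u) (@big_cat_nat _ _ _ N)//=; last exact: ltnW.
by move: sN; rewrite /s -(big_mkord xpredT u); lra.
Qed.

(** * Orthonormal systems: Bessel, Riesz-Fischer, Parseval *)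

Section orthonormal.
Context {R : realType}.
Local Notation mu := (mu01 R).
Implicit Types f g h : R -> R.
Variable e : nat -> R -> R.
Hypothesis L2e : forall k, L2 (e k).
Hypothesis ortho : forall i j, L2inner (e i) (e j) = (i == j)%:R.

Definition psum (a : nat -> R) n : R -> R := \sum_(k < n) a k *: e k.

Lemma L2_psum a n : L2 (psum a n).
Proof. by apply: (@L2_sum _ n (fun k => a k *: e k)) => k; exact: L2Z. Qed.

Lemma psum_innerl a n f : L2 f ->
  L2inner (psum a n) f = \sum_(k < n) a k * L2inner (e k) f.
Proof.
move=> Lf; rewrite (@L2inner_suml _ n (fun k => a k *: e k))//; last first.
  by move=> k; exact: L2Z.
by apply: eq_bigr => k _; rewrite L2innerZl.
Qed.

Lemma psum_coef a n j : L2inner (psum a n) (e j) = if (j < n)%N then a j else 0.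
Proof.
rewrite psum_innerl//; under eq_bigr do rewrite ortho.
case: ifPn => jn.
  rewrite (bigD1 (Ordinal jn))//= eqxx mulr1 big1 ?addr0// => i.
  by rewrite -val_eqE/= => /negbTE ->; rewrite mulr0.
rewrite big1// => i _; case: eqP => [ij|]; last by rewrite mulr0.
by move: jn; rewrite -ij ltn_ord.
Qed.

Lemma psum_norm_sqr a n : L2norm (psum a n) ^+ 2 = \sum_(k < n) a k ^+ 2.
Proof.
rewrite L2norm_sqr; last exact: L2_psum.
rewrite psum_innerl; last exact: L2_psum.
by apply: eq_bigr => k _; rewrite L2innerC psum_coef ltn_ord expr2.
Qed.

Lemma psum_dist_sqr a n m : (n <= m)%N ->
  L2norm (psum a m - psum a n) ^+ 2 = \sum_(n <= k < m) a k ^+ 2.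
Proof.
move=> nm; pose b k := if (n <= k)%N then a k else 0.
have -> : psum a m - psum a n = psum b m.
  rewrite /psum -!(big_mkord xpredT (fun k => _ k *: e k)).
  rewrite (@big_cat_nat _ _ _ n)//= addrAC subrr add0r.
  rewrite [RHS](@big_cat_nat _ _ _ n)//= [X in _ = X + _]big_nat.
  rewrite [X in _ = X + _]big1 ?add0r; last first.
    by move=> k /= kn; rewrite /b leqNgt kn scale0r.
  by apply: eq_big_nat => k /andP[nk _]; rewrite /b nk.
rewrite psum_norm_sqr -(big_mkord xpredT (fun k => b k ^+ 2)).
rewrite (@big_cat_nat _ _ _ n)//= big_nat big1 ?add0r; last first.
  by move=> k /= kn; rewrite /b leqNgt kn expr0n.
by apply: eq_big_nat => k /andP[nk _]; rewrite /b nk.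
Qed.

Lemma bessel f n : L2 f -> \sum_(k < n) L2inner f (e k) ^+ 2 <= L2norm f ^+ 2.
Proof.
move=> Lf; set a := fun k => L2inner f (e k).
have Lp := L2_psum a n; have LB := L2B Lf Lp.
have := L2inner_ge0 (f - psum a n).
rewrite L2innerBl// !L2innerBr// -!L2norm_sqr// psum_norm_sqr.
rewrite (L2innerC f (psum _ _)) psum_innerl//.
have -> : \sum_(k < n) a k * L2inner (e k) f = \sum_(k < n) a k ^+ 2.
  by apply: eq_bigr => k _; rewrite L2innerC expr2.
rewrite -/(\sum_(k < n) a k ^+ 2); lra.
Qed.

Lemma riesz_fischer (a : nat -> R) (M : R) :
  (forall n, \sum_(k < n) a k ^+ 2 <= M) ->
  exists f, [/\ L2 f, forall k, L2inner f (e k) = a k & L2norm f ^+ 2 <= M].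
Proof.
move=> aM; have Lp := L2_psum a.
have tail := bounded_sum_tail (fun k => sqr_ge0 (a k)) aM.
have [f Lf hf] : exists2 f, L2 f & forall d : R, 0 < d -> exists N, forall n,
    (N <= n)%N -> L2norm (f - psum a n) <= d.
  apply: L2_complete => // d d0; have [N hN] := tail (d ^+ 2) (exprn_gt0 2 d0).
  have key m n : (N <= n)%N -> (n <= m)%N -> L2norm (psum a m - psum a n) <= d.
    move=> Nn nm; rewrite -(@ler_pXn2r _ 2)// ?nnegrE ?L2norm_ge0 ?(ltW d0)//.
    rewrite psum_dist_sqr//; apply: le_trans (hN m).
    rewrite [leRHS](@big_cat_nat _ _ _ n)//= lerDr sumr_ge0// => k _.
    exact: sqr_ge0.
  exists N => m n Nm Nn; have [nm|mn] := leqP n m; first exact: key.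
  by rewrite L2normBC//; apply: key => //; exact: ltnW.
exists f; split => //.
- move=> k; apply/eqP; rewrite -subr_eq0 -normr_le0; apply/ler_addgt0Pl => d d0.
  rewrite addr0; have [N hN] := hf d d0.
  have -> : L2inner f (e k) - a k = L2inner (f - psum a (maxn N k.+1)) (e k).
    by rewrite L2innerBl// psum_coef leq_maxr.
  apply: le_trans (L2_cauchy_schwarz (L2B Lf (Lp _)) (L2e k)) _.
  have -> : L2norm (e k) = 1.
    by apply/eqP; rewrite -(@eqrXn2 _ 2)// ?L2norm_ge0// L2norm_sqr// ortho eqxx expr1n.
  by rewrite mulr1; apply: hN; rewrite leq_maxl.
- have M0 : 0 <= M by have := aM 0%N; rewrite big_ord0.
  rewrite -(sqr_sqrtr M0) lerXn2r ?nnegrE ?L2norm_ge0 ?sqrtr_ge0//.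
  apply/ler_addgt0Pl => d d0; have [N hN] := hf d d0.
  rewrite -[f](subrK (psum a N)); apply: le_trans (L2normD (L2B Lf (Lp N)) (Lp N)) _.
  apply: lerD; first exact: hN.
  rewrite -(@ler_pXn2r _ 2)// ?nnegrE ?L2norm_ge0 ?sqrtr_ge0//.
  by rewrite sqr_sqrtr// psum_norm_sqr.
Qed.

Hypothesis complete : forall f, L2 f -> (forall k, L2inner f (e k) = 0) ->
  f = 0 %[ae mu].

(** Riesz-Fischer builds a function with the coefficients of [f] and squared norm at most [M];
    completeness identifies it with [f]. This is the half of Parseval's identity that Bessel's
    inequality does not give. *)
Lemma parseval_le f (M : R) : L2 f ->
  (forall n, \sum_(k < n) L2inner f (e k) ^+ 2 <= M) -> L2norm f ^+ 2 <= M.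
Proof.
move=> Lf fM.
have [g [Lg gf gM]] := @riesz_fischer (fun k => L2inner f (e k)) M fM.
suff fg : f = g %[ae mu] by rewrite (L2norm_ae Lf Lg fg).
have := complete (L2B Lf Lg).
have h : forall k, L2inner (f - g) (e k) = 0.
  by move=> k; rewrite L2innerBl// gf subrr.
move=> /(_ h); apply: filterS => x /[apply] /eqP.
by rewrite subr_eq0 => /eqP.
Qed.

End orthonormal.

(** * Trigonometric systems *)

Section calculus01.
Context {R : realType}.
Local Notation mu := (mu01 R).
Implicit Types f g F G : R -> R.

Lemma continuous_within01 f : continuous f -> {within `[0, 1], continuous f}.
Proof. exact: continuous_subspaceT. Qed.

Lemma within01_integrable f : {within `[0, 1], continuous f} ->
  lebesgue_measure.-integrable `[0, 1] (EFin \o f).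
Proof.
by move=> cf; apply: continuous_compact_integrable => //; exact: segment_compact.
Qed.

Lemma Rintegral_mu01_cc f : lebesgue_measure.-integrable `[0, 1] (EFin \o f) ->
  \int[mu]_x f x = \int[lebesgue_measure]_(x in `[0, 1]) f x.
Proof.
move=> fi; rewrite Rintegral_mu01.
have fi' : lebesgue_measure.-integrable `]0, 1] (EFin \o f).
  by apply: integrableS fi => //; apply: subset_itvr; rewrite bnd_simp.
rewrite -Rintegral_itv_obnd_cbnd//; last first.
apply: Rintegral_itv_bndo_bndc.
by apply: integrableS fi' => //; apply: subset_itvl; rewrite bnd_simp.
Qed.

Lemma FTC2_mu01 F f : {within `[0, 1], continuous f} ->
  {within `[0, 1], continuous F} ->
  (forall x : R, 0 < x < 1 -> is_derive x 1 F (f x)) ->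
  \int[mu]_x f x = F 1 - F 0.
Proof.
move=> cf cF dF; have fi := within01_integrable cf.
rewrite Rintegral_mu01_cc// /Rintegral (@continuous_FTC2 _ f F)//.
- have [cF1 cF2 cF3] := (continuous_within_itvP F ltr01).1 cF.
  by split => // x; rewrite in_itv/= => /dF [].
- by move=> x; rewrite in_itv/= => /dF d; rewrite derive1E derive_val.
Qed.

Lemma within01_RintegralD f g : {within `[0, 1], continuous f} ->
  {within `[0, 1], continuous g} ->
  \int[mu]_x (f x + g x) = \int[mu]_x f x + \int[mu]_x g x.
Proof.
move=> cf cg; rewrite !Rintegral_mu01_cc; last 3 first.
- exact: within01_integrable.
- exact: within01_integrable.
- exact: within01_integrable (within_continuousD cf cg).
by rewrite RintegralD//; exact: within01_integrable.
Qed.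

Lemma within01_RintegralZl (a : R) f : {within `[0, 1], continuous f} ->
  \int[mu]_x (a * f x) = a * \int[mu]_x f x.
Proof.
move=> cf; rewrite !Rintegral_mu01_cc; last 2 first.
- exact: within01_integrable.
- apply: within01_integrable => x; apply: cvgM; [exact: cvg_cst|exact: cf].
by rewrite RintegralZl//; exact: within01_integrable.
Qed.

Lemma within01M f g : {within `[0, 1], continuous f} ->
  {within `[0, 1], continuous g} -> {within `[0, 1], continuous (fun x => f x * g x)}.
Proof. by move=> cf cg x; apply: cvgM; [exact: cf|exact: cg]. Qed.

Lemma parts_mu01 F f G g :
  {within `[0, 1], continuous f} -> {within `[0, 1], continuous F} ->
  {within `[0, 1], continuous g} -> {within `[0, 1], continuous G} ->
  (forall x : R, 0 < x < 1 -> is_derive x 1 F (f x)) ->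
  (forall x : R, 0 < x < 1 -> is_derive x 1 G (g x)) ->
  \int[mu]_x (f x * G x) = F 1 * G 1 - F 0 * G 0 - \int[mu]_x (F x * g x).
Proof.
move=> cf cF cg cG dF dG.
have cfG := within01M cf cG; have cFg := within01M cF cg.
apply: (canRL (addrK _)); rewrite -within01_RintegralD//.
apply: (@FTC2_mu01 (fun x => F x * G x)).
- exact: within_continuousD.
- exact: within01M.
- move=> x x01; have := dF x x01; have := dG x x01 => dGx dFx.
  by apply: is_derive_eq; rewrite /GRing.scale/= addrC mulrC.
Qed.

Lemma is_derive_mulr (a y : R) : is_derive y 1 (fun y => a * y) a.
Proof.
by have := is_deriveZ a (is_derive_id y (1 : R)); rewrite /GRing.scale/= mulr1.
Qed.

Lemma is_derive_sinM (a y : R) :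
  is_derive y 1 (fun y => sin (a * y)) (a * cos (a * y)).
Proof.
have h := is_derive_mulr a y.
by apply: is_derive_eq (is_derive1_comp _ _) _; rewrite mulrC.
Qed.

Lemma is_derive_cosM (a y : R) :
  is_derive y 1 (fun y => cos (a * y)) (- a * sin (a * y)).
Proof.
have h := is_derive_mulr a y.
by apply: is_derive_eq (is_derive1_comp _ _) _; rewrite mulrC; ring.
Qed.

Lemma continuous_sinM (a : R) : continuous (fun y => sin (a * y)).
Proof.
move=> y; apply: (@continuous_comp _ _ _ (fun y => a * y) sin).
  by apply: cvgM; [exact: cvg_cst|exact: cvg_id].
exact: continuous_sin.
Qed.

Lemma continuous_cosM (a : R) : continuous (fun y => cos (a * y)).
Proof.
move=> y; apply: (@continuous_comp _ _ _ (fun y => a * y) cos).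
  by apply: cvgM; [exact: cvg_cst|exact: cvg_id].
exact: continuous_cos.
Qed.

End calculus01.

Section trigonometric_systems.
Context {R : realType}.
Local Notation mu := (mu01 R).
Implicit Types f : R -> R.

(* The frequencies are shifted by one: [om k] is (k + 1) pi, so that [sn] and
   [cs] start at the first non-constant mode and [cs1] is the complete cosine
   system. *)
Definition om (k : nat) : R := k.+1%:R * pi.
Definition sn (k : nat) (y : R) : R := Num.sqrt 2 * sin (om k * y).
Definition cs (k : nat) (y : R) : R := Num.sqrt 2 * cos (om k * y).
Definition cs1 (k : nat) : R -> R := if k is j.+1 then cs j else cst 1.

Let C (m : nat) (y : R) : R := cos (m%:R * pi * y).

Lemma om_gt0 k : 0 < om k.
Proof. by rewrite mulr_gt0// ?ltr0n// pi_gt0. Qed.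

Lemma om_ge1 k : 1 <= om k.
Proof.
rewrite -[1]mulr1 ler_pM//; first by rewrite ler1n.
by apply: le_trans (pi_ge2 R); rewrite ler1n.
Qed.

Lemma sin_natpi n : sin (n%:R * pi) = 0 :> R.
Proof.
elim: n => [|n IH]; first by rewrite mul0r sin0.
by rewrite -natr1 mulrDl mul1r sinDpi IH oppr0.
Qed.

Lemma sn0 k : sn k 0 = 0.
Proof. by rewrite /sn mulr0 sin0 mulr0. Qed.

Lemma sn1 k : sn k 1 = 0.
Proof. by rewrite /sn mulr1 sin_natpi mulr0. Qed.

Lemma is_derive_sn k (y : R) : is_derive y 1 (sn k) (om k * cs k y).
Proof.
have h := is_derive_sinM (om k) y.
have := is_deriveZ (Num.sqrt 2) h.
by rewrite /GRing.scale/= mulrCA.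
Qed.

Lemma is_derive_cs k (y : R) : is_derive y 1 (cs k) (- om k * sn k y).
Proof.
have h := is_derive_cosM (om k) y.
have := is_deriveZ (Num.sqrt 2) h.
by rewrite /GRing.scale/= mulrCA.
Qed.

Lemma continuous_sn k : continuous (sn k).
Proof. by move=> y; apply: cvgM; [exact: cvg_cst|exact: continuous_sinM]. Qed.

Lemma continuous_cs k : continuous (cs k).
Proof. by move=> y; apply: cvgM; [exact: cvg_cst|exact: continuous_cosM]. Qed.

Lemma L2_sn k : L2 (sn k). Proof. exact/continuous_L2/continuous_sn. Qed.

Lemma L2_cs k : L2 (cs k). Proof. exact/continuous_L2/continuous_cs. Qed.

Lemma L2_cst (c : R) : L2 (cst c).
Proof. by apply: continuous_L2 => x; exact: cvg_cst. Qed.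

Lemma L2_cs1 k : L2 (cs1 k).
Proof. by case: k => [|k]; [exact: L2_cst|exact: L2_cs]. Qed.

Let cC m : continuous (C m). Proof. exact: continuous_cosM. Qed.

Let intC m : \int[mu]_y C m y = (m == 0)%:R.
Proof.
case: m => [|m].
  rewrite -[RHS]Rintegral_mu01_cst; apply: eq_Rintegral => y _.
  by rewrite /C !mul0r cos0.
pose F y : R := (om m)^-1 * sin (om m * y).
transitivity (F 1 - F 0); last first.
  by rewrite /F mulr1 mulr0 sin0 sin_natpi !mulr0 subrr.
apply: FTC2_mu01.
- exact/continuous_within01/cC.
- apply: continuous_within01 => y; apply: cvgM; first exact: cvg_cst.
  exact: continuous_sinM.
- move=> y _; have h := is_derive_sinM (om m) y.
  have := is_deriveZ (om m)^-1 h; rewrite /GRing.scale/= mulKf//.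
  exact/lt0r_neq0/om_gt0.
Qed.

Let CD i j y : C (i + j) y = C i y * C j y - sin (i%:R * pi * y) * sin (j%:R * pi * y).
Proof. by rewrite /C natrD !mulrDl cosD. Qed.

Let CB i j y : (j <= i)%N ->
  C (i - j) y = C i y * C j y + sin (i%:R * pi * y) * sin (j%:R * pi * y).
Proof. by move=> ji; rewrite /C natrB// !mulrBl cosB. Qed.

Let int_half (a b : nat) (s : R) :
  \int[mu]_y (C a y + s * C b y) = (a == 0)%:R + s * (b == 0)%:R.
Proof.
have cs b' : {within `[0, 1], continuous (fun y => s * C b' y)}.
  by apply: continuous_within01 => y; apply: cvgM; [exact: cvg_cst|exact: cC].
rewrite (@within01_RintegralD _ (C a) (fun y => s * C b y))//; last first.
  exact/continuous_within01/cC.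
rewrite within01_RintegralZl ?intC//.
exact/continuous_within01/cC.
Qed.

Let sqrt2_sqr : Num.sqrt 2 * Num.sqrt 2 = 2 :> R.
Proof. by rewrite -expr2 sqr_sqrtr. Qed.

(** The product-to-sum formula leaves the cosines of modes i - j and i + j + 2, and only mode 0 has
    a nonzero mean. The order of [i] and [j] matters because the subtraction is taken in nat. *)
Lemma sn_ortho i j : L2inner (sn i) (sn j) = (i == j)%:R :> R.
Proof.
wlog ij : i j / (j <= i)%N.
  move=> h; have [ji|ij] := leqP j i; first exact: h.
  by rewrite L2innerC eq_sym h// ltnW.
rewrite /L2inner (_ : (fun _ => _) =
    (fun y => C (i.+1 - j.+1) y + (- 1) * C (i.+1 + j.+1) y)); last first.
  apply/funext => y; rewrite CD CB//.
  transitivity (Num.sqrt 2 * Num.sqrt 2 * (sin (om i * y) * sin (om j * y)) : R).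
    by rewrite /sn; ring.
  by rewrite sqrt2_sqr /om; ring.
rewrite int_half addnS/= mulr0 addr0 subn_eq0 ltnS.
by rewrite eqn_leq ij andbT.
Qed.

Lemma cs1_ortho i j : L2inner (cs1 i) (cs1 j) = (i == j)%:R :> R.
Proof.
have cs10 k : L2inner (cs k) (cst 1) = 0 :> R.
  rewrite /L2inner (_ : (fun _ => _) = (fun y => Num.sqrt 2 * C k.+1 y)); last first.
    by apply/funext => y; rewrite mulr1.
  by rewrite within01_RintegralZl ?intC ?mulr0//; exact/continuous_within01/cC.
wlog ij : i j / (j <= i)%N.
  move=> h; have [ji|ij] := leqP j i; first exact: h.
  by rewrite L2innerC eq_sym h// ltnW.
case: i j ij => [|i] [|j] //=.
- move=> _; rewrite /L2inner -[RHS]Rintegral_mu01_cst.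
  by apply: eq_Rintegral => y _; rewrite mulr1.
move=> ij; rewrite /L2inner (_ : (fun _ => _) =
    (fun y => C (i.+1 - j.+1) y + 1 * C (i.+1 + j.+1) y)); last first.
  apply/funext => y; rewrite CD CB//.
  transitivity (Num.sqrt 2 * Num.sqrt 2 * (cos (om i * y) * cos (om j * y)) : R).
    by rewrite /cs; ring.
  by rewrite sqrt2_sqr /om /C; ring.
rewrite int_half addnS/= mulr0 addr0 subn_eq0 ltnS eqSS.
by rewrite [in RHS]eqn_leq -[(j <= i)%N]ltnS ij andbT.
Qed.

End trigonometric_systems.

(** * Completeness of the cosine and sine systems *)

Section trigonometric_completeness.
Context {R : realType}.
Local Notation mu := (mu01 R).
Implicit Types f : R -> R.

(* The polynomials (1 - x^n)^(2^n) converge boundedly to the indicator of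
   [0, 1/2[ off 1/2, which replaces the Weierstrass theorem. *)
Definition step_poly n (x : R) := (1 - x ^+ n) ^+ (2 ^ n).

Lemma step_poly_bound n (x : R) : 0 <= x <= 1 -> 0 <= step_poly n x <= 1.
Proof.
move=> /andP[x0 x1]; have xn0 : 0 <= x ^+ n by rewrite exprn_ge0.
have xn1 : x ^+ n <= 1 by rewrite exprn_ile1.
by rewrite /step_poly exprn_ge0 ?exprn_ile1//; lra.
Qed.

Let bernoulli (y : R) n : -1 <= y -> 1 + n%:R * y <= (1 + y) ^+ n.
Proof.
move=> y1; elim: n => [|n IH]; first by rewrite mul0r addr0 expr0.
rewrite exprS; have := ler_wpM2l (_ : 0 <= 1 + y) IH; rewrite -natr1.
have y2 := sqr_ge0 y; rewrite expr2 in y2.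
have : 0 <= n%:R * (y * y) by rewrite mulr_ge0.
by move=> ? h; apply: le_trans (h _); [|lra]; nra.
Qed.

(** Bernoulli's inequality gives 1 - (2 x)^n as a lower bound. *)
Lemma step_poly_cvg1 (x : R) : 0 <= x < 2^-1 -> step_poly n x @[n --> \oo] --> (1 : R).
Proof.
move=> /andP[x0 xh]; have x1 : x <= 1 by lra.
apply: (@squeeze_cvgr _ _ _ _ (fun n => 1 - (2 * x) ^+ n) (cst 1)).
- apply: nearW => n; rewrite (andP (step_poly_bound n _)).2 ?x0// andbT.
  have := @bernoulli (- x ^+ n) (2 ^ n) _; rewrite /step_poly => h.
  apply: le_trans (h _); last by rewrite lerN2 exprn_ile1.
  by rewrite exprMn natrX mulrN.
- rewrite -[X in _ --> X]subr0; apply: cvgB; first exact: cvg_cst.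
  by apply: cvg_expr; rewrite ger0_norm; lra.
- exact: cvg_cst.
Qed.

(** The product of (1 - x^n)^(2^n) and (1 + x^n)^(2^n) is at most 1, and by Bernoulli the second
    factor is at least (2 x)^n. *)
Lemma step_poly_cvg0 (x : R) : 2^-1 < x <= 1 -> step_poly n x @[n --> \oo] --> (0 : R).
Proof.
move=> /andP[xh x1]; have x0 : 0 <= x by lra.
apply: (@squeeze_cvgr _ _ _ _ (cst 0) (fun n => (2 * x)^-1 ^+ n)).
- apply: nearW => n; rewrite (andP (step_poly_bound n _)).1 ?x0//=.
  have xn0 : 0 <= x ^+ n by rewrite exprn_ge0.
  have xn1 : x ^+ n <= 1 by rewrite exprn_ile1.
  have h1 := @bernoulli (x ^+ n) (2 ^ n) (le_trans _ xn0).
  rewrite exprVn -[leRHS]mul1r ler_pdivlMr ?exprn_gt0//; last lra.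
  apply: (@le_trans _ _ (step_poly n x * (1 + x ^+ n) ^+ (2 ^ n))).
    apply: ler_wpM2l; first by rewrite (andP (step_poly_bound n _)).1 ?x0.
    by apply: le_trans (h1 _); [rewrite exprMn natrX lerDr|lra].
  rewrite /step_poly -exprMn exprn_ile1//; nra.
- exact: cvg_cst.
- by apply: cvg_expr; rewrite ger0_norm ?invr_ge0 ?invf_lt1; lra.
Qed.

Lemma cvg_expn {T : Type} {F : set_system T} {FF : Filter F} (f : T -> R) (l : R) n :
  f x @[x --> F] --> l -> f x ^+ n @[x --> F] --> l ^+ n.
Proof. by move=> fl; exact: cvg_comp fl (@exprn_continuous R n l). Qed.

Lemma ae_in01 : {ae mu, forall x, 0 < x < 1}.
Proof. exact: ae_mu01. Qed.

(** The primitive from -oo of the extension of [f] by zero vanishes identically, and Lebesgue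
    differentiation recovers the extension from it almost everywhere. *)
Lemma zero_primitive_ae f : L2 f ->
  (forall a : R, 0 <= a < 1 ->
    \int[lebesgue_measure]_(y in `]a, 1[) f y = 0) -> f = 0 %[ae mu].
Proof.
move=> Lf f0; pose g := f \_ (`]0, 1[ : set R).
have fi01 : lebesgue_measure.-integrable `]0, 1[ (EFin \o f).
  by apply/integrable_lebesgue01/Lfun1_integrable; apply: Lfun_subset12 => //=;
    rewrite mu01_setT.
have giT : lebesgue_measure.-integrable setT (EFin \o g).
  by rewrite /g -restrict_EFin; apply/(integrable_mkcond _ _).1.
have gi (y : R) : lebesgue_measure.-integrable `]-oo, y] (EFin \o g).
  exact: integrableS giT.
have F0 (x : R) : \int[lebesgue_measure]_(t in `]-oo, x]) g t = 0.
  rewrite /g -Rintegral_mkcondr; have [x0|x0] := leP x 0.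
    rewrite (_ : _ `&` _ = set0) ?Rintegral_set0//.
    apply/seteqP; split => // y []/=; rewrite !in_itv/= => yx /andP[y0 _].
    by have := lt_le_trans y0 (le_trans yx x0); rewrite ltxx.
  have [x1|x1] := leP 1 x.
    rewrite (_ : _ `&` _ = `]0, 1[%classic); first by rewrite f0 ?lexx ?ltr01.
    apply/seteqP; split => [y []//|y /= y01]; split => //; move: y01.
    by rewrite !in_itv/= => /andP[_ y1]; exact: ltW (lt_le_trans y1 x1).
  rewrite (_ : _ `&` _ = `]0, x]%classic); last first.
    apply/seteqP; split => y /=; rewrite !in_itv/=.
      by move=> [-> /andP[->]].
    by move=> /andP[-> yx]; rewrite yx (le_lt_trans yx x1).
  have := @Rintegral_itvB R f (BRight 0) (BLeft 1) x fi01.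
  rewrite !bnd_simp (ltW x0) x1 => /(_ isT isT).
  rewrite (f0 0) ?lexx ?ltr01// (f0 x) ?(ltW x0)// sub0r.
  by move/eqP; rewrite oppr_eq0 => /eqP.
have := FTC1Ny gi (integrable_locally (measurable_itv `]0, 1[) fi01).
rewrite (_ : (fun x : R => _) = cst 0); last by apply/funext => x; rewrite -(F0 x).
move=> [N [mN N0 hN]].
have g0 : {ae mu, forall x, g x = 0}.
  exists N; split => //.
    apply/eqP; rewrite eq_le measure_ge0 andbT -N0 /= /mrestr.
    by apply: le_measure; rewrite ?inE//; exact: measurableI.
  apply: subset_trans hN => x /= gx [_]; rewrite derive1_cst => g0x.
  by apply: gx.
have := ae_in01; apply: filterS2 g0 => x + x01 _.
by rewrite /g patchE mem_set//= in_itv.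
Qed.

Lemma L2M_bounded f g (M : R) : L2 f -> measurable_fun setT g ->
  (forall x : R, `|g x : R| <= M) -> L2 (fun x => f x * g x).
Proof.
move=> Lf mg gM; have mf := L2_mfun Lf.
apply: integrable_sqr_L2; first exact: measurable_funM.
have := L2_integrable_sqr (L2Z M Lf); apply: le_integrable => //.
  by apply/measurable_EFinP; apply: measurable_funX; exact: measurable_funM.
move=> x _ /=; rewrite lee_fin !normrX lerXn2r ?nnegrE//.
rewrite !normrM mulrC ler_wpM2r//.
exact: le_trans (gM x) (ler_norm _).
Qed.

(** Induction on [n] for all [m] at once: the product-to-sum formula absorbs one factor cos(pi y)
    into the modes m + 1 and m - 1. With m = 0 this covers all polynomials in cos(pi y). *)
Lemma cos_power_orthogonal f (n m : nat) : L2 f ->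
  (forall k, L2inner f (cs1 k) = 0) ->
  L2inner f (fun y => cos (pi * y) ^+ n * cos (m%:R * pi * y)) = 0.
Proof.
move=> Lf f0; pose G n m (y : R) : R := cos (pi * y) ^+ n * cos (m%:R * pi * y).
have LG i j : L2 (G i j).
  apply: continuous_L2 => y; apply: cvgM; last exact: continuous_cosM.
  by apply: cvg_expn; exact: continuous_cosM.
rewrite -/(G n m); elim: n m => [|n IH] [|m].
- rewrite -(f0 0%N); apply: eq_Rintegral => y _.
  by rewrite /G expr0 !mul0r cos0 mulr1.
- have s2 : Num.sqrt 2 != 0 :> R by rewrite gt_eqF// sqrtr_gt0.
  have -> : G 0%N m.+1 = (Num.sqrt 2)^-1 *: cs1 m.+1.
    apply/funext => y.
    change (G 0%N m.+1 y = (Num.sqrt 2)^-1 * (Num.sqrt 2 * cos (om m * y))).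
    by rewrite mulKf// /G expr0 mul1r.
  by rewrite L2innerZr ?f0 ?mulr0//; exact: L2_cs1.
- rewrite -(IH 1%N); apply: eq_Rintegral => y _; congr (_ * _).
  by rewrite /G exprSr !mul0r cos0 mulr1 mul1r.
- have -> : G n.+1 m.+1 = 2^-1 *: (G n m.+2 + G n m).
    apply/funext => y.
    change (G n.+1 m.+1 y = 2^-1 * (G n m.+2 y + G n m y)); rewrite /G.
    have -> : m.+2%:R * pi * y = m.+1%:R * pi * y + pi * y by rewrite -[in LHS]natr1; ring.
    have -> : m%:R * pi * y = m.+1%:R * pi * y - pi * y by rewrite -[in RHS]natr1; ring.
    by rewrite cosD cosB exprSr; field.
  rewrite L2innerZr//; last exact: L2D.
  by rewrite L2innerDr// !IH addr0 mulr0.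
Qed.

Lemma poly_cos_orthogonal f (p : {poly R}) : L2 f ->
  (forall k, L2inner f (cs1 k) = 0) ->
  L2inner f (fun y => p.[cos (pi * y)]) = 0.
Proof.
move=> Lf f0; pose G n (y : R) : R := p`_n * cos (pi * y) ^+ n.
have LG n : L2 (G n).
  apply: continuous_L2 => y; apply: cvgM; first exact: cvg_cst.
  by apply: cvg_expn; exact: continuous_cosM.
rewrite (_ : (fun _ => _) = \sum_(i < size p) G i); last first.
  by apply/funext => y; rewrite horner_coef fct_sumE.
rewrite L2innerC L2inner_suml// big1// => i _; rewrite L2innerC.
have L1 : L2 (fun y : R => cos (pi * y) ^+ i * cos (0%:R * pi * y)).
  apply: continuous_L2 => y; apply: cvgM; last exact: continuous_cosM.
  by apply: cvg_expn; exact: continuous_cosM.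
have -> : G i = p`_i *: (fun y : R => cos (pi * y) ^+ i * cos (0%:R * pi * y)).
  by apply/funext => y; rewrite /G /GRing.scale/= !mul0r cos0 mulr1.
by rewrite L2innerZr// cos_power_orthogonal// mulr0.
Qed.

(** Polynomials in cos(pi y) approximate the indicator of ]a, 1[ boundedly, so [f] has integral zero
    over every such interval by dominated convergence. *)
Lemma cs1_complete f : L2 f -> (forall k, L2inner f (cs1 k) = 0) ->
  f = 0 %[ae mu].
Proof.
move=> Lf f0; apply: zero_primitive_ae => // a /andP[a0 a1].
have fi : mu.-integrable setT (EFin \o f).
  by apply/Lfun1_integrable; apply: Lfun_subset12 => //=; rewrite mu01_setT.
have mf := L2_mfun Lf.
have pi0 := pi_gt0 R.
pose t : R := cos (pi * a).
(* An affine function of cos(pi y) that passes 1/2 exactly at y = a and lies below 1/2 for y > a.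
   Division by 4 keeps it in [0, 1], as two cosines differ by at most 2. *)
pose x (y : R) : R := 2^-1 + (cos (pi * y) - t) / 4.
have x01 y : 0 <= x y <= 1.
  have := cos_geN1 (pi * y); have := cos_le1 (pi * y).
  have := cos_geN1 (pi * a); have := cos_le1 (pi * a).
  by rewrite /x /t => *; apply/andP; split; lra.
pose F n (y : R) : R := f y * step_poly n (x y).
have mstep n : measurable_fun setT (fun y : R => step_poly n (x y)).
  apply: continuous_measurable_fun => y; apply: cvg_expn; apply: cvgB; first exact: cvg_cst.
  apply: cvg_expn; apply: cvgD; first exact: cvg_cst.
  apply: cvgM; last exact: cvg_cst.
  by apply: cvgB; [exact: continuous_cosM|exact: cvg_cst].
have F0 n : \int[mu]_y F n y = 0.
  pose p := (1 - ((2^-1 - t / 4)%:P + (4^-1)%:P * 'X) ^+ n) ^+ (2 ^ n) : {poly R}.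
  rewrite -[RHS](poly_cos_orthogonal p Lf f0); apply: eq_Rintegral => y _.
  rewrite /F /step_poly /p !hornerE; congr (_ * (_ - _ ^+ _) ^+ _).
  by rewrite /x; field.
have mF n : measurable_fun setT (F n) by exact: measurable_funM.
have [| | | | |_ _] := @dominated_convergence _ _ _ mu setT measurableT
  (fun n y => (F n y)%:E) (EFin \o (f \_ (`]a, 1[ : set R))) (fun y => `|f y|%:E).
- by move=> n; apply/measurable_EFinP; exact: mF.
- apply/measurable_EFinP/(measurable_restrictT _ _).1 => //.
  exact: measurable_funS mf.
- have aN : {ae mu, forall y : R, y != a}.
    exists [set a]; split; first exact: measurable_set1.
      apply/eqP; rewrite eq_le measure_ge0 andbT -(lebesgue_measure_set1 a) /= /mrestr.
      by apply: le_measure; rewrite ?inE//; apply: measurableI => //; exact: measurable_set1.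
    by move=> y /= /negP; rewrite negbK => /eqP.
  have := ae_in01.
  apply: filterS2 aN => y ya /andP[y0 y1] _; apply: cvg_EFin; first exact: nearW.
  rewrite patchE; have piy (z : R) : 0 <= z < 1 -> pi * z \in `[0, pi].
    move=> /andP[z0 z1]; rewrite in_itv/= mulr_ge0 ?(ltW pi0)//=.
    by rewrite -[leRHS]mulr1 ler_pM2l// ltW.
  have [ay|ay] := ltP a y.
    rewrite mem_set; last by rewrite /= in_itv/= ay.
    suff : F n y @[n --> \oo] --> f y * 1 by rewrite mulr1.
    apply: cvgM; first exact: cvg_cst.
    apply: step_poly_cvg1; rewrite (andP (x01 y)).1 /= /x /t.
    have : cos (pi * y) < cos (pi * a).
      by rewrite ltr_cos ?piy ?a0 ?a1 ?y1 ?ltW// ltr_pM2l.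
    lra.
  rewrite memNset; last by rewrite /= in_itv/= ltNge ay.
  suff : F n y @[n --> \oo] --> f y * 0 by rewrite mulr0.
  apply: cvgM; first exact: cvg_cst.
  apply: step_poly_cvg0; rewrite (andP (x01 y)).2 andbT /x /t.
  have : cos (pi * a) < cos (pi * y).
    by rewrite ltr_cos ?piy ?a0 ?a1 ?y1 ?ltW// ltr_pM2l// lt_neqAle ya.
  lra.
- exact: integrable_norm.
- apply: aeW => y n _; rewrite lee_fin normrM -[leRHS]mulr1 ler_wpM2l//.
  have /andP[s0 s1] := step_poly_bound n (x01 y).
  by rewrite ger0_norm.
have Fi n : mu.-integrable setT (EFin \o F n).
  have := fi; apply: le_integrable => //; first by apply/measurable_EFinP; exact: mF.
  move=> y _; rewrite lee_fin normrM -[leRHS]mulr1 ler_wpM2l//.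
  have /andP[s0 s1] := step_poly_bound n (x01 y).
  by rewrite ger0_norm.
rewrite (_ : [sequence _]_n = cst 0%E); last first.
  apply/funext => n /=; have := F0 n.
  by rewrite /Rintegral -[X in _ -> X = _]fineK ?(integrable_fin_num _ (Fi n))// => ->.
move=> /(cvg_unique _ (cvg_cst 0%E))-/(_ _)/esym; rewrite integral_mu01 => h.
rewrite (_ : `]a, 1[%classic = `]0, 1[ `&` `]a, 1[); last first.
  apply/seteqP; split => y /=; rewrite !in_itv/=; last by case.
  by move=> /andP[ay ->]; rewrite ay (le_lt_trans a0 ay).
rewrite Rintegral_mkcondr /Rintegral.
by move: h; rewrite /comp => -> //.
Qed.

(** The product of [f] with sin(pi y) is orthogonal to all cosines, since sin(pi y) cos((k + 1) pi
    y) is half the difference of the sines of modes k + 2 and k. As sin(pi y) > 0 on ]0, 1[, [f]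
    itself vanishes. *)
Lemma sn_complete f : L2 f -> (forall k, L2inner f (sn k) = 0) ->
  f = 0 %[ae mu].
Proof.
move=> Lf f0; pose g (y : R) : R := f y * sin (pi * y).
have Lg : L2 g.
  apply: (@L2M_bounded _ _ 1) => // [|x]; last exact: sin_max.
  by apply: continuous_measurable_fun; exact: continuous_sinM.
have f0' m : \int[mu]_y (f y * sin (m%:R * pi * y)) = 0.
  case: m => [|m].
    rewrite -[RHS]Rintegral_mu01_cst; apply: eq_Rintegral => y _.
    by rewrite !mul0r sin0 mulr0.
  have : L2inner f ((Num.sqrt 2)^-1 *: sn m) = 0.
    by rewrite L2innerZr ?f0 ?mulr0//; exact: L2_sn.
  move=> <-; apply: eq_Rintegral => y _; congr (_ * _).
  change (sin (m.+1%:R * pi * y) =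
    (Num.sqrt 2)^-1 * (Num.sqrt 2 * sin (om m * y))).
  by rewrite mulKf// gt_eqF.
have Ls m : L2 (fun y : R => sin (m%:R * pi * y)).
  exact/continuous_L2/continuous_sinM.
have := cs1_complete Lg; have h k : L2inner g (cs1 k) = 0.
  case: k => [|k].
    rewrite -[RHS](f0' 1%N); apply: eq_Rintegral => y _.
    by rewrite /g mulr1 mul1r.
  have -> : L2inner g (cs1 k.+1) = L2inner f ((Num.sqrt 2 / 2) *:
      ((fun y : R => sin (k.+2%:R * pi * y)) - (fun y : R => sin (k%:R * pi * y)))).
    apply: eq_Rintegral => y _; rewrite /g -mulrA; congr (_ * _).
    change (sin (pi * y) * (Num.sqrt 2 * cos (k.+1%:R * pi * y)) =
      Num.sqrt 2 / 2 * (sin (k.+2%:R * pi * y) - sin (k%:R * pi * y))).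
    have -> : k.+2%:R * pi * y = k.+1%:R * pi * y + pi * y by rewrite -[in LHS]natr1; ring.
    have -> : k%:R * pi * y = k.+1%:R * pi * y - pi * y by rewrite -[in RHS]natr1; ring.
    by rewrite sinD sinB; field.
  rewrite L2innerZr//; last exact: L2B.
  by rewrite L2innerBr// /L2inner !f0' subrr mulr0.
move=> /(_ h) g0; have := ae_in01.
apply: filterS2 g0 => y /(_ I) gy0 y01 _; apply/eqP.
have /eqP := gy0; rewrite /g mulf_eq0 => /orP[//|].
rewrite gt_eqF// sin_gt0_pi//; have := pi_gt0 R; move: y01 => /andP[y0 y1] p0.
by rewrite mulr_gt0// -[ltRHS]mulr1 ltr_pM2l.
Qed.

End trigonometric_completeness.

(** * Smooth functions and a smooth transition from 0 to 1 *)

Section smooth_functions.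
Context {R : realType}.
Implicit Types f g : R -> R.

(** Taking the first derivative and recursing on it, instead of differentiating the n-th derivative
    once more, lets sums, products and inverses be treated by induction on [n]. *)
Fixpoint smooth n f : Prop :=
  if n is m.+1 then (forall y : R, derivable f y 1) /\ smooth m (derive1 f) else True.

Lemma smoothP f : (forall n, smooth n f) <-> (forall n y, derivable (derive1n n f) y 1).
Proof.
have h n : forall f, smooth n f <-> (forall m, (m < n)%N -> forall y, derivable (derive1n m f) y 1).
  elim: n => [|n IH] g //=; split.
  - move=> [dg /IH sg] [|m] mn; first exact: dg.
    by rewrite derive1Sn; exact: sg.
  - move=> hg; split; first exact: (hg 0%N).
    by apply/IH => m mn y; rewrite -derive1Sn; exact: hg.
split=> [sf n y|df n]; last by apply/h => m _; exact: df.
by have /h := sf n.+1; apply.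
Qed.

Lemma smooth_is_derive n f g : (forall y : R, is_derive y 1 f (g y)) -> smooth n g -> smooth n.+1 f.
Proof.
move=> fg sg; split; first by move=> y; have [] := fg y.
suff -> : derive1 f = g by [].
by apply/funext => y; rewrite derive1E; have fgy := fg y; rewrite derive_val.
Qed.

Lemma derivable_is_derive1 f (y : R) : derivable f y 1 -> is_derive y 1 f (derive1 f y).
Proof. by move=> df; apply: DeriveDef => //; rewrite derive1E. Qed.

Lemma smoothW n f : smooth n.+1 f -> smooth n f.
Proof.
by elim: n f => [//|n IH] f [df sf]; split=> //; exact: IH.
Qed.

Lemma smooth_cst n (c : R) : smooth n (cst c).
Proof.
elim: n c => [//|n IH] c; apply: (@smooth_is_derive _ _ (cst 0)) => //.
Qed.

Lemma smoothD n f g : smooth n f -> smooth n g -> smooth n (fun y => f y + g y).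
Proof.
elim: n f g => [//|n IH] f g [df sf] [dg sg].
apply: (@smooth_is_derive _ _ (fun y => derive1 f y + derive1 g y)); last exact: IH.
move=> y; have f' := derivable_is_derive1 (df y).
by have g' := derivable_is_derive1 (dg y); exact: is_deriveD.
Qed.

Lemma smoothM n f g : smooth n f -> smooth n g -> smooth n (fun y => f y * g y).
Proof.
elim: n f g => [//|n IH] f g sf sg; have [df sf'] := sf; have [dg sg'] := sg.
apply: (@smooth_is_derive _ _ (fun y => f y * derive1 g y + g y * derive1 f y)).
  move=> y; have f' := derivable_is_derive1 (df y).
  by have g' := derivable_is_derive1 (dg y); exact: is_deriveM.
by apply: smoothD; apply: IH => //; exact: smoothW.
Qed.

Lemma smoothV n f : (forall y, f y != 0) -> smooth n f -> smooth n (fun y => (f y)^-1).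
Proof.
move=> f0; elim: n => [//|n IH] sf; have [df sf'] := sf.
(* The sign and the inverse square are spelled out as products, so that closure under products
   finishes the induction. *)
pose g (y : R) : R := - 1 * derive1 f y * ((f y)^-1 * (f y)^-1).
have dV (y : R) : is_derive y 1 (fun y => (f y)^-1) (g y).
  have f' := derivable_is_derive1 (df y).
  have h := is_deriveV (f0 y) f'; apply: is_derive_eq h _.
  change (- f y ^- 2 * derive1 f y = g y); rewrite /g expr2 invfM.
  by move: (derive1 f y) ((f y)^-1) => u v; ring.
apply: (smooth_is_derive dV).
have IH' := IH (smoothW sf).
by apply: smoothM; apply: smoothM => //; exact: smooth_cst.
Qed.

Lemma is_derive_affine (a b y : R) : is_derive y 1 (fun y => a * y + b) a.
Proof.
have h := is_derive_mulr a y; have h' := is_derive_cst b y (1 : R).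
by have := is_deriveD h h'; rewrite addr0.
Qed.

Lemma is_derive_comp_affine f (a b y : R) : derivable f (a * y + b) 1 ->
  is_derive y 1 (fun y => f (a * y + b)) (a * derive1 f (a * y + b)).
Proof.
move=> df; have f' := derivable_is_derive1 df; have g' := is_derive_affine a b y.
have h := @is_derive1_comp R f (fun y => a * y + b) y _ _ f' g'.
apply: is_derive_eq h _.
by rewrite mulrC.
Qed.

Lemma smooth_affine n f (a b : R) : smooth n f -> smooth n (fun y => f (a * y + b)).
Proof.
elim: n f => [//|n IH] f [df sf].
apply: (@smooth_is_derive _ _ (fun y => a * derive1 f (a * y + b))).
  by move=> y; exact: is_derive_comp_affine.
by apply: smoothM; [exact: smooth_cst|exact: IH].
Qed.

(** For m = 0 this is the classical function exp(- 1 / t), flat at the origin. The powers of 1 / t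
    make the family stable under differentiation up to linear combinations. *)
Definition flat m (t : R) : R := if 0 < t then t^-1 ^+ m * expR (- t^-1) else 0.

Lemma flat_ge0 m t : 0 <= flat m t.
Proof.
rewrite /flat; case: ifPn => // t0.
by rewrite mulr_ge0 ?expR_ge0// exprn_ge0// invr_ge0 ltW.
Qed.

Lemma flat_gt0 t : 0 < t -> 0 < flat 0 t.
Proof. by move=> t0; rewrite /flat t0 expr0 mul1r expR_gt0. Qed.

(** The term of order m + 1 of the exponential series at 1 / t is at most exp(1 / t). The linear
    bound gives continuity at 0. *)
Lemma flat_le m t : flat m t <= m.+1`!%:R * `|t|.
Proof.
rewrite /flat; case: ifPn => [t0|_]; last by rewrite mulr_ge0.
have u0 : 0 <= t^-1 by rewrite invr_ge0 ltW.
rewrite expRN ler_pdivrMr ?expR_gt0// gtr0_norm//.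
have := expR_ge1Dxn m u0 => h.
have -> : t^-1 ^+ m = m.+1`!%:R * t * (t^-1 ^+ m.+1 / m.+1`!%:R).
  by rewrite exprS; field; rewrite !gt_eqF.
apply: ler_wpM2l; first by rewrite mulr_ge0// ltW.
by apply: le_trans h; rewrite lerDr.
Qed.

Lemma flatS m t : flat m t = flat m.+1 t * t.
Proof.
rewrite /flat; case: ifPn => [t0|_]; last by rewrite mul0r.
by rewrite exprS; field; rewrite gt_eqF.
Qed.

Lemma is_derive_flat m (t : R) :
  is_derive t 1 (flat m) (flat m.+2 t + (- m%:R) * flat m.+1 t).
Proof.
have [t0|t0|->] := ltgtP t 0.
- rewrite /flat !ltNge (ltW t0)/= mulr0 addr0.
  apply: (@near_eq_is_derive _ _ _ (cst 0 : R -> R)).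
  near=> y; rewrite /flat ltNge (ltW _)//.
  by near: y; exact: lt_nbhsl.
- have tN0 : t != 0 by rewrite gt_eqF.
  have hv : is_derive t 1 (fun y : R => y^-1) (- t ^- 2).
    have := is_deriveV tN0 (is_derive_id t (1 : R)).
    by rewrite /GRing.scale/= mulr1.
  have h1 := is_deriveX m hv.
  have h2 := @is_derive1_comp R expR (fun y => - y^-1) t _ _
    (is_derive_expR (- t^-1)) (is_deriveN hv).
  have h3 := is_deriveM h1 h2.
  have hn : \near t, ((fun y : R => y^-1) ^+ m *
      (expR \o (fun y : R => - y^-1))) t = flat m t.
    near=> y; rewrite /flat ifT ?fctE ?exprfctE//.
    by near: y; exact: lt_nbhsr.
  apply: (near_eq_is_derive hn).
  apply: is_derive_eq h3 _; rewrite /flat t0 /GRing.scale/=.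
  rewrite exprfctE -!exprVn {hn h1 h2 hv}.
  move: (t^-1) => u; move: (expR (- u)) => E; case: m => [|m] /=.
    by rewrite mulr0n; ring.
  by rewrite !exprS; ring.
(* At the origin the difference quotient of [flat m] is [flat m.+1], which is continuous there with
   value 0 by [flat_le]. *)
- rewrite /flat !ltxx mulr0 addr0; apply/is_derive1_caratheodory.
  exists (flat m.+1); split.
  + by move=> z; rewrite /flat ltxx !subr0; exact: flatS.
  + rewrite /prop_for /continuous_at [X in _ --> X](_ : _ = 0); last by rewrite /flat ltxx.
    apply: (@squeeze_cvgr _ _ _ _ (cst 0) (fun t => m.+2`!%:R * `|t|)).
    * by apply: nearW => y; rewrite flat_ge0 flat_le.
    * exact: cvg_cst.
    * rewrite -[X in _ --> X](mulr0 m.+2`!%:R); apply: cvgM; first exact: cvg_cst.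
      by have := @norm_continuous _ R 0; rewrite /continuous_at normr0; exact.
  + by rewrite /flat ltxx.
Unshelve. all: by end_near. Qed.

Lemma smooth_flat n m : smooth n (flat m).
Proof.
elim: n m => [//|n IH] m.
apply: (@smooth_is_derive _ _ (fun t => flat m.+2 t + (- m%:R) * flat m.+1 t)).
  by move=> y; exact: is_derive_flat.
by apply: smoothD => //; apply: smoothM => //; exact: smooth_cst.
Qed.

Definition smooth_step (t : R) : R := flat 0 t / (flat 0 t + flat 0 ((- 1) * t + 1)).

Let denom_gt0 t : 0 < flat 0 t + flat 0 ((- 1) * t + 1).
Proof.
have [t0|t0] := ltP 0 t; first by rewrite ltr_wpDr// ?flat_ge0// flat_gt0.
by rewrite ltr_wpDl// ?flat_ge0// flat_gt0//; lra.
Qed.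

Lemma smooth_smooth_step n : smooth n smooth_step.
Proof.
apply: smoothM; first exact: smooth_flat.
apply: smoothV; first by move=> y; rewrite gt_eqF.
by apply: smoothD; [exact: smooth_flat|apply: smooth_affine; exact: smooth_flat].
Qed.

Lemma smooth_step_bound t : 0 <= smooth_step t <= 1.
Proof.
have d0 := denom_gt0 t; rewrite /smooth_step divr_ge0 ?flat_ge0//= ?(ltW d0)// ler_pdivrMr// mul1r lerDl.
exact: flat_ge0.
Qed.

Lemma smooth_step0 t : t <= 0 -> smooth_step t = 0.
Proof. by move=> t0; rewrite /smooth_step {1}/flat ltNge t0/= mul0r. Qed.

Lemma smooth_step1 t : 1 <= t -> smooth_step t = 1.
Proof.
move=> t1; rewrite /smooth_step [X in _ + X](_ : _ = 0) ?addr0; last first.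
  by rewrite /flat ifF//; apply/negbTE; rewrite -leNgt; lra.
by rewrite divff// gt_eqF// flat_gt0//; lra.
Qed.

Lemma derivable_smooth_step t : derivable smooth_step t 1.
Proof. by have [] := smooth_smooth_step 1. Qed.

Lemma smooth_continuous f : smooth 1 f -> continuous f.
Proof.
move=> [df _] y; apply: differentiable_continuous.
exact/derivable1_diffP.
Qed.

Lemma smooth_derive1_continuous f : smooth 2 f -> continuous (derive1 f).
Proof. by move=> [_ sf]; exact: smooth_continuous. Qed.

Lemma derive1_near_cst f (c t : R) : (\near t, f t = c) -> derive1 f t = 0.
Proof.
move=> fc; rewrite derive1E; have h : \near t, cst c t = f t.
  by apply: filterS fc => y ->.
by rewrite -(near_eq_derive _ h) derive_cst.
Qed.

Lemma derive1_smooth_step0 t : t < 0 \/ 1 < t -> derive1 smooth_step t = 0.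
Proof.
move=> [t0|t1].
  apply: (@derive1_near_cst _ 0); near=> y; apply: smooth_step0.
  by apply: ltW; near: y; exact: lt_nbhsl.
apply: (@derive1_near_cst _ 1); near=> y; apply: smooth_step1.
by apply: ltW; near: y; exact: lt_nbhsr.
Unshelve. all: by end_near. Qed.

Lemma derive1_smooth_step_bounded : exists2 C : R, 0 <= C &
  forall t, `|derive1 smooth_step t| <= C.
Proof.
have cd := smooth_derive1_continuous (smooth_smooth_step 2).
have [|c _ hc] := @EVT_max R (fun t => `|derive1 smooth_step t|) 0 1 ler01.
  apply: continuous_subspaceT => x.
  by apply: (@continuous_comp _ _ _ (derive1 smooth_step) (@Num.norm _ R)); [exact: cd|exact: norm_continuous].
exists (`|derive1 smooth_step c|); first exact: normr_ge0.
move=> t.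
have [t0|t0] := ltP t 0.
  by rewrite (derive1_smooth_step0 (or_introl t0)) normr0.
have [t1|t1] := ltP 1 t.
  by rewrite (derive1_smooth_step0 (or_intror t1)) normr0.
by apply: hc; rewrite in_itv/= t0.
Qed.

End smooth_functions.

(** * Test functions and cutoffs *)

Section test_functions.
Context {R : realType}.
Local Notation mu := (mu01 R).
Implicit Types f g phi : R -> R.

Lemma Ccinfty_sm phi n : Ccinfty phi -> smooth n phi.
Proof. by move=> [dphi _]; move: n; apply/smoothP. Qed.

Lemma Ccinfty_continuous phi : Ccinfty phi -> continuous phi.
Proof. by move=> h; apply: smooth_continuous; exact: Ccinfty_sm. Qed.

Lemma Ccinfty_derive1_continuous phi : Ccinfty phi -> continuous (derive1 phi).
Proof. by move=> h; apply: smooth_derive1_continuous; exact: Ccinfty_sm. Qed.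

Lemma Ccinfty_is_derive phi (y : R) : Ccinfty phi ->
  is_derive y 1 phi (derive1 phi y).
Proof. by move=> h; apply: derivable_is_derive1; have [+ _] := h; move/(_ 0%N y). Qed.

Lemma Ccinfty0 phi : Ccinfty phi -> phi 0 = 0.
Proof.
by move=> [_ [a [b [a0 _ h]]]]; apply: h; rewrite in_itv/= negb_and -ltNge a0.
Qed.

Lemma Ccinfty1 phi : Ccinfty phi -> phi 1 = 0.
Proof.
by move=> [_ [a [b [_ b1 h]]]]; apply: h; rewrite in_itv/= negb_and -!ltNge b1 orbT.
Qed.

Lemma CcinftyM phi g : Ccinfty phi -> (forall n, smooth n g) ->
  Ccinfty (fun y => phi y * g y).
Proof.
move=> h sg; split.
  by apply/smoothP => n; apply: smoothM => //; exact: Ccinfty_sm.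
by have [_ [a [b [a0 b1 h0]]]] := h; exists a, b; split => // y /h0 ->; rewrite mul0r.
Qed.

Lemma smooth_sn n k : smooth n (@sn R k) /\ smooth n (@cs R k).
Proof.
elim: n => [//|n [IHs IHc]]; split.
  apply: (smooth_is_derive (@is_derive_sn R k)).
  by apply: smoothM => //; exact: smooth_cst.
apply: (smooth_is_derive (@is_derive_cs R k)).
by apply: smoothM => //; exact: smooth_cst.
Qed.

Lemma smooth_cs1 n k : smooth n (@cs1 R k).
Proof. by case: k => [|k]; [exact: smooth_cst|have [] := smooth_sn n k]. Qed.

Lemma bounded_on01 f : {within `[0, 1], continuous f} ->
  exists2 M : R, 0 <= M & forall x, 0 <= x <= 1 -> `|f x| <= M.
Proof.
move=> cf; have [|c _ hc] := @EVT_max R (fun t => `|f t|) 0 1 ler01.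
  by move=> x; apply: (@continuous_comp _ _ _ _ (@Num.norm _ R)); [exact: cf|exact: norm_continuous].
by exists (`|f c|); [exact: normr_ge0|move=> x x01; apply: hc; rewrite in_itv].
Qed.

(** For c > 1, supported in [1 / c, 1 - 1 / c], and equal to 1 on [2 / c, 1 - 2 / c]; the second
    argument is c (1 - y) - 1. The parameter is an inverse width, so the derivative is of order
    [c]. *)
Definition cutoff (c y : R) : R :=
  smooth_step (c * y + (- 1)) * smooth_step ((- c) * y + (c - 1)).

Lemma cutoff_Ccinfty c : 1 < c -> Ccinfty (cutoff c).
Proof.
move=> c1; split.
  by apply/smoothP => n; apply: smoothM; apply: smooth_affine; exact: smooth_smooth_step.
have c0 : 0 < c by lra.
exists c^-1, (1 - c^-1); split; [by rewrite invr_gt0|by rewrite ltrBlDr ltrDl invr_gt0|].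
move=> y; rewrite in_itv/= negb_and -!ltNge => /orP[yc|yc].
  rewrite /cutoff smooth_step0 ?mul0r//.
  by move: yc; rewrite -[c^-1]mul1r ltr_pdivlMr// mulrC; lra.
rewrite /cutoff [X in _ * X]smooth_step0 ?mulr0//.
have : c * (1 - y) < 1 by rewrite -ltr_pdivlMl// mulr1; lra.
by lra.
Qed.

Lemma cutoff_bound c y : 0 <= cutoff c y <= 1.
Proof.
have /andP[h1 h2] := smooth_step_bound (c * y + (- 1)).
have /andP[h3 h4] := smooth_step_bound ((- c) * y + (c - 1)).
by rewrite /cutoff mulr_ge0//= -[leRHS]mulr1 ler_pM.
Qed.

Lemma cutoff1 c y : 0 < c -> 2 / c <= y <= 1 - 2 / c -> cutoff c y = 1.
Proof.
move=> c0 /andP[]; rewrite ler_pdivrMr// => h1 h2.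
have {}h2 : 2 <= c * (1 - y) by rewrite -ler_pdivrMl// mulrC; lra.
by rewrite /cutoff !smooth_step1 ?mulr1//; lra.
Qed.

Lemma derive1_cutoff c y : derive1 (cutoff c) y =
  smooth_step (c * y + (- 1)) * ((- c) * derive1 smooth_step ((- c) * y + (c - 1))) +
  smooth_step ((- c) * y + (c - 1)) * (c * derive1 smooth_step (c * y + (- 1))).
Proof.
have h1 := @is_derive_comp_affine R _ c (- 1) y (@derivable_smooth_step R _).
have h2 := @is_derive_comp_affine R _ (- c) (c - 1) y
  (@derivable_smooth_step R _).
by rewrite derive1E; have := is_deriveM h1 h2; move=> h3; rewrite (@derive_val _ _ _ _ _ _ _ h3).
Qed.

Lemma derive1_cutoff_bound : exists2 C : R, 0 <= C &
  forall c y, 0 < c -> `|derive1 (cutoff c) y| <= C * c.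
Proof.
have [C C0 hC] := @derive1_smooth_step_bounded R.
exists (2 * C) => [|c y c0]; first by rewrite mulr_ge0.
have key (s d c' : R) : 0 <= s <= 1 -> `|d| <= C -> `|c'| = c ->
    `|s * (c' * d)| <= C * c.
  move=> /andP[s0 s1] dC c'c; rewrite !normrM (ger0_norm s0) c'c.
  rewrite -[leRHS]mul1r ler_pM ?mulr_ge0 ?(ltW c0)//.
  by rewrite mulrC ler_pM2r.
rewrite derive1_cutoff; apply: le_trans (ler_normD _ _) _.
rewrite (_ : 2 * C * c = C * c + C * c); last by ring.
apply: lerD; apply: key.
- exact: smooth_step_bound.
- exact: hC.
- by rewrite normrN gtr0_norm.
- exact: smooth_step_bound.
- exact: hC.
- by rewrite gtr0_norm.
Qed.

Lemma derive1_cutoff0 c y : 0 < c -> 2 / c < y < 1 - 2 / c ->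
  derive1 (cutoff c) y = 0.
Proof.
move=> c0 /andP[h1 h2]; apply: (@derive1_near_cst _ _ 1); near=> z.
apply: cutoff1 => //; apply/andP; split; apply: ltW; near: z.
- exact: lt_nbhsr.
- exact: lt_nbhsl.
Unshelve. all: by end_near. Qed.

End test_functions.

(** * Weak derivatives and Fourier coefficients *)

Section weak_derivatives.
Context {R : realType}.
Local Notation mu := (mu01 R).
Implicit Types f g h phi u w : R -> R.

Lemma smooth_L2 h : smooth 1 h -> L2 h.
Proof. by move=> sh; exact/continuous_L2/smooth_continuous. Qed.

Lemma smooth_L2_derive1 h : smooth 2 h -> L2 (derive1 h).
Proof. by move=> sh; exact/continuous_L2/smooth_derive1_continuous. Qed.

Lemma eq0_norm_le_small (x N : R) : (forall e : R, 0 < e -> `|x| <= N * e) -> x = 0.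
Proof.
move=> h; have N0 : 0 <= N by have := h 1 ltr01; rewrite mulr1; exact: le_trans.
have N1 : 0 < N + 1 by rewrite ltr_wpDl.
apply/eqP; rewrite -normr_le0; apply/ler_addgt0Pl => e e0; rewrite addr0.
apply: le_trans (h _ (divr_gt0 e0 N1)) _; rewrite mulrCA ler_piMr// ?(ltW e0)//.
by rewrite ler_pdivrMr// mul1r lerDl.
Qed.

Lemma mu01_itv_le (a b : R) : a <= b -> (mu `[a, b]%classic <= (b - a)%:E)%E.
Proof.
move=> ab; apply: (@le_trans _ _ (lebesgue_measure (`[a, b] : set (measurableTypeR R)))).
  by rewrite /= /mrestr; apply: le_measure; rewrite ?inE//; exact: measurableI.
by rewrite lebesgue_measure_itv/=; case: ifPn => //; rewrite lee_fin subr_ge0.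
Qed.

Lemma integrable_mu01_indic (A : set (measurableTypeR R)) : measurable A ->
  mu.-integrable setT (EFin \o \1_A).
Proof.
move=> mA; apply: (@bounded_integrable_mu01 _ _ 1).
  exact: measurable_indic.
by move=> x _; rewrite indicE; case: (_ \in _); rewrite /= ?normr0 ?normr1.
Qed.

Lemma le_Rintegral_ae f g : mu.-integrable setT (EFin \o f) ->
  mu.-integrable setT (EFin \o g) -> {ae mu, forall x, f x <= g x} ->
  \int[mu]_x f x <= \int[mu]_x g x.
Proof.
move=> fi gi fg.
have /integrableP[/measurable_EFinP mf _] := fi.
have /integrableP[/measurable_EFinP mg _] := gi.
(* The pointwise minimum equals [f] almost everywhere and lies below [g] everywhere. *)
have mm : measurable_fun setT (fun x => Num.min (f x) (g x)) by exact: measurable_minr.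
have fm : f = (fun x => Num.min (f x) (g x)) %[ae mu].
  by apply: filterS fg => x fgx _; rewrite min_l.
rewrite (ae_eq_Rintegral mf mm fm).
have mi : mu.-integrable setT (EFin \o (fun x => Num.min (f x) (g x))).
  apply: le_integrable (integrableD measurableT (integrable_norm fi) (integrable_norm gi)) => //.
    exact/measurable_EFinP.
  move=> x _; change (`|(Num.min (f x) (g x))%:E| <= `|(`|f x| + `|g x|)%:E|)%E.
  rewrite /= lee_fin [leRHS]ger0_norm ?addr_ge0//.
  by rewrite /Num.min; case: ifPn; rewrite ?lerDl ?lerDr.
by apply: le_Rintegral_mu01 => // x _; rewrite ge_min lexx orbT.
Qed.

Lemma Rintegral_mu01_indic_le (a b : R) : a <= b ->
  \int[mu]_x \1_(`[a, b]%classic : set (measurableTypeR R)) x <= b - a.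
Proof.
move=> ab; rewrite /Rintegral integral_indic// setIT -lee_fin.
have h := mu01_itv_le ab; rewrite fineK//.
by rewrite ge0_fin_numE ?measure_ge0//; exact: le_lt_trans h (ltry _).
Qed.

(** All of the positive mass of [h] sits on two strips of width 2 / c at the endpoints, and [M]
    times the sum of their indicators dominates [h]. *)
Lemma strip_integral_le h (c M : R) : 0 < c -> 0 <= M ->
  mu.-integrable setT (EFin \o h) ->
  {ae mu, forall x, h x <= M} ->
  {ae mu, forall x, 2 / c < x < 1 - 2 / c -> h x = 0} ->
  \int[mu]_x h x <= M * (4 / c).
Proof.
move=> c0 M0 hi hM h0; pose d := 2 / c.
have d0 : 0 <= d by rewrite divr_ge0 ?(ltW c0).
pose A := `[0, d]%classic : set (measurableTypeR R).
pose B := `[1 - d, 1]%classic : set (measurableTypeR R).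
have iA : mu.-integrable setT (EFin \o \1_A) by exact: (integrable_mu01_indic (measurable_itv _)).
have iB : mu.-integrable setT (EFin \o \1_B) by exact: (integrable_mu01_indic (measurable_itv _)).
have iAB : mu.-integrable setT (EFin \o (fun x => M * (\1_A x + \1_B x))).
  by have := integrableZl measurableT M (integrableD measurableT iA iB).
apply: (@le_trans _ _ (\int[mu]_x (M * (\1_A x + \1_B x)))).
  apply: le_Rintegral_ae => //; have hMh : {ae mu, forall x, h x <= M /\
      (2 / c < x < 1 - 2 / c -> h x = 0)}.
    by apply: filterS2 hM h0 => x h1 h2; split.
  have := @ae_in01 R; apply: filterS2 hMh => x [{}hM {}h0] /andP[x0 x1].
  have [xA|xA] := boolP (x \in A).
    rewrite [\1_A x]indicE xA; apply: le_trans hM _.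
    by rewrite ler_peMr// lerDl indicE.
  have [xB|xB] := boolP (x \in B).
    rewrite [\1_B x]indicE xB; apply: le_trans hM _.
    by rewrite ler_peMr// lerDr indicE.
  rewrite h0 ?mulr_ge0// ?addr_ge0 ?indicE//.
  move: xA xB; rewrite !notin_setE /A /B /= !in_itv/= (ltW x0) (ltW x1)/= andbT.
  by move=> /negP; rewrite -ltNge => -> /negP; rewrite -ltNge.
rewrite RintegralZl//; last exact: (integrableD measurableT iA iB).
apply: ler_wpM2l => //; rewrite RintegralD//.
have := Rintegral_mu01_indic_le d0.
have d1 : 1 - d <= 1 by rewrite lerBlDr lerDl.
have := Rintegral_mu01_indic_le d1; rewrite -/A -/B.
have -> : 4 / c = d + d by rewrite /d -mulrDl; congr (_ / _); ring.
lra.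
Qed.

Lemma strip_L2norm_le h (c M : R) : 0 < c -> 0 <= M -> L2 h ->
  (forall x : R, 0 < x < 1 -> `|h x| <= M) ->
  (forall x : R, 2 / c < x < 1 - 2 / c -> h x = 0) ->
  L2norm h ^+ 2 <= M ^+ 2 * (4 / c).
Proof.
move=> c0 M0 Lh hM h0; rewrite L2norm_sqr//.
apply: strip_integral_le => //; first by rewrite exprn_ge0.
- exact: L2_integrableM.
- apply: ae_mu01 => x x01; rewrite -expr2 -[h x ^+ 2]real_normK ?num_real//.
  by rewrite lerXn2r ?nnegrE//; exact: hM.
- by apply: aeW => x xc; rewrite h0 ?mul0r.
Qed.

Lemma cutoff_approx h (c M : R) : 1 < c -> 0 <= M -> continuous h ->
  (forall x : R, 0 <= x <= 1 -> `|h x| <= M) ->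
  L2norm ((fun y => cutoff c y * h y) - h) ^+ 2 <= M ^+ 2 * (4 / c).
Proof.
move=> c1 M0 ch hM; have c0 : 0 < c by lra.
have Lh := continuous_L2 ch.
have cchi := Ccinfty_continuous (cutoff_Ccinfty c1).
have Lch : L2 (fun y => cutoff c y * h y).
  by apply: continuous_L2 => y; apply: cvgM; [exact: cchi|exact: ch].
apply: strip_L2norm_le => //; first exact: L2B.
- move=> x /andP[x0 x1]; have /andP[k0 k1] := cutoff_bound c x.
  change (`|cutoff c x * h x - h x| <= M).
  rewrite -{2}[h x]mul1r -mulrBl normrM; apply: le_trans (hM x _); last by rewrite !ltW.
  by rewrite -[leRHS]mul1r ler_wpM2r// ler_norml; lra.
- move=> x /andP[x0 x1].
  change (cutoff c x * h x - h x = 0).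
  by rewrite cutoff1 ?mul1r ?subrr// !ltW.
Qed.

Lemma cvg_sqrt_inv (K e : R) : 0 <= K -> 0 < e -> exists2 c0 : R, 1 < c0 &
  forall c, c0 <= c -> K * (4 / c) <= e.
Proof.
move=> K0 e0; have K4 : 0 <= K * 4 / e by rewrite divr_ge0 ?mulr_ge0 ?(ltW e0).
exists (2 + K * 4 / e) => [|c cc]; first lra.
have c0 : 0 < c by lra.
rewrite mulrA ler_pdivrMr// -ler_pdivrMl// mulrC.
by apply: le_trans cc; rewrite lerDr.
Qed.

Lemma Ccinfty_parts phi f g : Ccinfty phi -> {within `[0, 1], continuous f} ->
  {within `[0, 1], continuous g} -> (forall x : R, 0 < x < 1 -> is_derive x 1 f (g x)) ->
  \int[mu]_x (derive1 phi x * f x) = - \int[mu]_x (phi x * g x).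
Proof.
move=> hphi cf cg fg.
have c1 := continuous_within01 (Ccinfty_continuous hphi).
have c2 := continuous_within01 (Ccinfty_derive1_continuous hphi).
have dphi (x : R) : 0 < x < 1 -> is_derive x 1 phi (derive1 phi x).
  by move=> _; exact: Ccinfty_is_derive.
have := parts_mu01 c2 c1 cg cf dphi fg.
by rewrite (Ccinfty0 hphi) (Ccinfty1 hphi) !mul0r subrr sub0r.
Qed.

Lemma C1_weak_derivative f f' : continuous f -> continuous f' ->
  (forall x : R, is_derive x 1 f (f' x)) -> weak_derivative f f'.
Proof.
move=> cf cf' ff' phi hphi.
have := @Ccinfty_parts phi f f' hphi (continuous_within01 cf) (continuous_within01 cf') (fun x _ => ff' x).
rewrite /Rintegral; under eq_integral do rewrite mulrC.
by move=> ->; under [in RHS]eq_integral do rewrite mulrC.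
Qed.

(* [h] need not vanish at the endpoints.  It is multiplied by a cutoff whose
   derivative is of order c on strips of width of order 1 / c, in which the
   continuous representative [w] is small. *)
Lemma weak_parts u w g h : L2 u -> L2 g -> weak_derivative u g ->
  {within `[0, 1], continuous w} -> u = w %[ae mu] -> w 0 = 0 -> w 1 = 0 ->
  (forall n, smooth n h) -> L2inner u (derive1 h) = - L2inner g h.
Proof.
move=> Lu Lg ug cw uw w0 w1 sh.
have ch : continuous h := smooth_continuous (sh 1%N).
have ch' : continuous (derive1 h) := smooth_derive1_continuous (sh 2%N).
have Lh := continuous_L2 ch; have Lh' := continuous_L2 ch'.
have [H H0 hH] := bounded_on01 (continuous_within01 ch).
have [H' H'0 hH'] := bounded_on01 (continuous_within01 ch').
have [C C0 hC] := @derive1_cutoff_bound R.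
apply/eqP; rewrite -subr_eq0 opprK -normr_le0; apply/ler_addgt0Pl => e e0.
rewrite addr0.
pose e1 := e / (3 * (1 + L2norm u + L2norm g)).
have nu := L2norm_ge0 u; have ng := L2norm_ge0 g.
have e10 : 0 < e1 by rewrite divr_gt0// mulr_gt0//; lra.
have [d d0 wd] : exists2 d : R, 0 < d & forall x, 0 <= x <= 1 -> x <= d \/ 1 - d <= x ->
    `|w x| <= e / (12 * (1 + C * H)).
  have e2 : 0 < e / (12 * (1 + C * H)).
    by rewrite divr_gt0// mulr_gt0// ltr_pwDl// mulr_ge0.
  have [_ cw0 cw1] := (continuous_within_itvP w ltr01).1 cw.
  move/cvgrPdist_le : cw0 => /(_ _ e2) [d1 /= d10 h1].
  move/cvgrPdist_le : cw1 => /(_ _ e2) [d2 /= d20 h2].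
  exists (Num.min d1 d2 / 2); first by rewrite divr_gt0// lt_min d10 d20.
  move=> x /andP[x0 x1] [xd|xd].
    have [->|xN0] := eqVneq x 0; first by rewrite w0 normr0 ltW.
    have := h1 x; rewrite w0 !sub0r !normrN; apply; last by rewrite lt_neqAle eq_sym xN0.
    rewrite /ball_/= sub0r normrN ger0_norm//; apply: le_lt_trans xd _.
    rewrite ltr_pdivrMr//; apply: (@le_lt_trans _ _ d1); first by rewrite ge_min lexx.
    lra.
  have [->|xN1] := eqVneq x 1; first by rewrite w1 normr0 ltW.
  have := h2 x; rewrite w1 !sub0r !normrN; apply; last by rewrite lt_neqAle xN1.
  rewrite /ball_/= ger0_norm ?subr_ge0//.
  have : Num.min d1 d2 <= d2 by rewrite ge_min lexx orbT.
  lra.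
have [c1 c11 hc1] := cvg_sqrt_inv (exprn_ge0 2 H'0) (exprn_gt0 2 e10).
have [c2 c21 hc2] := cvg_sqrt_inv (exprn_ge0 2 H0) (exprn_gt0 2 e10).
(* [c1] and [c2] bring the two cutoff errors in L2 down to [e1]; the last summand puts the strips of
   width 2 / c within distance [d] of the endpoints. *)
pose c := c1 + c2 + 2 / d.
have d2 : 0 < 2 / d by rewrite divr_gt0.
have c1c : c1 <= c by rewrite /c; lra.
have c2c : c2 <= c by rewrite /c; lra.
have cgt1 : 1 < c by rewrite /c; lra.
have c0 : 0 < c by lra.
have cd : 2 / c <= d.
  by rewrite ler_pdivrMr// mulrC -ler_pdivrMr// /c; lra.
have hchi := cutoff_Ccinfty cgt1.
have phiC : Ccinfty (fun y => cutoff c y * h y) by exact: CcinftyM.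
have dphi y : derive1 (fun y => cutoff c y * h y) y =
    cutoff c y * derive1 h y + h y * derive1 (cutoff c) y.
  have h1 := Ccinfty_is_derive y hchi.
  have h2 : is_derive y 1 h (derive1 h y).
    by apply: derivable_is_derive1; have [+ _] := sh 1%N; exact.
  by have h3 := is_deriveM h1 h2; rewrite derive1E (@derive_val _ _ _ _ _ _ _ h3).
have cchi := Ccinfty_continuous hchi; have cchi' := Ccinfty_derive1_continuous hchi.
pose F1 y := cutoff c y * derive1 h y; pose F2 y := h y * derive1 (cutoff c) y.
pose F3 y := cutoff c y * h y.
have L1 : L2 F1 by apply: continuous_L2 => y; apply: cvgM; [exact: cchi|exact: ch'].
have LL2 : L2 F2 by apply: continuous_L2 => y; apply: cvgM; [exact: ch|exact: cchi'].
have L3 : L2 F3 by apply: continuous_L2 => y; apply: cvgM; [exact: cchi|exact: ch].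
have key : L2inner u (F1 + F2) = - L2inner g F3.
  have := ug _ phiC; rewrite (_ : derive1 _ = F1 + F2) => [<- //|].
  by apply/funext => y; rewrite dphi.
have E : L2inner u (derive1 h) + L2inner g h =
    - L2inner u (F1 - derive1 h) - L2inner u F2 - L2inner g (F3 - h).
  rewrite !L2innerBr//; move: key; rewrite L2innerDr//.
  move: (L2inner u F1) (L2inner u F2) (L2inner g F3) (L2inner u _) (L2inner g h).
  by clear => a1 a2 a3 a4 a5; lra.
rewrite E.
have b1 : `|L2inner u (F1 - derive1 h)| <= L2norm u * e1.
  apply: le_trans (L2_cauchy_schwarz Lu (L2B L1 Lh')) _; apply: ler_wpM2l => //.
  rewrite -(@ler_pXn2r _ 2)// ?nnegrE ?L2norm_ge0 ?(ltW e10)//.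
  by apply: le_trans (cutoff_approx cgt1 H'0 ch' hH') _; exact: hc1.
have b3 : `|L2inner g (F3 - h)| <= L2norm g * e1.
  apply: le_trans (L2_cauchy_schwarz Lg (L2B L3 Lh)) _; apply: ler_wpM2l => //.
  rewrite -(@ler_pXn2r _ 2)// ?nnegrE ?L2norm_ge0 ?(ltW e10)//.
  by apply: le_trans (cutoff_approx cgt1 H0 ch hH) _; exact: hc2.
have b2 : `|L2inner u F2| <= e / 3.
  have iF : mu.-integrable setT (EFin \o (fun y => u y * F2 y)) by exact: L2_integrableM.
  apply: le_trans (le_normr_Rintegral measurableT iF) _.
  have CH0 : 0 <= C * H by rewrite mulr_ge0.
  (* The three factors bound [w], [h] and the cutoff derivative on the strips. The growth [c] of the
     last one is compensated by the total strip length 4 / c, which leaves at most e / 3. *)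
  pose M := e / (12 * (1 + C * H)) * (H * (C * c)).
  have M0 : 0 <= M by rewrite /M !(mulr_ge0, invr_ge0)// ?(ltW e0) ?(ltW c0)//; lra.
  have /le_trans : \int[mu]_t `|u t * F2 t| <= M * (4 / c).
    apply: strip_integral_le => //; first exact: integrable_norm.
      have := @ae_in01 R; apply: filterS2 uw => x /(_ I) -> /andP[x0 x1].
      have x01 : 0 <= x <= 1 by rewrite !ltW.
      have [/andP[xc xc']|xc] := boolP (2 / c < x < 1 - 2 / c).
        by rewrite /F2 derive1_cutoff0 ?xc//; rewrite !mulr0 normr0.
      rewrite normrM ler_pM//; last by rewrite /F2 normrM ler_pM ?hH ?hC.
      apply: wd => //; move: xc; rewrite negb_and -!leNgt => /orP[xc|xc]; [left|right].
        exact: le_trans cd.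
      by apply: le_trans xc; rewrite lerB.
    by apply: aeW => x xc; rewrite /F2 derive1_cutoff0// !mulr0 normr0.
  apply; have -> : M * (4 / c) = (C * H) / (1 + C * H) * (e / 3).
    have := ltr_pwDl ltr01 CH0; move: c0; rewrite /M; move: (c) (e) (H) (C).
    by clear => a b H C a0 CH1; field; rewrite !gt_eqF.
  rewrite -[leRHS]mul1r ler_wpM2r ?divr_ge0 ?(ltW e0)//.
  by rewrite ler_pdivrMr ?mul1r ?lerDr// ltr_pwDl.
have : (L2norm u + L2norm g) * e1 <= e / 3.
  have : e1 * (3 * (1 + L2norm u + L2norm g)) = e.
    by rewrite /e1 divfK// gt_eqF// mulr_gt0//; lra.
  move: (ltW e10); move: (L2norm u) (L2norm g) (e1).
  by clear => a b e1; lra.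
move: b1 b2 b3; rewrite !ler_norml.
move: (L2inner u _) (L2inner u F2) (L2inner g _) (L2norm u) (L2norm g).
by clear => a1 a2 a3 n1 n2; lra.
Qed.

(** The difference of the two is a weak derivative of the zero function. By [weak_parts] it may then
    be tested against cosines, which do not vanish at the endpoints, and these are complete. *)
Lemma weak_derivative_unique f g1 g2 : L2 f -> L2 g1 -> L2 g2 ->
  weak_derivative f g1 -> weak_derivative f g2 -> g1 = g2 %[ae mu].
Proof.
move=> Lf L1 LL fg1 fg2; have LB := L2B L1 LL.
have wd0 : weak_derivative 0 (g1 - g2).
  move=> phi hphi.
  have Lphi := continuous_L2 (Ccinfty_continuous hphi).
  have := L2innerBl L1 LL Lphi; have := fg1 _ hphi; rewrite (fg2 _ hphi).
  move=> /oppr_inj E; rewrite {2}/L2inner {2}/L2inner -E subrr => E2.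
  rewrite [X in - X]E2 oppr0 -[RHS](L2inner0l (derive1 phi)).
  by [].
have c0 : {within `[0, 1], continuous (0 : R -> R)}.
  by apply: continuous_within01 => x; exact: cvg_cst.
have g0 k : L2inner (g1 - g2) (cs1 k) = 0.
  have := @weak_parts 0 0 (g1 - g2) (cs1 k) L2_0 LB wd0 c0.
  rewrite L2inner0l => h; apply/eqP; rewrite -oppr_eq0 -h//.
    exact: ae_eq_refl.
  by move=> n; exact: smooth_cs1.
have := cs1_complete LB g0; apply: filterS => x /[apply] /eqP.
by rewrite subr_eq0 => /eqP.
Qed.

Lemma H1_L2 f : H1 f -> L2 f. Proof. by case. Qed.

Lemma wderivP f : H1 f -> L2 (wderiv f) /\ weak_derivative f (wderiv f).
Proof.
move=> [Lf [g Lg fg]].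
by have := @xgetPex _ (cst 0) [set g | L2 g /\ weak_derivative f g]
  (ex_intro _ g (conj Lg fg)).
Qed.

Lemma L2_wderiv f : H1 f -> L2 (wderiv f).
Proof. by case/wderivP. Qed.

Lemma wderiv_ae f g : L2 f -> L2 g -> weak_derivative f g ->
  H1 f /\ wderiv f = g %[ae mu].
Proof.
move=> Lf Lg fg; have Hf : H1 f by split => //; exists g.
by split => //; have [Lw fw] := wderivP Hf; exact: weak_derivative_unique Lf Lw Lg fw fg.
Qed.

Lemma weak_derivative_lin (a : R) f1 g1 f2 g2 : L2 f1 -> L2 g1 -> L2 f2 -> L2 g2 ->
  weak_derivative f1 g1 -> weak_derivative f2 g2 ->
  weak_derivative (a *: f1 + f2) (a *: g1 + g2).
Proof.
move=> Lf1 Lg1 Lf2 Lg2 h1 h2 phi hphi.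
have Lphi := continuous_L2 (Ccinfty_continuous hphi).
have Lphi' := continuous_L2 (Ccinfty_derive1_continuous hphi).
have := L2inner_linl a Lf1 Lf2 Lphi'; have := L2inner_linl a Lg1 Lg2 Lphi.
rewrite /L2inner (h1 _ hphi) (h2 _ hphi) => -> ->.
by rewrite mulrN opprD.
Qed.

Lemma H1_lin (a : R) f g : H1 f -> H1 g ->
  H1 (a *: f + g) /\ wderiv (a *: f + g) = a *: wderiv f + wderiv g %[ae mu].
Proof.
move=> Hf Hg; have [Lf' wf] := wderivP Hf; have [Lg' wg] := wderivP Hg.
apply: wderiv_ae; [exact: L2_lin (H1_L2 Hf) (H1_L2 Hg)|exact: L2_lin|].
exact: weak_derivative_lin (H1_L2 Hf) _ (H1_L2 Hg) _ _ _.
Qed.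

Lemma H1B f g : H1 f -> H1 g ->
  H1 (f - g) /\ wderiv (f - g) = wderiv f - wderiv g %[ae mu].
Proof.
move=> Hf Hg; have := H1_lin (- 1) Hg Hf.
by rewrite !scaleN1r addrC (addrC (- wderiv g)).
Qed.

Lemma H1norm_sqr f : H1norm f ^+ 2 = L2norm f ^+ 2 + L2norm (wderiv f) ^+ 2.
Proof. by rewrite sqr_sqrtr// addr_ge0// exprn_ge0// L2norm_ge0. Qed.

Lemma H1norm_ge0 f : 0 <= H1norm f.
Proof. exact: sqrtr_ge0. Qed.

Lemma L2norm_le_H1norm f : L2norm f <= H1norm f.
Proof.
rewrite -(@ler_pXn2r _ 2)// ?nnegrE ?L2norm_ge0 ?H1norm_ge0// H1norm_sqr.
by rewrite lerDl exprn_ge0// L2norm_ge0.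
Qed.

Lemma L2norm_wderiv_le_H1norm f : L2norm (wderiv f) <= H1norm f.
Proof.
rewrite -(@ler_pXn2r _ 2)// ?nnegrE ?L2norm_ge0 ?H1norm_ge0// H1norm_sqr.
by rewrite lerDr exprn_ge0// L2norm_ge0.
Qed.

Lemma Ccinfty_wderiv phi : Ccinfty phi ->
  H1 phi /\ wderiv phi = derive1 phi %[ae mu].
Proof.
move=> hphi; have cphi := Ccinfty_continuous hphi.
have cphi' := Ccinfty_derive1_continuous hphi.
apply: wderiv_ae; [exact: continuous_L2|exact: continuous_L2|].
by apply: C1_weak_derivative => // x; exact: Ccinfty_is_derive.
Qed.

(** The identity holds for test functions by definition of the weak derivative, and its defect is
    bounded by a multiple of the H1 distance from [h] to a test function. *)
Lemma H10_weak_parts f g h : L2 f -> L2 g -> weak_derivative f g -> H10 h ->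
  L2inner f (wderiv h) = - L2inner g h.
Proof.
move=> Lf Lg fg [Hh hd]; have Lh := H1_L2 Hh; have Lh' := L2_wderiv Hh.
suff : L2inner f (wderiv h) + L2inner g h = 0 by move/eqP; rewrite addr_eq0 => /eqP.
apply: (@eq0_norm_le_small _ (L2norm f + L2norm g)) => e e0.
have [phi hphi /ltW he] := hd _ e0.
have [Hphi dphi] := Ccinfty_wderiv hphi; have [HB dB] := H1B Hh Hphi.
have [Lp Lp'] := (H1_L2 Hphi, L2_wderiv Hphi); have LB := L2_wderiv HB.
have E0 : L2inner f (wderiv phi) = - L2inner g phi.
  have Ld := continuous_L2 (Ccinfty_derive1_continuous hphi).
  by rewrite L2innerC (L2inner_ae Lp' Ld Lf dphi) L2innerC; exact: fg.
have -> : L2inner f (wderiv h) + L2inner g h =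
    L2inner f (wderiv (h - phi)) + L2inner g (h - phi).
  rewrite [L2inner f (wderiv (h - phi))]L2innerC (L2inner_ae LB (L2B Lh' Lp') Lf dB).
  rewrite L2innerBl// L2innerBr// !(L2innerC _ f) E0.
  by rewrite opprK addrACA addrN addr0.
apply: le_trans (ler_normD _ _) _; rewrite mulrDl; apply: lerD.
  apply: le_trans (L2_cauchy_schwarz Lf LB) _; rewrite ler_wpM2l ?L2norm_ge0//.
  exact: le_trans (L2norm_wderiv_le_H1norm _) he.
apply: le_trans (L2_cauchy_schwarz Lg (L2B Lh Lp)) _; rewrite ler_wpM2l ?L2norm_ge0//.
exact: le_trans (L2norm_le_H1norm _) he.
Qed.

Lemma H10_parts f h : H10 f -> (forall n, smooth n h) ->
  L2inner f (derive1 h) = - L2inner (wderiv f) h.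
Proof.
move=> Hf sh; have Lh := smooth_L2 (sh 1%N); have Lh' := smooth_L2_derive1 (sh 2%N).
have hh' : weak_derivative h (derive1 h).
  apply: C1_weak_derivative => [||x]; [exact: smooth_continuous (sh 1%N)|exact: smooth_derive1_continuous (sh 2%N)|].
  by apply: derivable_is_derive1; have [+ _] := sh 1%N; exact.
by rewrite (L2innerC f) (L2innerC _ h) (H10_weak_parts Lh Lh' hh' Hf) opprK.
Qed.

Lemma derive1_cs k : derive1 (cs k) = (fun y => - om k * sn k y) :> (R -> R).
Proof.
by apply/funext => y; rewrite derive1E; have h := is_derive_cs k y; rewrite derive_val.
Qed.

(** Testing with the constant 1 gives the zero mean, and testing with [cs k] gives the relation
    between coefficients. The hypothesis is integration by parts without boundary terms, which holds
    both for functions in H10 and for H1 functions that vanish at the endpoints. *)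
Lemma coef_of_parts f g : L2 f -> L2 g ->
  (forall h, (forall n, smooth n h) -> L2inner f (derive1 h) = - L2inner g h) ->
  L2inner g (cst 1) = 0 /\ forall k, L2inner g (cs k) = om k * L2inner f (sn k).
Proof.
move=> Lf Lg fg; split => [|k].
  have := fg _ (fun n => smooth_cst n (1 : R)).
  have -> : derive1 (cst (1 : R) : R -> R) = 0.
    by apply/funext => y; rewrite derive1_cst.
  by rewrite L2innerC L2inner0l => /eqP; rewrite eq_sym oppr_eq0 => /eqP.
have := fg _ (fun n => (smooth_sn n k).2); rewrite derive1_cs.
change (fun y : R => - om k * sn k y) with (- om k *: sn k : R -> R).
rewrite L2innerZr//; [|exact: L2_sn].
by rewrite mulNr => /oppr_inj ->.
Qed.

Lemma H10_coef f : H10 f -> L2inner (wderiv f) (cst 1) = 0 /\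
  forall k, L2inner (wderiv f) (cs k) = om k * L2inner f (sn k).
Proof.
move=> Hf; apply: coef_of_parts (fun h => H10_parts Hf (h := h)).
  exact: H1_L2 Hf.1.
exact: L2_wderiv Hf.1.
Qed.

End weak_derivatives.

(** * Fourier characterisation of H10 *)

Section H10_fourier.
Context {R : realType}.
Local Notation mu := (mu01 R).
Implicit Types f g h phi : R -> R.

(** The remainder has the coefficients of [f] from index [n] on and zeros before, so Parseval bounds
    its norm by a tail of the Bessel sum. *)
Lemma tail_norm (e : nat -> R -> R) f (d : R) : (forall k, L2 (e k)) ->
  (forall i j, L2inner (e i) (e j) = (i == j)%:R) ->
  (forall f, L2 f -> (forall k, L2inner f (e k) = 0) -> f = 0 %[ae mu]) ->
  L2 f -> 0 < d -> exists N, forall n, (N <= n)%N ->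
    L2norm (f - psum e (fun k => L2inner f (e k)) n) <= d.
Proof.
move=> Le ortho comp Lf d0; pose a k := L2inner f (e k).
have [N hN] := bounded_sum_tail (fun k => sqr_ge0 (a k))
  (fun n => bessel Le ortho n Lf) (exprn_gt0 2 d0).
exists N => n Nn; have Lp := L2_psum Le a n; have LB := L2B Lf Lp.
rewrite -(@ler_pXn2r _ 2)// ?nnegrE ?L2norm_ge0 ?(ltW d0)//.
apply: (parseval_le Le ortho comp LB) => m.
apply: le_trans (hN m).
rewrite -(big_mkord xpredT (fun k => L2inner (f - psum e a n) (e k) ^+ 2)).
have c0 k : (k < n)%N -> L2inner (f - psum e a n) (e k) ^+ 2 = 0.
  by move=> kn; rewrite L2innerBl// psum_coef// kn subrr expr0n.
have [mN|Nm] := leqP m N.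
  rewrite [leRHS]big_geq// big_nat big1// => k /andP[_ km].
  by apply: c0; exact: leq_trans (leq_trans km mN) Nn.
rewrite (@big_cat_nat _ _ _ N)//=; last exact: ltnW.
rewrite [X in X + _]big_nat big1 ?add0r; last first.
  by move=> k /andP[_ km]; apply: c0; exact: leq_trans km Nn.
apply: ler_sum => k _; have [kn|nk] := ltnP k n; first by rewrite c0// sqr_ge0.
by rewrite L2innerBl// psum_coef// ltnNge nk/= subr0.
Qed.

Lemma H1_0 : H1 (0 : R -> R) /\ wderiv (0 : R -> R) = 0 %[ae mu].
Proof.
apply: wderiv_ae; [exact: L2_0|exact: L2_0|].
by apply: C1_weak_derivative => x; exact: cvg_cst.
Qed.

Lemma H1Z (a : R) f : H1 f -> H1 (a *: f) /\ wderiv (a *: f) = a *: wderiv f %[ae mu].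
Proof.
move=> Hf; have [H0 w0] := H1_0; have := H1_lin a Hf H0; rewrite addr0 => -[? h].
split=> //; apply: filterS2 h w0 => x h1 h2 _.
by rewrite (h1 I) !fctE (h2 I) addr0.
Qed.

Lemma H1D f g : H1 f -> H1 g -> H1 (f + g) /\ wderiv (f + g) = wderiv f + wderiv g %[ae mu].
Proof. by move=> Hf Hg; have := H1_lin 1 Hf Hg; rewrite !scale1r. Qed.

Lemma H1normD f g : H1 f -> H1 g -> H1norm (f + g) <= H1norm f + H1norm g.
Proof.
move=> Hf Hg; have [Hfg dfg] := H1D Hf Hg.
have [Lf Lg] := (H1_L2 Hf, H1_L2 Hg); have [Lf' Lg'] := (L2_wderiv Hf, L2_wderiv Hg).
have s0 : 0 <= H1norm f + H1norm g by rewrite addr_ge0 ?H1norm_ge0.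
rewrite -ler_sqr ?nnegrE ?H1norm_ge0//.
rewrite H1norm_sqr (L2norm_ae (L2_wderiv Hfg) (L2D Lf' Lg') dfg) sqrrD !H1norm_sqr.
have h1 : L2norm (f + g) ^+ 2 <= (L2norm f + L2norm g) ^+ 2.
  by rewrite ler_sqr ?nnegrE ?addr_ge0 ?L2norm_ge0// L2normD.
have h2 : L2norm (wderiv f + wderiv g) ^+ 2 <= (L2norm (wderiv f) + L2norm (wderiv g)) ^+ 2.
  by rewrite ler_sqr ?nnegrE ?addr_ge0 ?L2norm_ge0// L2normD.
have h3 : L2norm f * L2norm g + L2norm (wderiv f) * L2norm (wderiv g) <= H1norm f * H1norm g.
  have k0 : 0 <= L2norm f * L2norm g + L2norm (wderiv f) * L2norm (wderiv g).
    by rewrite addr_ge0// mulr_ge0 ?L2norm_ge0.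
  rewrite -ler_sqr ?nnegrE ?mulr_ge0 ?H1norm_ge0// exprMn !H1norm_sqr.
  move: (L2norm f) (L2norm g) (L2norm (wderiv f)) (L2norm (wderiv g)) => a b c d.
  have := sqr_ge0 (a * d - b * c); rewrite sqrrB sqrrD !exprMn.
  by rewrite !expr2; lra.
move: h1 h2 h3; rewrite !sqrrD.
move: (L2norm (f + g) ^+ 2) (L2norm (_ + _) ^+ 2) (L2norm f ^+ 2) (L2norm g ^+ 2)
  (L2norm (wderiv f) ^+ 2) (L2norm (wderiv g) ^+ 2) (H1norm f * H1norm g)
  (L2norm f * L2norm g) (L2norm (wderiv f) * L2norm (wderiv g)).
by clear => a b c d e i j k m; lra.
Qed.

Lemma H1normD_sqr f g : H1 f -> H1 g ->
  H1norm (f + g) ^+ 2 <= 2 * H1norm f ^+ 2 + 2 * H1norm g ^+ 2.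
Proof.
move=> Hf Hg; apply: (@le_trans _ _ ((H1norm f + H1norm g) ^+ 2)).
  by rewrite ler_sqr ?nnegrE ?addr_ge0 ?H1norm_ge0// H1normD.
move: (H1norm f) (H1norm g); clear => a c.
by have := sqr_ge0 (a - c); rewrite sqrrB sqrrD; lra.
Qed.

Lemma H1normZ_sqr (a : R) f : H1 f -> H1norm (a *: f) ^+ 2 = a ^+ 2 * H1norm f ^+ 2.
Proof.
move=> Hf; have [Ha af] := H1Z a Hf.
have Lf := H1_L2 Hf; have Lf' := L2_wderiv Hf.
rewrite !H1norm_sqr (L2norm_ae (L2_wderiv Ha) (L2Z a Lf') af) !L2normZ//.
by rewrite !exprMn real_normK ?num_real// mulrDr.
Qed.

Lemma Ccinfty_lin (a : R) phi psi : Ccinfty phi -> Ccinfty psi -> Ccinfty (a *: phi + psi).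
Proof.
move=> h1 h2; split.
  apply/smoothP => n; apply: smoothD; last exact: Ccinfty_sm.
  by apply: smoothM; [exact: smooth_cst|exact: Ccinfty_sm].
have [_ [a1 [b1 [a10 b11 hh1]]]] := h1; have [_ [a2 [b2 [a20 b21 hh2]]]] := h2.
exists (Num.min a1 a2), (Num.max b1 b2); split.
- by rewrite lt_min a10.
- by rewrite gt_max b11.
- move=> y; rewrite in_itv/= negb_and -!ltNge => hy.
  have E1 : phi y = 0.
    apply: hh1; rewrite in_itv/= negb_and -!ltNge; move: hy.
    by rewrite lt_min gt_max => /orP[/andP[->]//|/andP[->]]; rewrite orbT.
  have E2 : psi y = 0.
    apply: hh2; rewrite in_itv/= negb_and -!ltNge; move: hy.
    by rewrite lt_min gt_max => /orP[/andP[_ ->]//|/andP[_ ->]]; rewrite orbT.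
  by change (a * phi y + psi y = 0); rewrite E1 E2 mulr0 addr0.
Qed.

Lemma H1norm_sqr_lt f (e : R) : 0 < e -> H1norm f ^+ 2 < e ^+ 2 -> H1norm f < e.
Proof.
by move=> e0; rewrite ltr_pXn2r// nnegrE ?H1norm_ge0// ltW.
Qed.

Lemma H10_lin (a : R) f g : H10 f -> H10 g -> H10 (a *: f + g).
Proof.
move=> [Hf fd] [Hg gd]; have [Hfg _] := H1_lin a Hf Hg; split=> [|e e0]; first exact: Hfg.
have a0 : 0 < 2 * (1 + `|a|) by rewrite mulr_gt0// ltr_pwDl.
have e20 : 0 < e / 2 by rewrite divr_gt0.
have [phi hphi fphi] := fd _ (divr_gt0 e0 a0).
have [psi hpsi gpsi] := gd _ e20.
exists (a *: phi + psi); first exact: Ccinfty_lin.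
change (H1norm ((a *: f + g) - (a *: phi + psi)) < e).
have -> : (a *: f + g) - (a *: phi + psi) = a *: (f - phi) + (g - psi).
  by rewrite scalerBr opprD addrACA.
have [HB1 _] := H1B Hf (Ccinfty_wderiv hphi).1.
have [HB2 _] := H1B Hg (Ccinfty_wderiv hpsi).1.
apply: H1norm_sqr_lt => //; apply: le_lt_trans (H1normD_sqr (H1Z a HB1).1 HB2) _.
rewrite H1normZ_sqr//.
have n1 := H1norm_ge0 (f - phi); have n2 := H1norm_ge0 (g - psi).
have b1 : `|a| * H1norm (f - phi) <= e / 2.
  apply: (@le_trans _ _ ((1 + `|a|) * (e / (2 * (1 + `|a|))))).
    by apply: ler_pM => //; [rewrite lerDr|exact: ltW].
  have : 1 + `|a| != 0 by rewrite gt_eqF// ltr_pwDl.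
  move: (1 + `|a|) => c c0; suff -> : c * (e / (2 * c)) = e / 2 by [].
  by field.
have b1' : a ^+ 2 * H1norm (f - phi) ^+ 2 <= (e / 2) ^+ 2.
  rewrite -[a ^+ 2]real_normK ?num_real// -exprMn lerXn2r// nnegrE ?mulr_ge0//.
  exact: ltW.
have b2 : H1norm (g - psi) ^+ 2 < (e / 2) ^+ 2 by rewrite ltr_pXn2r// nnegrE// ltW.
have : e ^+ 2 = 2 * (e / 2) ^+ 2 + 2 * (e / 2) ^+ 2 by field.
move: (H1norm (g - psi) ^+ 2) (a ^+ 2 * _) ((e / 2) ^+ 2) (e ^+ 2) b1' b2.
by clear => x y z w; lra.
Qed.

Lemma H10_limit f : H1 f ->
  (forall e : R, 0 < e -> exists2 g, H10 g & H1norm (f - g) ^+ 2 <= e) -> H10 f.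
Proof.
move=> Hf fg; split=> // e e0.
have e40 : 0 < e ^+ 2 / 8 by rewrite divr_gt0// exprn_gt0.
have [g [Hg gd] fge] := fg _ e40.
have e20 : 0 < e / 2 by rewrite divr_gt0.
have [phi hphi gphi] := gd _ e20; exists phi => //.
change (H1norm (f - phi) < e); have -> : f - phi = (f - g) + (g - phi) by rewrite addrA subrK.
have [HB1 _] := H1B Hf Hg; have [HB2 _] := H1B Hg (Ccinfty_wderiv hphi).1.
apply: H1norm_sqr_lt => //; apply: le_lt_trans (H1normD_sqr HB1 HB2) _.
have b2 : H1norm (g - phi) ^+ 2 < (e / 2) ^+ 2.
  by rewrite ltr_pXn2r// nnegrE ?H1norm_ge0// ltW.
have e2 : 0 < e ^+ 2 by rewrite exprn_gt0.
have : (e / 2) ^+ 2 = e ^+ 2 / 4 by field.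
move: (H1norm (g - phi) ^+ 2) (H1norm _ ^+ 2) ((e / 2) ^+ 2) (e ^+ 2) b2 fge e2.
by clear => x y z w; lra.
Qed.

Lemma cs_bound k (y : R) : `|cs k y| <= Num.sqrt 2.
Proof.
by rewrite /cs normrM ger0_norm ?sqrtr_ge0// -[leRHS]mulr1 ler_wpM2l ?sqrtr_ge0 ?cos_max.
Qed.

Lemma sn_lipschitz k (x y : R) : `|sn k x - sn k y| <= Num.sqrt 2 * om k * `|x - y|.
Proof.
wlog xy : x y / x <= y.
  move=> h; have [xy|yx] := leP x y; first exact: h.
  by rewrite distrC (distrC x); apply: h; exact: ltW.
have [| |c _ E] := @MVT_segment R (sn k) (fun y => om k * cs k y) x y xy.
  by move=> z _; exact: is_derive_sn.
  by apply: continuous_subspaceT; exact: continuous_sn.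
rewrite distrC E normrM (distrC x) ler_wpM2r// normrM gtr0_norm ?om_gt0//.
by rewrite mulrC ler_wpM2r ?cs_bound// ltW// om_gt0.
Qed.

Lemma sn_wderiv k : H1 (sn k : R -> R) /\ wderiv (sn k) = om k *: cs k %[ae mu].
Proof.
apply: wderiv_ae; [exact: L2_sn|exact/L2Z/L2_cs|].
apply: C1_weak_derivative; first exact: continuous_sn.
- by move=> y; apply: cvgM; [exact: cvg_cst|exact: continuous_cs].
- exact: is_derive_sn.
Qed.

(** The approximating test functions are cutoffs of [sn k]. As [sn k] is Lipschitz and vanishes at
    the endpoints, its product with the cutoff derivative stays bounded as [c] grows, and the error
    lives on strips of total length at most 4 / c. *)
Lemma sn_H10 k : H10 (sn k : R -> R).
Proof.
have [Hs s'] := sn_wderiv k.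
have [C C0 hC] := @derive1_cutoff_bound R.
have om0 : 0 < om k :> R := om_gt0 k; have s20 : 0 <= Num.sqrt 2 :> R by exact: sqrtr_ge0.
(* The summand 1 accounts for 1 - cutoff times the derivative of [sn k]. The summand 2 C comes from
   [sn k], at most sqrt 2 om k (2 / c) on the strips, times the cutoff derivative, at most C c. *)
split=> // e e0; pose M := Num.sqrt 2 * om k * (1 + 2 * C).
have C20 : 0 <= 1 + 2 * C by apply: addr_ge0 => //; exact: mulr_ge0.
have M0 : 0 <= M by exact: mulr_ge0 (mulr_ge0 s20 (ltW om0)) C20.
have sM (x : R) : 0 <= x <= 1 -> `|sn k x| <= M.
  move=> /andP[x0 x1]; have := sn_lipschitz k x 0; rewrite sn0 !subr0 => /le_trans; apply.
  apply: ler_wpM2l; first by rewrite mulr_ge0// ltW.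
  by rewrite ger0_norm//; apply: le_trans x1 _; rewrite lerDl mulr_ge0.
have K0 : 0 <= 2 * M ^+ 2 by rewrite mulr_ge0// exprn_ge0.
have e20 : 0 < e ^+ 2 / 2 by rewrite divr_gt0// exprn_gt0.
have [c c1 hc] := cvg_sqrt_inv K0 e20; have {}hc := hc c (lexx c).
have c0 : 0 < c by lra.
have hchi := cutoff_Ccinfty c1.
have sms n : smooth n (sn k : R -> R) by exact: (@smooth_sn R n k).1.
pose phi y := cutoff c y * sn k y.
have hphi : Ccinfty phi by exact: CcinftyM.
exists phi => //; change (H1norm (sn k - phi) < e).
have [Hphi phi'] := Ccinfty_wderiv hphi.
have [HB B'] := H1B Hs Hphi.
have cphi := Ccinfty_continuous hphi; have cphi' := Ccinfty_derive1_continuous hphi.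
have Ls := @L2_sn R k; have Lc := L2Z (om k) (@L2_cs R k).
have Lphi := continuous_L2 cphi; have Lphi' := continuous_L2 cphi'.
have dphi y : derive1 phi y = cutoff c y * (om k * cs k y) + sn k y * derive1 (cutoff c) y.
  have h1 := Ccinfty_is_derive y hchi; have h2 := is_derive_sn k y.
  by have h3 := is_deriveM h1 h2; rewrite derive1E (@derive_val _ _ _ _ _ _ _ h3).
have D' : wderiv (sn k - phi) = om k *: cs k - derive1 phi %[ae mu].
  by apply: filterS3 B' s' phi' => x h1 h2 h3 _; rewrite (h1 I) !fctE (h2 I) (h3 I).
have b1 : L2norm (sn k - phi) ^+ 2 <= M ^+ 2 * (4 / c).
  rewrite L2normBC//; apply: cutoff_approx => //; exact: continuous_sn.
have b2 : L2norm (om k *: cs k - derive1 phi) ^+ 2 <= M ^+ 2 * (4 / c).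
  apply: strip_L2norm_le => //; first exact: L2B.
    move=> x /andP[x0 x1]; change (`|om k * cs k x - derive1 phi x| <= M).
    rewrite dphi; have /andP[k0 k1] := cutoff_bound c x.
    have -> : om k * cs k x - (cutoff c x * (om k * cs k x) + sn k x * derive1 (cutoff c) x) =
        (1 - cutoff c x) * (om k * cs k x) + - (sn k x * derive1 (cutoff c) x).
      move: (om k * cs k x) (sn k x) (cutoff c x) (derive1 _ x).
      by clear => a b d f; ring.
    apply: le_trans (ler_normD _ _) _; rewrite normrN /M mulrDr mulr1; apply: lerD.
      rewrite normrM normrM (gtr0_norm om0) -[leRHS]mul1r ler_pM//.
      + by rewrite mulr_ge0// ltW.
      + by rewrite ler_norml; lra.
      + by rewrite mulrC ler_wpM2r ?cs_bound// ltW.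
    have [/andP[xc xc']|xc] := boolP (2 / c < x < 1 - 2 / c).
      rewrite derive1_cutoff0 ?xc// mulr0 normr0.
      by apply: mulr_ge0; [exact: mulr_ge0 s20 (ltW om0)|exact: mulr_ge0].
    have sx : `|sn k x| <= Num.sqrt 2 * om k * (2 / c).
      have d0 : 0 <= Num.sqrt 2 * om k :> R := mulr_ge0 s20 (ltW om0).
      move: xc; rewrite negb_and -!leNgt => /orP[xc|xc].
        have := sn_lipschitz k x 0; rewrite sn0 !subr0 => /le_trans; apply.
        by rewrite ler_wpM2l// gtr0_norm.
      have := sn_lipschitz k x 1; rewrite sn1 !subr0 => /le_trans; apply.
      by rewrite ler_wpM2l// distrC ger0_norm ?subr_ge0 ?(ltW x1)// lerBlDl -lerBlDr.
    rewrite normrM; apply: le_trans (ler_pM _ _ sx (hC c x c0)) _ => //.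
    have : c != 0 by rewrite gt_eqF.
    move: (Num.sqrt 2) (om k) (c) (C); clear => s o d b d0.
    by suff -> : s * o * (2 / d) * (b * d) = s * o * (2 * b) by []; field.
  move=> x xc; change (om k * cs k x - derive1 phi x = 0).
  rewrite dphi derive1_cutoff0// cutoff1//; last first.
    by move: xc => /andP[? ?]; rewrite !ltW.
  by rewrite mul1r mulr0 addr0 subrr.
apply: H1norm_sqr_lt => //; rewrite H1norm_sqr (L2norm_ae (L2_wderiv HB) (L2B Lc Lphi') D').
have e2 : 0 < e ^+ 2 by rewrite exprn_gt0.
move: hc; rewrite -mulrA; move: b1 b2 e2.
move: (L2norm _ ^+ 2) (L2norm _ ^+ 2) (e ^+ 2) (M ^+ 2 * (4 / c)).
by clear => x y z w; lra.
Qed.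

Lemma cs_ortho i j : L2inner (cs i) (cs j) = (i == j)%:R :> R.
Proof. by have := cs1_ortho i.+1 j.+1. Qed.

Lemma psum_H10 (a : nat -> R) n : H10 (psum sn a n) /\
  weak_derivative (psum sn a n) (psum cs (fun k => om k * a k) n).
Proof.
elim: n => [|n [IH1 IH2]].
  rewrite /psum !big_ord0; split; last first.
    by apply: C1_weak_derivative => x; exact: cvg_cst.
  have := H10_lin (- 1) (sn_H10 0) (sn_H10 0).
  by rewrite scaleN1r addNr.
have Ls := @L2_sn R; have Lc := @L2_cs R.
rewrite /psum !big_ord_recr/= addrC [X in weak_derivative _ X]addrC; split.
  exact: H10_lin (sn_H10 n) IH1.
have -> : (om n * a n) *: cs n = a n *: (om n *: cs n) :> (R -> R) by rewrite scalerA mulrC.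
apply: weak_derivative_lin => //.
- exact: L2Z.
- exact: (@L2_psum R sn Ls a n).
- exact: (@L2_psum R cs Lc (fun k => om k * a k) n).
- apply: C1_weak_derivative; first exact: continuous_sn.
  + by move=> y; apply: cvgM; [exact: cvg_cst|exact: continuous_cs].
  + exact: is_derive_sn.
Qed.

Lemma coef_approx f g (d : R) : L2 f -> L2 g -> L2inner g (cst 1) = 0 ->
  (forall k, L2inner g (cs k) = om k * L2inner f (sn k)) -> 0 < d ->
  exists n, L2norm (f - psum sn (fun k => L2inner f (sn k)) n) <= d /\
    L2norm (g - psum cs (fun k => om k * L2inner f (sn k)) n) <= d.
Proof.
move=> Lf Lg g0 gf d0.
have [N1 h1] := tail_norm (@L2_sn R) sn_ortho (@sn_complete R) Lf d0.
have [N2 h2] := tail_norm (@L2_cs1 R) cs1_ortho (@cs1_complete R) Lg d0.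
exists (maxn N1 N2); split; first by apply: h1; rewrite leq_maxl.
(* The constant mode of [g] is zero, so n + 1 terms in [cs1] are n terms in [cs]. *)
have -> : psum cs (fun k => om k * L2inner f (sn k)) (maxn N1 N2) =
    psum cs1 (fun k => L2inner g (cs1 k)) (maxn N1 N2).+1.
  rewrite /psum [RHS]big_ord_recl /= g0 scale0r add0r.
  by apply: eq_bigr => i _; rewrite /= add0n gf.
by apply: h2; apply: leqW; rewrite leq_maxr.
Qed.

Lemma H1_coef_approx f (e : R) : H1 f -> L2inner (wderiv f) (cst 1) = 0 ->
  (forall k, L2inner (wderiv f) (cs k) = om k * L2inner f (sn k)) -> 0 < e ->
  exists n, H1norm (f - psum sn (fun k => L2inner f (sn k)) n) <= e.
Proof.
move=> Hf g0 gf e0; have Lg := L2_wderiv Hf.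
have e20 : 0 < e / 2 by rewrite divr_gt0.
have [n [h1 h2]] := coef_approx (H1_L2 Hf) Lg g0 gf e20; exists n.
have [[Hn _] wn] := psum_H10 (fun k => L2inner f (sn k)) n.
have Lc := L2_psum (@L2_cs R) (fun k => om k * L2inner f (sn k)) n.
have [_ n'] := wderiv_ae (H1_L2 Hn) Lc wn; have [HB B'] := H1B Hf Hn.
have D' : wderiv (f - psum sn (fun k => L2inner f (sn k)) n) =
    wderiv f - psum cs (fun k => om k * L2inner f (sn k)) n %[ae mu].
  by apply: filterS2 B' n' => x k1 k2 _; rewrite (k1 I) !fctE (k2 I).
rewrite -ler_sqr ?nnegrE ?H1norm_ge0 ?(ltW e0)// H1norm_sqr.
rewrite (L2norm_ae (L2_wderiv HB) (L2B Lg Lc) D').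
move: h1 h2 (L2norm_ge0 (f - psum sn (fun k => L2inner f (sn k)) n))
  (L2norm_ge0 (wderiv f - psum cs (fun k => om k * L2inner f (sn k)) n)).
by move: (L2norm _) (L2norm _) => x y h1 h2 x0 y0; nra.
Qed.

(** The sine sums of [f] converge to [f] and their derivatives, cosine sums, converge to [g].
    Passing to the limit in the weak formulation makes [g] the weak derivative, and [f] is then an
    H1 limit of elements of H10. *)
Lemma H10_of_coef f g : L2 f -> L2 g -> L2inner g (cst 1) = 0 ->
  (forall k, L2inner g (cs k) = om k * L2inner f (sn k)) ->
  H10 f /\ wderiv f = g %[ae mu].
Proof.
move=> Lf Lg g0 gf; have Ls := @L2_sn R; have Lc := @L2_cs R.
pose a k := L2inner f (sn k); pose b k := om k * a k.
have Lfn n : L2 (psum sn a n) by exact: L2_psum.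
have Lgn n : L2 (psum cs b n) by exact: L2_psum.
have fg : weak_derivative f g.
  move=> phi hphi.
  have Lphi := continuous_L2 (Ccinfty_continuous hphi).
  have Lphi' := continuous_L2 (Ccinfty_derive1_continuous hphi).
  change (L2inner f (derive1 phi) = - L2inner g phi).
  suff : L2inner f (derive1 phi) + L2inner g phi = 0 by move/eqP; rewrite addr_eq0 => /eqP.
  apply: (@eq0_norm_le_small _ _ (L2norm (derive1 phi) + L2norm phi)) => e e0.
  have [n [h1 h2]] := coef_approx Lf Lg g0 gf e0.
  have -> : L2inner f (derive1 phi) + L2inner g phi =
      L2inner (f - psum sn a n) (derive1 phi) + L2inner (g - psum cs b n) phi.
    have E : L2inner (psum sn a n) (derive1 phi) = - L2inner (psum cs b n) phi := (psum_H10 a n).2 _ hphi.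
    by rewrite !L2innerBl// E opprK addrACA addrN addr0.
  apply: le_trans (ler_normD _ _) _; rewrite mulrDl; apply: lerD.
    apply: le_trans (L2_cauchy_schwarz (L2B Lf (Lfn n)) Lphi') _.
    by rewrite mulrC ler_wpM2l ?L2norm_ge0.
  apply: le_trans (L2_cauchy_schwarz (L2B Lg (Lgn n)) Lphi) _.
  by rewrite mulrC ler_wpM2l ?L2norm_ge0.
have [Hf f'] := wderiv_ae Lf Lg fg; split=> //; have Lf' := L2_wderiv Hf.
have w0 : L2inner (wderiv f) (cst 1) = 0 by rewrite (L2inner_ae Lf' Lg _ f')//; exact: L2_cst.
have wk k : L2inner (wderiv f) (cs k) = om k * L2inner f (sn k).
  by rewrite (L2inner_ae Lf' Lg (Lc k) f').
apply: H10_limit => // e e0; have s0 : 0 < Num.sqrt e by rewrite sqrtr_gt0.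
have [n hn] := H1_coef_approx Hf w0 wk s0; exists (psum sn a n); first exact: (psum_H10 a n).1.
by rewrite -[leRHS](sqr_sqrtr (ltW e0)) ler_sqr ?nnegrE ?H1norm_ge0 ?sqrtr_ge0.
Qed.

Lemma H10_H1 f : H10 f -> H1 f. Proof. by case. Qed.

Lemma H10_bessel f n : H10 f ->
  \sum_(k < n) (om k * L2inner f (sn k)) ^+ 2 <= L2norm (wderiv f) ^+ 2.
Proof.
move=> Hf; have [_ h] := H10_coef Hf.
under eq_bigr do rewrite -h.
exact: (@bessel R cs (@L2_cs R) cs_ortho (wderiv f) n (L2_wderiv (H10_H1 Hf))).
Qed.

(** Parseval in the complete cosine system bounds the derivative. Since om k >= 1, the same [M]
    bounds the function itself, a Poincare inequality, whence the factor 2. *)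
Lemma H10_norm_le f (M : R) : H10 f ->
  (forall n, \sum_(k < n) (om k * L2inner f (sn k)) ^+ 2 <= M) ->
  L2norm (wderiv f) ^+ 2 <= M /\ H1norm f ^+ 2 <= 2 * M.
Proof.
move=> Hf fM; have [h0 h] := H10_coef Hf.
have wM : L2norm (wderiv f) ^+ 2 <= M.
  apply: (parseval_le (@L2_cs1 R) cs1_ortho (@cs1_complete R) (L2_wderiv (H10_H1 Hf))).
  move=> [|n]; first by have := fM 0%N; rewrite !big_ord0.
  rewrite big_ord_recl /= h0 expr0n add0r; apply: le_trans (fM n).
  by apply: ler_sum => i _; rewrite /= add0n h.
split=> //; rewrite H1norm_sqr.
have : L2norm f ^+ 2 <= M.
  apply: (parseval_le (@L2_sn R) sn_ortho (@sn_complete R) (H1_L2 (H10_H1 Hf))).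
  move=> n; apply: le_trans (fM n); apply: ler_sum => i _.
  rewrite exprMn ler_peMl ?sqr_ge0// -[leLHS](expr1n _ 2).
  by rewrite lerXn2r ?nnegrE// ?om_ge1// ltW// om_gt0.
move: (L2norm _ ^+ 2) (L2norm _ ^+ 2) wM; clear => x y; lra.
Qed.

(** Riesz-Fischer is applied twice, to sines for the function and to cosines for its prospective
    derivative; [H10_of_coef] then ties the two together. *)
Lemma H10_synth (b : nat -> R) (M : R) : (forall n, \sum_(k < n) b k ^+ 2 <= M) ->
  exists f, H10 f /\ forall k, om k * L2inner f (sn k) = b k.
Proof.
move=> bM; have Ls := @L2_sn R.
have om0 k : om k != 0 :> R by rewrite gt_eqF// om_gt0.
have aM n : \sum_(k < n) (b k / om k) ^+ 2 <= M.
  apply: le_trans (bM n); apply: ler_sum => i _.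
  rewrite exprMn ler_piMr ?sqr_ge0// -[leRHS](expr1n _ 2).
  rewrite lerXn2r ?nnegrE// ?invr_ge0 ?invf_le1 ?om_ge1 ?om_gt0//.
  by rewrite ltW// om_gt0.
have [f [Lf fa _]] :=
  @riesz_fischer R sn Ls sn_ortho (fun k => b k / om k) M aM.
(* The constant mode is set to zero, as the derivative of an H10 function has mean zero. *)
pose b1 k := if k is j.+1 then b j else 0.
have b1M n : \sum_(k < n) b1 k ^+ 2 <= M.
  case: n => [|n]; first by have := bM 0%N; rewrite !big_ord0.
  rewrite big_ord_recl /= expr0n add0r; apply: le_trans (bM n).
  by apply: ler_sum => i _; rewrite /= add0n.
have [g [Lg ga _]] :=
  @riesz_fischer R cs1 (@L2_cs1 R) cs1_ortho b1 M b1M.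
exists f; split=> [|k]; last by rewrite fa mulrC divfK.
have [] // := @H10_of_coef f g Lf Lg (ga 0%N).
by move=> k; rewrite (ga k.+1) fa /= mulrC divfK.
Qed.

(** Endpoint values enter only through integration by parts without boundary terms, which yields the
    coefficient relations that characterise H10. *)
Lemma vanishing_H10 f : H1 f -> vanishes_at_endpoints f -> H10 f.
Proof.
move=> Hf [w [cw fw w0 w1]]; have [Lf' ff'] := wderivP Hf; have Lf := H1_L2 Hf.
have [g0 gf] := coef_of_parts Lf Lf' (fun h => weak_parts (h := h) Lf Lf' ff' cw fw w0 w1).
by have [] := H10_of_coef Lf Lf' g0 gf.
Qed.

End H10_fourier.

(** * The wave equation in coordinates *)

Section wave_system.
Context {R : realType}.
Local Notation mu := (mu01 R).
Implicit Types (f : R -> R) (b d G : R -> nat -> R).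

(* The integral starts at -1 so that [prim f] is derivable on both sides of 0. *)
Definition prim f (x : R) : R :=
  \int[lebesgue_measure]_(t in `[-1, x]) f t - \int[lebesgue_measure]_(t in `[-1, 0]) f t.

Lemma prim0 f : prim f 0 = 0. Proof. exact: subrr. Qed.

Lemma is_derive_prim f (x : R) : continuous f -> -1 < x -> is_derive x 1 (prim f) (f x).
Proof.
move=> cf x1.
have fi : lebesgue_measure.-integrable `[-1, x + 1] (EFin \o f).
  apply: continuous_compact_integrable; first exact: segment_compact.
  exact: continuous_subspaceT.
have xx : x < x + 1 by rewrite ltrDl.
have [dF F'] := continuous_FTC1_closed xx fi x1 (cf x).
have h : is_derive x 1 (fun x0 : R => \int[lebesgue_measure]_(t in `[-1, x0]) f t) (f x).
  by apply: (DeriveDef dF); rewrite -derive1E.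
rewrite -[f x]subr0; exact: is_deriveB.
Qed.

Lemma derive_within01 f (f' : R -> R) : (forall x : R, 0 <= x <= 1 -> is_derive x 1 f (f' x)) ->
  {within `[0, 1], continuous f}.
Proof.
move=> h; apply: derivable_within_continuous => x; rewrite in_itv/= => x01.
by have [] := h x x01.
Qed.

(** Gronwall's argument: f(y) exp(- y) has the nonpositive derivative (f' - f) exp(- y). *)
Lemma nonpos_of_derive_le f (f' : R -> R) : {within `[0, 1], continuous f} ->
  (forall x : R, 0 < x < 1 -> is_derive x 1 f (f' x)) ->
  (forall x : R, 0 < x < 1 -> f' x <= f x) -> f 0 <= 0 ->
  forall x : R, 0 <= x <= 1 -> f x <= 0.
Proof.
move=> cf h le f0 x /andP[x0 x1].
pose g (y : R) := f y * expR (- y).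
have dE (y : R) : is_derive y 1 (fun y : R => expR (- y)) (- expR (- y)).
  have h1 : is_derive y 1 (- id : R -> R) (- 1) := is_deriveN (is_derive_id y 1).
  have h2 := is_derive1_comp (is_derive_expR (- y)) h1.
  by move: h2; rewrite mulrN1.
have dg (y : R) : 0 < y < 1 -> is_derive y 1 g ((f' y - f y) * expR (- y)).
  move=> y01; have h1 := h y y01; have h3 := is_deriveM h1 (dE y).
  rewrite mulrBl; apply: is_derive_eq h3 _.
  rewrite /GRing.scale/=; move: (f y) (f' y) (expR (- y)); clear => a b c; ring.
have cg : {within `[0, 1], continuous g}.
  apply: within01M => //; apply: continuous_within01 => y.
  exact/differentiable_continuous/derivable1_diffP/(@ex_derive _ _ _ _ _ _ _ (dE y)).
have : g x <= g 0.
  apply: (@ler0_derive1_nincr R g 0 1) => // y; rewrite in_itv/= => y01.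
    by have [] := dg y y01.
  rewrite derive1E (@derive_val _ _ _ _ _ _ _ (dg y y01)).
  by rewrite mulr_le0_ge0 ?expR_ge0// subr_le0 le.
rewrite /g oppr0 expR0 mulr1 => /le_trans /(_ f0).
by rewrite pmulr_lle0// expR_gt0.
Qed.

(* For a solution u, [b x k] is om k <u, sn k>, the k-th cosine coefficient of
   the y-derivative, [d x k] is <u_x, sn k> and [G x k] is <P u, sn k>. *)
Definition wave b d G := forall k,
  [/\ {within `[0, 1], continuous (b^~ k)}, {within `[0, 1], continuous (d^~ k)} &
    forall x : R, 0 < x < 1 -> is_derive x 1 (b^~ k) (om k * d x k) /\
      is_derive x 1 (d^~ k) (- (om k * b x k) - G x k)].

Lemma within01B (f g : R -> R) : {within `[0, 1], continuous f} ->
  {within `[0, 1], continuous g} -> {within `[0, 1], continuous (fun x => f x - g x)}.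
Proof.
move=> cf cg.
move=> x.
by apply: cvgB; [exact: (cf x)|exact: (cg x)].
Qed.

Lemma waveB b d G b' d' G' : wave b d G -> wave b' d' G' ->
  wave (fun x k => b x k - b' x k) (fun x k => d x k - d' x k) (fun x k => G x k - G' x k).
Proof.
move=> h h' k; have [c1 c2 e] := h k; have [c1' c2' e'] := h' k.
split; [exact: within01B|exact: within01B|move=> x x01].
have [e1 e2] := e x x01; have [e1' e2'] := e' x x01; split.
  apply: is_derive_eq (is_deriveB e1 e1') _.
  by move: (om k) => o; ring.
apply: is_derive_eq (is_deriveB e2 e2') _.
by move: (om k) => o; ring.
Qed.

Definition energy b d n (x : R) := \sum_(k < n) (b x k ^+ 2 + d x k ^+ 2).

Lemma coord_energy b d G k : wave b d G ->
  {within `[0, 1], continuous (fun x => b x k ^+ 2 + d x k ^+ 2)} /\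
  forall x : R, 0 < x < 1 ->
    is_derive x 1 (fun x => b x k ^+ 2 + d x k ^+ 2) (- 2 * d x k * G x k).
Proof.
move=> h; have [c1 c2 e] := h k; split=> [|x x01].
  move=> x.
  by apply: cvgD; apply: cvg_expn; [exact: (c1 x)|exact: (c2 x)].
have [e1 e2] := e x x01.
apply: is_derive_eq (is_deriveD (is_deriveX 2 e1) (is_deriveX 2 e2)) _.
rewrite /GRing.scale/= !expr1.
by move: (om k) (b x k) (d x k) (G x k); clear => o p q r; ring.
Qed.

Lemma sum_energy b d G n : wave b d G ->
  {within `[0, 1], continuous (energy b d n)} /\
  forall x : R, 0 < x < 1 ->
    is_derive x 1 (energy b d n) (\sum_(k < n) (- 2 * d x k * G x k)).
Proof.
move=> h; elim: n => [|n [c e]].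
  have E0 : energy b d 0 = cst 0 by apply/funext => x; rewrite /energy big_ord0.
  rewrite E0; split; first by apply: continuous_within01; exact: cst_continuous.
  by move=> x x01; rewrite big_ord0; exact: is_derive_cst.
have E : energy b d n.+1 = (energy b d n + (fun x => b x n ^+ 2 + d x n ^+ 2)).
  by apply/funext => x; rewrite /energy big_ord_recr.
have [c' e'] := coord_energy n h.
rewrite E; split.
  move=> x.
  by apply: cvgD; [exact: (c x)|exact: (c' x)].
by move=> x x01; rewrite big_ord_recr/=; apply: is_deriveD; [exact: e|exact: e'].
Qed.

(* The energy E satisfies E' <= E + |G|^2, and K / (l - 1) * exp (l x) is a
   supersolution of this inequality. *)
Lemma wave_energy b d G n (K l : R) : 1 < l -> 0 <= K -> wave b d G ->
  (forall k, b 0 k = 0) -> (forall k, d 0 k = 0) ->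
  (forall s : R, 0 < s < 1 -> \sum_(k < n) G s k ^+ 2 <= K * expR (l * s)) ->
  forall x : R, 0 <= x <= 1 -> energy b d n x <= K / (l - 1) * expR (l * x).
Proof.
move=> l1 K0 h b0 d0 hG x x01.
have l10 : 0 < l - 1 by rewrite subr_gt0.
pose Z (x : R) := K / (l - 1) * expR (l * x).
have dZ (y : R) : is_derive y 1 Z (l * Z y).
  have h2 := is_derive1_comp (is_derive_expR (l * y)) (is_derive_mulr l y).
  apply: is_derive_eq (is_deriveZ (K / (l - 1)) h2) _.
  by rewrite /Z /GRing.scale/=; move: (expR _) (_ / _); clear => a c; ring.
have [cE dE] := sum_energy n h.
rewrite -subr_le0; apply: (@nonpos_of_derive_le (fun x => energy b d n x - Z x)
  (fun x => \sum_(k < n) (- 2 * d x k * G x k) - l * Z x)) => //.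
- apply: within01B => //; apply: continuous_within01 => y.
  exact/differentiable_continuous/derivable1_diffP/(@ex_derive _ _ _ _ _ _ _ (dZ y)).
- by move=> y y01; apply: is_deriveB => //; exact: dE.
- move=> y y01.
  have h1 : \sum_(k < n) (- 2 * d y k * G y k) <= energy b d n y + \sum_(k < n) G y k ^+ 2.
    rewrite /energy -big_split/=; apply: ler_sum => k _.
    move: (b y k) (d y k) (G y k); clear => p q r.
    by have := sqr_ge0 (q + r); have := sqr_ge0 p; rewrite sqrrD !expr2; lra.
  have h2 : K * expR (l * y) = (l - 1) * Z y.
    by rewrite /Z mulrA mulrCA divff ?gt_eqF// mulr1.
  have := hG y y01; rewrite h2.
  by move: h1; move: (energy _ _ _ _) (\sum_(k < n) _) (\sum_(k < n) _) (Z y); clear => a c e z; lra.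
- rewrite /energy big1 => [|k _]; last by rewrite b0 d0 expr0n/= addr0.
  by rewrite sub0r oppr_le0 /Z mulr_ge0 ?expR_ge0// divr_ge0// ltW.
Qed.

(** The majorant makes the tails beyond some [N] small for all [t] near the limit at once; the
    finitely many remaining terms converge one by one. *)
Lemma ell2_dominated (F : set_system R) {FF : Filter F} (r : R -> nat -> R) (m : nat -> R) (M : R) :
  (forall k, r t k @[t --> F] --> (0 : R)) ->
  (\forall t \near F, forall k, r t k ^+ 2 <= m k) ->
  (forall n, \sum_(k < n) m k <= M) -> (forall k, 0 <= m k) ->
  forall e : R, 0 < e -> \forall t \near F, forall n, \sum_(k < n) r t k ^+ 2 <= e.
Proof.
move=> r0 rm mM m0 e e0.
have e2 : 0 < e / 2 by rewrite divr_gt0.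
have [N hN] := bounded_sum_tail m0 mM e2.
have hs : \sum_(k < N) r t k ^+ 2 @[t --> F] --> (0 : R).
  elim: (N) => [|j IH].
    rewrite (_ : (fun t => _) = cst 0); first exact: cvg_cst.
    by apply/funext => t; rewrite big_ord0.
  rewrite (_ : (fun t => _) = (fun t => \sum_(k < j) r t k ^+ 2 + r t j ^+ 2)).
    rewrite -[X in _ --> X]addr0; apply: cvgD => //.
    have E : (0 : R) ^+ 2 = 0 by rewrite expr0n.
    by have := @cvg_expn R R F FF (r^~ j) 0 2 (r0 j); rewrite E.
  by apply/funext => t; rewrite big_ord_recr.
have hs' : \forall t \near F, \sum_(k < N) r t k ^+ 2 < e / 2.
  by apply: (cvgr_lt _ hs).
apply: filterS2 rm hs' => t ht hN' n.
have [nN|Nn] := leqP n N.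
  apply: le_trans (_ : \sum_(k < N) r t k ^+ 2 <= _); last first.
    by apply: le_trans (ltW hN') _; lra.
  rewrite -!(big_mkord xpredT (fun k => r t k ^+ 2)) (big_cat_nat (leq0n n) nN)//= lerDl.
  by apply: sumr_ge0 => k _; exact: sqr_ge0.
rewrite -(big_mkord xpredT (fun k => r t k ^+ 2)) (big_cat_nat (leq0n N) (ltnW Nn))//= big_mkord.
rewrite [leRHS]splitr; apply: lerD; first exact: ltW.
apply: le_trans (hN n); apply: ler_sum_nat => k _; exact: ht.
Qed.

Lemma derive_le_slope f (f' : R -> R) (A : R) :
  (forall x : R, 0 <= x <= 1 -> is_derive x 1 f (f' x)) ->
  (forall x : R, 0 <= x <= 1 -> f' x <= A) ->
  forall x y : R, 0 <= x -> x <= y -> y <= 1 -> f y - f x <= A * (y - x).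
Proof.
move=> h le x y x0 xy y1.
have dg (z : R) : 0 <= z <= 1 -> is_derive z 1 (fun z => f z - A * z) (f' z - A).
  by move=> z01; apply: is_deriveB; [exact: h|exact: is_derive_mulr].
have : f y - A * y <= f x - A * x.
  apply: (@ler0_derive1_nincr R (fun z => f z - A * z) 0 1) => //.
  - by move=> z /andP[z0 z1]; have [] := dg z; rewrite ?ltW.
  - move=> z /andP[z0 z1]; have z01 : 0 <= z <= 1 by rewrite !ltW.
    by rewrite derive1E (@derive_val _ _ _ _ _ _ _ (dg z z01)) subr_le0 le.
  - exact: derive_within01 dg.
by move: (f x) (f y) (A) => a b c; lra.
Qed.

Lemma is_derive_primP f (x : R) : continuous f -> 0 <= x <= 1 -> is_derive x 1 (prim f) (f x).
Proof. by move=> cf /andP[x0 _]; apply: is_derive_prim => //; apply: lt_le_trans x0; rewrite oppr_lt0. Qed.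

Lemma prim_ndecr f : continuous f -> (forall x, 0 <= f x) ->
  forall x y : R, 0 <= x -> x <= y -> y <= 1 -> prim f x <= prim f y.
Proof.
move=> cf f0 x y x0 xy y1.
have dg (z : R) : 0 <= z <= 1 -> is_derive z 1 (- prim f) (- f z).
  by move=> z01; apply: is_deriveN; exact: is_derive_primP.
have := derive_le_slope dg (A := 0) _ x0 xy y1.
by rewrite mul0r !fctE opprK addrC subr_le0; apply => z _; rewrite oppr_le0.
Qed.

(** The sum of the primitives has derivative at most [A] on [0, 1]. It serves to sum the majorant of
    [sol_bound]. *)
Lemma sum_prim_le n (f : nat -> R -> R) (A : R) : (forall k, continuous (f k)) ->
  (forall s : R, \sum_(k < n) f k s <= A) -> \sum_(k < n) prim (f k) 1 <= A.
Proof.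
move=> cf fA.
have dg (z : R) : 0 <= z <= 1 -> is_derive z 1 (\sum_(k < n) prim (f k)) (\sum_(k < n) f k z).
  by move=> z01; apply: is_derive_sum => k; exact: is_derive_primP.
have := derive_le_slope dg (fun z _ => fA z) (lexx 0) ler01 (lexx 1).
rewrite !fct_sumE [X in _ - X]big1 => [|k _]; last exact: prim0.
by rewrite !subr0 mulr1.
Qed.

(* Variation of constants. *)
Definition solb G (b0 : nat -> R) (x : R) (k : nat) : R :=
  cos (om k * x) * b0 k - sin (om k * x) * prim (fun s => cos (om k * s) * G s k) x
  + cos (om k * x) * prim (fun s => sin (om k * s) * G s k) x.

Definition sold G (b0 : nat -> R) (x : R) (k : nat) : R :=
  - (sin (om k * x) * b0 k) - cos (om k * x) * prim (fun s => cos (om k * s) * G s k) x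
  - sin (om k * x) * prim (fun s => sin (om k * s) * G s k) x.

Section solution.
Variables (G : R -> nat -> R) (b0 : nat -> R).
Hypothesis cG : forall k, continuous (G^~ k).

Lemma sol_derive k (x : R) : 0 <= x <= 1 ->
  is_derive x 1 (solb G b0 ^~ k) (om k * sold G b0 x k) /\
  is_derive x 1 (sold G b0 ^~ k) (- (om k * solb G b0 x k) - G x k).
Proof.
move=> x01.
have cC : continuous (fun s => cos (om k * s) * G s k).
  by move=> s; apply: cvgM; [exact: continuous_cosM|exact: cG].
have cS : continuous (fun s => sin (om k * s) * G s k).
  by move=> s; apply: cvgM; [exact: continuous_sinM|exact: cG].
have dC := is_derive_primP cC x01; have dS := is_derive_primP cS x01.
have dc := is_derive_cosM (om k) x; have ds := is_derive_sinM (om k) x.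
have dK (c : R) := is_derive_cst c x 1.
have e2 : cos (om k * x) ^+ 2 + sin (om k * x) ^+ 2 = 1 := cos2Dsin2 _.
split.
  apply: is_derive_eq (is_deriveD (is_deriveB (is_deriveM dc (dK (b0 k)))
    (is_deriveM ds dC)) (is_deriveM dc dS)) _.
  rewrite /sold /GRing.scale/=.
  move: (prim (fun s => cos (om k * s) * G s k) x) (prim (fun s => sin (om k * s) * G s k) x) => p q.
  move: (om k) (b0 k) (G x k) (cos _) (sin _); clear -p q => o b g c s; ring.
apply: is_derive_eq (is_deriveB (is_deriveB (is_deriveN (is_deriveM ds (dK (b0 k))))
    (is_deriveM dc dC)) (is_deriveM ds dS)) _.
rewrite /solb /GRing.scale/= -[in RHS](mul1r (G x k)) -e2.
move: (prim (fun s => cos (om k * s) * G s k) x) (prim (fun s => sin (om k * s) * G s k) x) => p q.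
move: (om k) (b0 k) (G x k) (cos _) (sin _); clear -p q => o b g c s; ring.
Qed.

Lemma sol0 k : solb G b0 0 k = b0 k /\ sold G b0 0 k = 0.
Proof.
rewrite /solb /sold !prim0 mulr0 sin0 cos0.
by split; rewrite ?mulr0 ?mul0r ?mul1r ?oppr0 ?subr0 ?addr0.
Qed.

Lemma sol_wave : wave (solb G b0) (sold G b0) G.
Proof.
move=> k; split.
- by apply: (derive_within01 (f' := fun x => om k * sold G b0 x k)) => x /(sol_derive k) [].
- by apply: (derive_within01 (f' := fun x => - (om k * solb G b0 x k) - G x k)) => x /(sol_derive k) [].
- by move=> x /andP[x0 x1]; apply: sol_derive; rewrite !ltW.
Qed.

(** Dominated convergence in l2 asks for a summable majorant independent of [x]; sums bounded at
    each [x] separately would not suffice. The energy balance of a single mode provides it. *)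
Lemma sol_bound (A B : R) : (forall s n, \sum_(k < n) G s k ^+ 2 <= A) ->
  (forall n, \sum_(k < n) b0 k ^+ 2 <= B) ->
  exists m : nat -> R, [/\ forall k, 0 <= m k, forall n, \sum_(k < n) m k <= expR 1 * (B + A) &
    forall (x : R) k, 0 <= x <= 1 -> solb G b0 x k ^+ 2 + sold G b0 x k ^+ 2 <= m k].
Proof.
move=> GA bB.
have cG2 k : continuous (fun s => G s k ^+ 2).
  by move=> s; apply: cvg_expn; exact: cG.
have p0 k : 0 <= prim (fun s => G s k ^+ 2) 1.
  rewrite -(prim0 (fun s => G s k ^+ 2)).
  by apply: prim_ndecr => // s; exact: sqr_ge0.
(* The energy of mode k at x is compared with exp(x) times the sum of b0_k^2 and the integral of
   G_k^2 up to x, which is then increased to its value at x = 1. *)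
exists (fun k => expR 1 * (b0 k ^+ 2 + prim (fun s => G s k ^+ 2) 1)); split.
- by move=> k; rewrite mulr_ge0 ?expR_ge0// addr_ge0// sqr_ge0.
- move=> n; rewrite -mulr_sumr ler_wpM2l ?expR_ge0// big_split/=.
  apply: lerD; first exact: bB.
  exact: (@sum_prim_le n (fun k s => G s k ^+ 2) A cG2 (fun s => GA s n)).
move=> x k /andP[x0 x1].
have [cE dE] := coord_energy k sol_wave.
have dZ (y : R) : 0 <= y <= 1 -> is_derive y 1
    (fun y => expR y * (b0 k ^+ 2 + prim (fun s => G s k ^+ 2) y))
    (expR y * (b0 k ^+ 2 + prim (fun s => G s k ^+ 2) y) + expR y * G y k ^+ 2).
  move=> y01; have h1 := is_derive_primP (cG2 k) y01.
  apply: is_derive_eq (is_deriveM (is_derive_expR y) (is_deriveD (is_derive_cst (b0 k ^+ 2) y 1) h1)) _.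
  rewrite /GRing.scale/= add0r addrC !fctE; congr (_ + _).
  exact: mulrC.
have le1 : solb G b0 x k ^+ 2 + sold G b0 x k ^+ 2 <=
    expR x * (b0 k ^+ 2 + prim (fun s => G s k ^+ 2) x).
  rewrite -subr_le0.
  apply: (@nonpos_of_derive_le (fun x => solb G b0 x k ^+ 2 + sold G b0 x k ^+ 2 -
    expR x * (b0 k ^+ 2 + prim (fun s => G s k ^+ 2) x))
    (fun y => - 2 * sold G b0 y k * G y k - (expR y * (b0 k ^+ 2 + prim (fun s => G s k ^+ 2) y) + expR y * G y k ^+ 2))).
  - by apply: within01B => //; apply: derive_within01 dZ.
  - by move=> y y01; apply: is_deriveB; [exact: dE|apply: dZ; case/andP: y01 => *; rewrite !ltW].
  - move=> y /andP[y0 y1].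
    have e1 : 1 <= expR y by apply: le_trans (expR_ge1Dx y); rewrite lerDl ltW.
    move: (solb _ _ _ _) (sold _ _ _ _) (G y k) (expR y) (expR y * (b0 k ^+ 2 + _)) e1; clear.
    move=> b d g e z e1.
    have h1 : g ^+ 2 <= e * g ^+ 2 by rewrite ler_peMl// sqr_ge0.
    have h2 := sqr_ge0 (d + g); have h3 := sqr_ge0 b.
    move: h1 h2 h3; rewrite sqrrD; move: (e * _) (b ^+ 2) => p q; rewrite !expr2; lra.
  - by have [-> ->] := sol0 k; rewrite prim0 expR0 mul1r expr0n/= !addr0 subrr.
  - by rewrite x0.
apply: le_trans le1 _; apply: ler_pM; rewrite ?expR_ge0 ?ler_expR//.
  apply: addr_ge0; first exact: sqr_ge0.
  rewrite -(prim0 (fun s => G s k ^+ 2)).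
  by apply: prim_ndecr => // s; exact: sqr_ge0.
by rewrite lerD2l; apply: prim_ndecr => // s; exact: sqr_ge0.
Qed.

End solution.

End wave_system.

(** * Picard iteration and uniqueness in l2 *)

Section wave_existence.
Context {R : realType}.
Implicit Types (f : R -> R) (b d G : R -> nat -> R) (a : nat -> R).

Lemma cvg_sum_sqr {T : Type} (F : set_system T) {FF : Filter F} (r : T -> nat -> R) a n :
  (forall k, r t k @[t --> F] --> a k) ->
  \sum_(k < n) r t k ^+ 2 @[t --> F] --> \sum_(k < n) a k ^+ 2.
Proof.
move=> ra; elim: n => [|n IH].
  rewrite big_ord0 (_ : (fun t => _) = cst 0); first exact: cvg_cst.
  by apply/funext => t; rewrite big_ord0.
rewrite big_ord_recr (_ : (fun t => _) = (fun t => \sum_(k < n) r t k ^+ 2 + r t n ^+ 2)).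
  by apply: cvgD => //; exact: (@cvg_expn R T F FF (r^~ n) (a n) 2 (ra n)).
by apply/funext => t; rewrite big_ord_recr.
Qed.

Lemma sum_sqrD_le a a' n :
  \sum_(k < n) (a k + a' k) ^+ 2 <= 2 * (\sum_(k < n) a k ^+ 2) + 2 * (\sum_(k < n) a' k ^+ 2).
Proof.
rewrite !mulr_sumr -big_split/=; apply: ler_sum => k _.
by have := sqr_ge0 (a k - a' k); rewrite sqrrB sqrrD; move: (a k) (a' k) => x y; lra.
Qed.

Lemma sqr_le_sum a k : a k ^+ 2 <= \sum_(i < k.+1) a i ^+ 2.
Proof. by rewrite big_ord_recr/= lerDr; apply: sumr_ge0 => i _; exact: sqr_ge0. Qed.

Lemma div_exp4_small (c e : R) : 0 <= c -> 0 < e -> exists j, c / 4 ^+ j < e.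
Proof.
move=> c0 e0.
have : c / 4 ^+ j @[j --> \oo] --> (0 : R).
  rewrite -(mulr0 c); apply: cvgMr.
  rewrite (_ : (fun j => _) = (fun j => 4^-1 ^+ j)); last by apply/funext => j; rewrite exprVn.
  by apply: cvg_expr; rewrite ger0_norm// invf_lt1// ltr1n.
by move=> /cvgr_lt /(_ _ e0) [j _ h]; exists j; apply: h => /=.
Qed.

Lemma le0_div_exp4 (c x : R) : 0 <= c -> (forall j, x <= c / 4 ^+ j) -> x <= 0.
Proof.
move=> c0 h; rewrite leNgt; apply/negP => x0.
by have [j hj] := div_exp4_small c0 x0; have := h j; rewrite leNgt hj.
Qed.

(* Precomposition with [clamp] turns continuity on [0, 1] into continuity on the
   whole line. *)
Definition clamp (x : R) : R := Num.max 0 (Num.min x 1).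

Lemma clamp01 x : 0 <= clamp x <= 1.
Proof. by rewrite /clamp le_max lexx/= ge_max ler01/= ge_min lexx orbT. Qed.

Lemma clampE (x : R) : 0 <= x <= 1 -> clamp x = x.
Proof. by move=> /andP[x0 x1]; rewrite /clamp min_l// max_r. Qed.

Lemma continuous_clamp : continuous clamp.
Proof.
move=> x; apply: (@continuous_max R R (cst 0) (id \min cst 1) x); first exact: cvg_cst.
by apply: (@continuous_min R R id (cst 1) x) => //; exact: cvg_cst.
Qed.

Definition ell2 a := exists M, forall n, \sum_(k < n) a k ^+ 2 <= M.

Definition ell2_cont b := forall x : R, 0 <= x <= 1 -> forall e : R, 0 < e ->
  \forall t \near within `[0, 1] (nbhs x), forall n, \sum_(k < n) (b t k - b x k) ^+ 2 <= e.

Definition ell2_bnd b (M : R) := forall (x : R) n, 0 <= x <= 1 -> \sum_(k < n) b x k ^+ 2 <= M.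

Lemma dominated_ell2_cont b (m : nat -> R) (M : R) :
  (forall k, {within `[0, 1], continuous (b^~ k)}) ->
  (forall (x : R) k, 0 <= x <= 1 -> b x k ^+ 2 <= m k) ->
  (forall n, \sum_(k < n) m k <= M) -> (forall k, 0 <= m k) -> ell2_cont b.
Proof.
move=> cb le1 mM m0 x x01; apply: (@ell2_dominated R (within `[0, 1] (nbhs x)) _
  (fun t k => b t k - b x k) (fun k => 4 * m k) (4 * M)).
- move=> k; rewrite -[X in _ --> X](subrr (b x k)); apply: cvgB; last exact: cvg_cst.
  by move/subspace_continuousP: (cb k); apply; rewrite /= in_itv.
- apply: filterS (@near_withinT _ (nbhs x) `[0, 1]%classic _) => t; rewrite /= in_itv/= => t01 k.
  have := le1 t k t01; have := le1 x k x01.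
  have := sqr_ge0 (b t k + b x k); rewrite sqrrB sqrrD.
  by move: (b t k) (b x k) (m k) => p q r; lra.
- by move=> n; rewrite -mulr_sumr ler_wpM2l.
- by move=> k; rewrite mulr_ge0.
Qed.

Lemma ell2_cont_clamp b : ell2_cont b -> forall (x e : R), 0 < e ->
  \forall t \near x, forall n, \sum_(k < n) (b (clamp t) k - b (clamp x) k) ^+ 2 <= e.
Proof.
move=> cb x e e0; have h := cb (clamp x) (clamp01 x) _ e0.
have h2 : \forall t \near x, `[0, 1]%classic (clamp t) -> forall n,
    \sum_(k < n) (b (clamp t) k - b (clamp x) k) ^+ 2 <= e.
  exact: (continuous_clamp h).
by apply: filterS h2 => t; apply; exact: clamp01.
Qed.

Section contraction.
Variables (T : (nat -> R) -> nat -> R) (K : R) (b0 : nat -> R).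
Hypothesis K0 : 0 < K.
Hypothesis T0 : forall k, T (fun=> 0) k = 0.
Hypothesis lipT : forall a a' M, ell2 a -> ell2 a' ->
  (forall n, \sum_(k < n) (a k - a' k) ^+ 2 <= M) ->
  forall n, \sum_(k < n) (T a k - T a' k) ^+ 2 <= K * M.

(** [T] stands for the operator P in coordinates, from [b] to the sine coefficients of P u. The
    clamp gives continuity on the whole line, which [sol_derive] needs for two-sided derivatives at
    0 and 1. *)
Definition source b (x : R) : nat -> R := T (b (clamp x)).

Lemma source_bnd b M : ell2_bnd b M -> forall s n, \sum_(k < n) source b s k ^+ 2 <= K * M.
Proof.
move=> bM s n.
have bM' n' := bM (clamp s) n' (clamp01 s).
have z : ell2 (fun=> 0) by exists 0 => m; rewrite big1// => k _; rewrite expr0n.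
have h := @lipT (b (clamp s)) (fun=> 0) M (ex_intro _ M bM') z.
have E : \sum_(k < n) source b s k ^+ 2 = \sum_(k < n) (T (b (clamp s)) k - T (fun=> 0) k) ^+ 2.
  by apply: eq_bigr => k _; rewrite T0 subr0.
rewrite E; apply: h => m.
by under eq_bigr do rewrite subr0.
Qed.

Lemma source_cont b M : ell2_bnd b M -> ell2_cont b -> forall k, continuous (source b ^~ k).
Proof.
move=> bM cb k x; apply/cvgrPdist_lt => e e0.
have e'0 : 0 < e ^+ 2 / (2 * K) by rewrite divr_gt0 ?exprn_gt0// mulr_gt0.
apply: filterS (ell2_cont_clamp cb x e'0) => t ht.
have ell x' : ell2 (b (clamp x')) by exists M => n; apply: bM; exact: clamp01.
have h3 := @lipT (b (clamp t)) (b (clamp x)) _ (ell t) (ell x) ht k.+1.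
have h4 := le_trans (sqr_le_sum (fun k => source b t k - source b x k) k) h3.
have h5 : (source b t k - source b x k) ^+ 2 < e ^+ 2.
  apply: le_lt_trans h4 _.
  have -> : K * (e ^+ 2 / (2 * K)) = e ^+ 2 / 2.
    by rewrite invfM mulrCA [K * _]mulrCA divff ?lt0r_neq0// mulr1.
  by rewrite ltr_pdivrMr// ltr_pMr ?exprn_gt0// ltr1n.
rewrite distrC -(ger0_norm (ltW e0)) -ltr_sqr ?nnegrE// !real_normK ?num_real//.
Qed.

Hypothesis b0l2 : ell2 b0.

Lemma sol_good G (A : R) : (forall k, continuous (G^~ k)) ->
  (forall s n, \sum_(k < n) G s k ^+ 2 <= A) ->
  [/\ ell2_cont (solb G b0), ell2_cont (sold G b0) & exists M, ell2_bnd (solb G b0) M].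
Proof.
move=> cG GA; have [B hB] := b0l2.
have [m [m0 mM hm]] := sol_bound cG GA hB.
have le1 (x : R) k : 0 <= x <= 1 -> solb G b0 x k ^+ 2 <= m k.
  by move=> x01; apply: le_trans (hm x k x01); rewrite lerDl sqr_ge0.
have le2 (x : R) k : 0 <= x <= 1 -> sold G b0 x k ^+ 2 <= m k.
  by move=> x01; apply: le_trans (hm x k x01); rewrite lerDr sqr_ge0.
split.
- by apply: (dominated_ell2_cont _ le1 mM m0) => k; have [] := sol_wave b0 cG k.
- by apply: (dominated_ell2_cont _ le2 mM m0) => k; have [] := sol_wave b0 cG k.
exists (expR 1 * (B + A)) => x n x01; apply: le_trans (mM n).
by apply: ler_sum => k _; exact: le1.
Qed.

(** Only the [b] component is iterated, because the source depends on u and not on u_x. *)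
Fixpoint picard (j : nat) : R -> nat -> R :=
  if j is i.+1 then solb (source (picard i)) b0 else fun _ _ => 0.

Lemma picard_good j : ell2_cont (picard j) /\ exists M, ell2_bnd (picard j) M.
Proof.
elim: j => [|j [cj [M bM]]] /=.
  split; last by exists 0 => x n _; rewrite big1// => k _; rewrite expr0n.
  move=> x _ e e0; apply: nearW => t n.
  by rewrite big1 ?(ltW e0)// => k _; rewrite subrr expr0n.
by have [] := sol_good (source_cont bM cj) (source_bnd bM).
Qed.

Lemma picard_source j : (forall k, continuous (source (picard j) ^~ k)) /\
  forall x, ell2 (picard j (clamp x)).
Proof.
have [cj [M bM]] := picard_good j; split; first exact: source_cont bM cj.
by move=> x; exists M => n; apply: bM; exact: clamp01.
Qed.

Let l := 4 * K + 1.

Let l1 : 1 < l. Proof. by rewrite /l ltrDr mulr_gt0. Qed.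

(* For the weight exp (l x) with l = 4 K + 1 the Picard map divides squared
   distances by 4. *)
Lemma solb_dist G G' (M : R) n : 0 <= M ->
  (forall k, continuous (G^~ k)) -> (forall k, continuous (G'^~ k)) ->
  (forall s : R, 0 < s < 1 -> \sum_(k < n) (G s k - G' s k) ^+ 2 <= K * (M * expR (l * s))) ->
  forall x : R, 0 <= x <= 1 -> \sum_(k < n) (solb G b0 x k - solb G' b0 x k) ^+ 2 <= M / 4 * expR (l * x).
Proof.
move=> M0 cG cG' h x x01.
have W := waveB (sol_wave b0 cG) (sol_wave b0 cG').
have h1 := @wave_energy R _ _ _ n (K * M) l l1 (mulr_ge0 (ltW K0) M0) W.
have E : K * M / (l - 1) = M / 4.
  by rewrite /l addrK [K * M]mulrC -mulrA invfM [K * _]mulrCA divff ?lt0r_neq0// mulr1.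
rewrite -E; apply: le_trans (h1 _ _ _ x x01).
- by apply: ler_sum => k _; rewrite lerDl sqr_ge0.
- by move=> k; have [-> _] := sol0 G b0 k; have [-> _] := sol0 G' b0 k; rewrite subrr.
- by move=> k; have [_ ->] := sol0 G b0 k; have [_ ->] := sol0 G' b0 k; rewrite subrr.
- by move=> s s01; rewrite -mulrA; exact: h.
Qed.

Lemma picard_step : exists2 A : R, 0 <= A & forall j n (x : R), 0 <= x <= 1 ->
  \sum_(k < n) (picard j.+1 x k - picard j x k) ^+ 2 <= A / 4 ^+ j * expR (l * x).
Proof.
(* The iterate of index 0 is zero, so a bound on the next one bounds the first step. *)
have [c1 [A bA]] := picard_good 1.
have A0 : 0 <= A by have := bA 0 0%N; rewrite lexx ler01 big_ord0; exact.
exists A => //; elim=> [|j IH] n x x01.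
  rewrite expr0 divr1; apply: (@le_trans _ _ A).
    by under eq_bigr do rewrite subr0; exact: bA.
  rewrite ler_peMr// -expR0 ler_expR mulr_ge0//; last by case/andP: x01.
  by apply: le_trans (ltW l1); exact: ler01.
have [g1 e1] := picard_source j.+1; have [g0 e0] := picard_source j.
have E : A / 4 ^+ j.+1 = A / 4 ^+ j / 4 by rewrite exprSr invfM mulrA.
rewrite E; apply: (solb_dist (divr_ge0 A0 _) g1 g0 _ x01); first exact: exprn_ge0.
move=> s /andP[s0 s1]; have s01 : 0 <= s <= 1 by rewrite !ltW.
apply: (lipT (e1 s) (e0 s)) => m.
by rewrite clampE//; exact: IH.
Qed.

Lemma picard_cauchy : exists2 B : R, 0 <= B & forall i j n (x : R), 0 <= x <= 1 ->
  \sum_(k < n) (picard (j + i) x k - picard j x k) ^+ 2 <= B / 4 ^+ j.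
Proof.
have [A A0 hA] := picard_step.
have C0 : 0 <= A * expR l by rewrite mulr_ge0 ?expR_ge0.
have l0 : 0 <= l by apply: le_trans (ltW l1); exact: ler01.
(* With B = 4 A exp(l) the bound reproduces itself: the step from j to j + 1 and the distance from
   there on are both at most B / 4^(j + 1), and (p + q)^2 <= 2 p^2 + 2 q^2 adds them up to B /
   4^j. *)
exists (4 * (A * expR l)); first by rewrite mulr_ge0.
elim=> [|i IH] j n x x01.
  rewrite addn0 big1 => [|k _]; last by rewrite subrr expr0n.
  by rewrite divr_ge0 ?exprn_ge0// mulr_ge0.
have h1 : \sum_(k < n) (picard j.+1 x k - picard j x k) ^+ 2 <= A * expR l / 4 ^+ j.
  apply: le_trans (hA j n x x01) _; rewrite mulrAC ler_wpM2r ?invr_ge0 ?exprn_ge0//.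
  rewrite ler_wpM2l// ler_expR -[leRHS]mulr1 ler_wpM2l//.
  by case/andP: x01.
have h2 := IH j.+1 n x x01.
have h3 := sum_sqrD_le (fun k => picard (j.+1 + i) x k - picard j.+1 x k)
  (fun k => picard j.+1 x k - picard j x k) n.
rewrite addnS -addSn.
have E : 4 * (A * expR l) / 4 ^+ j.+1 = A * expR l / 4 ^+ j.
  by rewrite exprS invfM mulrACA divff ?mul1r// pnatr_eq0.
have E2 : \sum_(k < n) (picard (j.+1 + i) x k - picard j x k) ^+ 2 =
   \sum_(k < n) (picard (j.+1 + i) x k - picard j.+1 x k + (picard j.+1 x k - picard j x k)) ^+ 2.
  by apply: eq_bigr => k _; rewrite addrA subrK.
rewrite E2 -mulrA; apply: le_trans h3 _; rewrite E in h2.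
move: h1 h2; move: (\sum_(k < n) _) (\sum_(k < n) _) (_ / _) => p q r; lra.
Qed.

(** Every coordinate is a Cauchy sequence, and the geometric bound passes to the limit because each
    partial sum is finite. *)
Lemma picard_limit : exists b (B : R), 0 <= B /\ forall j n (x : R), 0 <= x <= 1 ->
  \sum_(k < n) (b x k - picard j x k) ^+ 2 <= B / 4 ^+ j.
Proof.
have [B B0 hB] := picard_cauchy.
exists (fun x k => lim (picard m x k @[m --> \oo])), B; split=> // j n x x01.
have cv k : picard m x k @[m --> \oo] --> lim (picard m x k @[m --> \oo]).
  apply: cauchy_cvg; apply: cauchy_exP => e e0.
  have [i hi] := div_exp4_small B0 (exprn_gt0 2 e0).
  exists (picard i x k); exists i => // m /= im.
  have h := le_lt_trans (le_trans (sqr_le_sum (fun k => picard (i + (m - i)) x k - picard i x k) k) (hB (m - i)%N i k.+1 x x01)) hi.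
  rewrite subnKC// in h.
  rewrite -ball_normE/= distrC -(ger0_norm (ltW e0)) -ltr_sqr ?nnegrE//.
  by rewrite !real_normK ?num_real.
have cw k : picard m x k - picard j x k @[m --> \oo] -->
    lim (picard m x k @[m --> \oo]) - picard j x k.
  by apply: cvgB; [exact: cv|exact: cvg_cst].
have h : \sum_(k < n) (picard m x k - picard j x k) ^+ 2 @[m --> \oo] -->
    \sum_(k < n) (lim (picard m x k @[m --> \oo]) - picard j x k) ^+ 2.
  have FF : Filter (\oo : set_system nat) := @filter_filter _ _ eventually_filter.
  exact: (@cvg_sum_sqr nat \oo FF (fun m k => picard m x k - picard j x k) _ n cw).
rewrite -(cvg_lim (@Rhausdorff R) h); apply: limr_le; first by apply/cvg_ex; eexists; exact: h.
by exists j => // m /= jm; have := hB (m - j)%N j n x x01; rewrite subnKC.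
Qed.

Lemma wave_fixpoint : exists b (B : R), [/\ ell2_bnd b B, ell2_cont b &
  forall (x : R) k, 0 <= x <= 1 -> solb (source b) b0 x k = b x k].
Proof.
have [b [B [B0 hb]]] := picard_limit; exists b, B.
have bB : ell2_bnd b B.
  move=> x n x01; have := hb 0 n x x01; rewrite expr0 divr1; apply: le_trans.
  by apply: ler_sum => k _; rewrite subr0.
have cb : ell2_cont b.
  move=> x x01 e e0.
  (* Splitting into three differences by (p + q)^2 <= 2 p^2 + 2 q^2, used twice, costs the factors
     2, 4 and 4, which sum to less than 12. *)
  have e1 : 0 < e / 12 by rewrite divr_gt0.
  have [j hj] := div_exp4_small B0 e1.
  have [cj _] := picard_good j.
  apply: filterS2 (cj x x01 _ e1) (@near_withinT _ (nbhs x) `[0, 1]%classic _) => t h.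
  rewrite /= in_itv/= => t01 n.
  have h1 := hb j n t t01; have h2 := hb j n x x01; have h3 := h n.
  have E : \sum_(k < n) (b t k - b x k) ^+ 2 = \sum_(k < n) (b t k - picard j t k +
      (picard j t k - picard j x k + (picard j x k - b x k))) ^+ 2.
    by apply: eq_bigr => k _; rewrite !addrA !subrK.
  have h4 := sum_sqrD_le (fun k => b t k - picard j t k)
     (fun k => picard j t k - picard j x k + (picard j x k - b x k)) n.
  have h5 := sum_sqrD_le (fun k => picard j t k - picard j x k) (fun k => picard j x k - b x k) n.
  have E2 : \sum_(k < n) (picard j x k - b x k) ^+ 2 = \sum_(k < n) (b x k - picard j x k) ^+ 2.
    by apply: eq_bigr => k _; rewrite -sqrrN opprB.
  rewrite E; apply: le_trans h4 _; move: h5 h1 h2 h3 hj; rewrite E2.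
  do 4 ![move: (\sum_(k < n) _)]; move: (B / _) => u p q r s; lra.
split=> // x k x01.
have [cS eS] : (forall k, continuous (source b ^~ k)) /\ forall x, ell2 (b (clamp x)).
  by split; [exact: source_cont bB cb|move=> y; exists B => n; apply: bB; exact: clamp01].
have l0 : 0 <= l by apply: le_trans (ltW l1); exact: ler01.
apply/eqP; rewrite -subr_eq0 -sqrf_eq0; apply/eqP/le_anti; rewrite sqr_ge0 andbT.
(* The limit and its image both lie within a multiple of 4^-j, in squared distance, of iterate j +
   1: the image by [solb_dist], the limit by [picard_limit]. *)
apply: (@le0_div_exp4 (2 * (B / 4 * expR l) + 2 * B)).
  by rewrite addr_ge0// !mulr_ge0// ?expR_ge0// divr_ge0.
move=> j; have [cj ej] := picard_source j.
apply: le_trans (sqr_le_sum (fun k => solb (source b) b0 x k - b x k) k) _.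
have E : \sum_(i < k.+1) (solb (source b) b0 x i - b x i) ^+ 2 = \sum_(i < k.+1)
    (solb (source b) b0 x i - picard j.+1 x i + (picard j.+1 x i - b x i)) ^+ 2.
  by apply: eq_bigr => i _; rewrite addrA subrK.
rewrite E; apply: le_trans (sum_sqrD_le (fun i => solb (source b) b0 x i - picard j.+1 x i)
  (fun i => picard j.+1 x i - b x i) _) _.
rewrite [leRHS]mulrDl -!(mulrA 2); apply: lerD; rewrite ler_wpM2l//.
  have Bj : 0 <= B / 4 ^+ j by rewrite divr_ge0// exprn_ge0.
  have le1 : \sum_(i < k.+1) (solb (source b) b0 x i - solb (source (picard j)) b0 x i) ^+ 2
      <= B / 4 ^+ j / 4 * expR (l * x).
    apply: solb_dist => // s /andP[s0 s1]; have s01 : 0 <= s <= 1 by rewrite !ltW.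
    apply: (lipT (eS s) (ej s)) => n; rewrite clampE//; apply: le_trans (hb j n s s01) _.
    by rewrite ler_peMr// -expR0 ler_expR mulr_ge0// ltW.
  apply: le_trans le1 _; rewrite (mulrAC B) [leRHS]mulrAC ler_wpM2l ?divr_ge0//.
  by rewrite ler_expR -[leRHS]mulr1 ler_wpM2l//; case/andP: x01.
have -> : \sum_(i < k.+1) (picard j.+1 x i - b x i) ^+ 2 = \sum_(i < k.+1) (b x i - picard j.+1 x i) ^+ 2.
  by apply: eq_bigr => i _; rewrite -sqrrN opprB.
apply: le_trans (hb j.+1 k.+1 x x01) _; rewrite ler_wpM2l// lef_pV2 ?posrE ?exprn_gt0//.
by rewrite exprS ler_peMl ?exprn_ge0// ler1n.
Qed.

(** Feeding the bound M / 4^j exp(l x) into [wave_energy] returns the same bound with j + 1 in place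
    of j; iteration forces [b] to vanish. *)
Lemma wave_unique b d G (M : R) : wave b d G ->
  (forall k, b 0 k = 0) -> (forall k, d 0 k = 0) -> ell2_bnd b M ->
  (forall (s A : R), 0 < s < 1 -> (forall n, \sum_(k < n) b s k ^+ 2 <= A) ->
    forall n, \sum_(k < n) G s k ^+ 2 <= K * A) ->
  forall (x : R) k, 0 <= x <= 1 -> b x k = 0.
Proof.
move=> h z0 z1 bM hG.
have M0 : 0 <= M by have := bM 0 0%N; rewrite lexx ler01 big_ord0; exact.
have l0 : 0 <= l by apply: le_trans (ltW l1); exact: ler01.
have it j : forall (x : R) n, 0 <= x <= 1 -> \sum_(k < n) b x k ^+ 2 <= M / 4 ^+ j * expR (l * x).
  elim: j => [|j IH] x n x01.
    rewrite expr0 divr1; apply: le_trans (bM x n x01) _.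
    by rewrite ler_peMr// -expR0 ler_expR mulr_ge0//; case/andP: x01.
  have Mj : 0 <= K * (M / 4 ^+ j) by rewrite (mulr_ge0 (ltW K0))// divr_ge0// exprn_ge0.
  have := @wave_energy R b d G n (K * (M / 4 ^+ j)) l l1 Mj h z0 z1 _ x x01.
  have -> : K * (M / 4 ^+ j) / (l - 1) = M / 4 ^+ j.+1.
    rewrite /l addrK exprSr !invfM mulrA [K * _]mulrC -!mulrA; congr (M * _).
    by rewrite mulrCA; congr (_ * _); rewrite mulrCA divff ?lt0r_neq0// mulr1.
  move=> h1; apply: le_trans (h1 _); first by apply: ler_sum => k _; rewrite lerDl sqr_ge0.
  move=> s /andP[s0 s1]; have s01 : 0 <= s <= 1 by rewrite !ltW.
  rewrite -mulrA; apply: hG => [|m]; first by rewrite s0.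
  exact: IH.
move=> x k x01; apply/eqP; rewrite -sqrf_eq0; apply/eqP/le_anti; rewrite sqr_ge0 andbT.
apply: (@le0_div_exp4 (M * expR (l * x))); first by rewrite mulr_ge0// expR_ge0.
by move=> j; rewrite mulrAC; apply: le_trans (sqr_le_sum (b x) k) (it j x _ x01).
Qed.

End contraction.
End wave_existence.

(** * From weak derivatives to classical ones *)

Section calculus.
Context {R : realType}.
Local Notation mu := (mu01 R).
Implicit Types (f g h d : R -> R).

Lemma cvg_dnbhs_shift (a b : R) : (fun t : R => t - a + b) @ a^' --> b^'.
Proof.
move=> A /=; rewrite /dnbhs /within/= => hA.
have c : (fun t : R => t - a + b) @ a --> b.
  rewrite -[X in _ --> X]add0r -(subrr a).
  by apply: cvgD; [apply: cvgB; [exact: cvg_id|exact: cvg_cst]|exact: cvg_cst].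
have h : \forall t \near a, t - a + b != b -> A (t - a + b) := c [set s | s != b -> A s] hA.
change (\forall t \near a, t != a -> A (t - a + b)).
apply: filterS h => t /= h ta; apply: h; apply/eqP => tb.
by move/eqP: ta; apply; lra.
Qed.

Lemma is_derive_slope f (x l : R) :
  is_derive x 1 f l <-> (f t - f x) / (t - x) @[t --> x^'] --> l.
Proof.
split=> [df|h].
  have [dx <-] := df.
  have c := cvg_comp _ _ (@cvg_dnbhs_shift x 0) dx.
  apply: cvg_trans c; apply: near_eq_cvg; apply: nearW => t /=.
  by rewrite addr0 /GRing.scale/= mulr1 subrK mulrC.
have c := cvg_comp _ _ (@cvg_dnbhs_shift 0 x) h.
have c' : h^-1 *: ((f \o shift x) (h *: 1) - f x) @[h --> (0:R)^'] --> l.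
  apply: cvg_trans c; apply: near_eq_cvg; apply: nearW => t /=.
  by rewrite subr0 /GRing.scale/= mulr1 addrK mulrC.
have dx : derivable f x 1 by apply/cvg_ex; exists l.
by apply: (DeriveDef dx); rewrite /derive; exact: cvg_lim c'.
Qed.

Lemma sqr_cvg0 {T : Type} (F : set_system T) {FF : Filter F} (r : T -> R) :
  (forall e : R, 0 < e -> \forall t \near F, r t ^+ 2 <= e) -> r t @[t --> F] --> (0 : R).
Proof.
move=> h; apply/cvgr0Pnorm_lt => e e0.
have e1 : 0 < e ^+ 2 / 2 by rewrite divr_gt0 ?exprn_gt0.
apply: filterS (h _ e1) => t ht.
rewrite -(ger0_norm (ltW e0)) -ltr_sqr ?nnegrE// !real_normK ?num_real//.
by apply: le_lt_trans ht _; rewrite ltr_pdivrMr// ltr_pMr ?exprn_gt0// ltr1n.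
Qed.

Lemma cvg_dist_bound {T : Type} (F : set_system T) {FF : Filter F} (r q : T -> R) (c l : R) :
  (\forall t \near F, `|r t - l| <= c * q t) -> q t @[t --> F] --> (0 : R) ->
  r t @[t --> F] --> l.
Proof.
move=> h q0.
have cq : c * q t @[t --> F] --> (0 : R) by rewrite -(mulr0 c); apply: cvgMr.
apply/cvgrPdist_lt => e e0.
have hq : \forall t \near F, c * q t < e by exact: (cvgr_lt _ cq).
by apply: filterS2 h hq => t h1 h2; rewrite distrC; exact: le_lt_trans h1 h2.
Qed.

Lemma within01_clamp f : {within `[0, 1], continuous f} -> continuous (f \o clamp).
Proof.
move=> /subspace_continuousP cf x.
have h : f @ within `[0, 1] (nbhs (clamp x)) --> f (clamp x).
  by apply: cf; rewrite /= in_itv/= clamp01.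
move=> A /h; rewrite /= /nbhs/= => hA.
have h2 : \forall t \near x, `[0, 1]%classic (clamp t) -> A (f (clamp t)).
  exact: (continuous_clamp hA).
by apply: filterS h2 => t; apply; rewrite /= in_itv/= clamp01.
Qed.

Lemma near_in01 (x : R) : 0 < x < 1 -> \forall t \near x, 0 < t < 1.
Proof.
move=> /andP[x0 x1]; have h := lt_nbhsr x0; have h' := lt_nbhsl x1.
by apply: filterS2 h h' => t -> ->.
Qed.

(** The primitive of f^2 is nondecreasing with equal values at 0 and 1, so it is constant and its
    derivative f^2 vanishes. *)
Lemma continuous_zero_ae f : continuous f -> f = 0 %[ae mu] ->
  forall x : R, 0 < x < 1 -> f x = 0.
Proof.
move=> cf f0 x x01.
have cf2 : continuous (fun y => f y ^+ 2) by move=> y; apply: cvg_expn; exact: cf.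
have I0 : \int[mu]_y (f y ^+ 2) = 0.
  have -> : \int[mu]_y (f y ^+ 2) = \int[mu]_y (cst 0 y).
    apply: ae_eq_Rintegral => //.
    - exact: (continuous_measurable_fun cf2).
    - by apply: filterS f0 => y h _; rewrite h// expr0n.
  by rewrite Rintegral_mu01_cst.
have dF (y : R) := is_derive_primP (x := y) cf2.
have F1 : prim (fun y => f y ^+ 2) 1 = 0.
  have := @FTC2_mu01 R (prim (fun y => f y ^+ 2)) _ (continuous_within01 cf2) (derive_within01 dF).
  rewrite I0 prim0 subr0 => h; apply/esym/h => y /andP[y0 y1].
  by apply: dF; rewrite !ltW.
have F0 (y : R) : 0 < y < 1 -> prim (fun y => f y ^+ 2) y = 0.
  move=> /andP[y0 y1]; have s0 z : 0 <= f z ^+ 2 by exact: sqr_ge0.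
  have := prim_ndecr cf2 s0 (lexx 0) (ltW y0) (ltW y1).
  have := prim_ndecr cf2 s0 (ltW y0) (ltW y1) (lexx 1).
  by rewrite F1 prim0 => h1 h2; apply/le_anti; rewrite h1.
have h : \forall t \near x, prim (fun y => f y ^+ 2) t = cst 0 t.
  by apply: filterS (near_in01 x01) => t; exact: F0.
have x01' : 0 <= x <= 1 by case/andP: x01 => *; rewrite !ltW.
have := @derive_val _ _ _ _ _ _ _ (near_eq_is_derive h (dF x x01')).
by rewrite derive_cst => /esym/eqP; rewrite sqrf_eq0 => /eqP.
Qed.

Lemma eq_Rintegral_mu01 f g : (forall x : R, 0 < x < 1 -> f x = g x) ->
  \int[mu]_x f x = \int[mu]_x g x.
Proof.
move=> fg; rewrite !Rintegral_mu01; apply: eq_Rintegral => x.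
by rewrite inE/= in_itv/= => /fg.
Qed.

(* The difference of [d] and a primitive of [h] has zero weak derivative, hence
   is orthogonal to every [cs k], hence is constant. *)
Lemma du_bois_reymond d h : {within `[0, 1], continuous d} -> {within `[0, 1], continuous h} ->
  (forall phi, Ccinfty phi -> \int[mu]_x (derive1 phi x * d x) = - \int[mu]_x (phi x * h x)) ->
  forall x : R, 0 < x < 1 -> is_derive x 1 d (h x).
Proof.
move=> cd ch dh x x01.
have cd' := within01_clamp cd; have ch' := within01_clamp ch.
pose H := prim (h \o clamp).
have dH (y : R) (y01 : 0 <= y <= 1) : is_derive y 1 H ((h \o clamp) y) := is_derive_primP ch' y01.
have cH := derive_within01 dH; have cH' := within01_clamp cH.
pose f := (d \o clamp) - (H \o clamp).
have cf : continuous f by move=> y; apply: cvgB; [exact: cd'|exact: cH'].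
have Lf := continuous_L2 cf.
have clE (y : R) : 0 < y < 1 -> clamp y = y by case/andP => *; rewrite clampE// !ltW.
have f0 : weak_derivative f 0.
  move=> phi hphi; have c1 := Ccinfty_continuous hphi; have c2 := Ccinfty_derive1_continuous hphi.
  have W1 := continuous_within01 c1; have W2 := continuous_within01 c2.
  have E1 : \int[mu]_y (f y * derive1 phi y) =
      \int[mu]_y (derive1 phi y * d y + (-1) * (derive1 phi y * H y)).
    apply: eq_Rintegral_mu01 => y y01; rewrite /f !fctE/= !clE//.
    by move: (derive1 _ _) (d y) (H y) => p q r; ring.
  have W3 := within01M W2 cd; have W4 := within01M W2 cH.
  rewrite E1 within01_RintegralD//; last by apply: within01M => //; apply: continuous_within01; exact: cst_continuous.
  rewrite within01_RintegralZl// dh//.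
  have -> : \int[mu]_y (derive1 phi y * H y) = - \int[mu]_y (phi y * (h \o clamp) y).
    apply: Ccinfty_parts => //; first exact: continuous_within01.
    by move=> y /andP[y0 y1]; apply: dH; rewrite !ltW.
  rewrite mulN1r opprK.
  have -> : \int[mu]_y (phi y * (h \o clamp) y) = \int[mu]_y (phi y * h y).
    by apply: eq_Rintegral_mu01 => y y01; rewrite /= clE.
  have -> : (fun y => (0 : R -> R) y * phi y) = cst 0 by apply/funext => y; rewrite mul0r.
  by rewrite Rintegral_mu01_cst oppr0 addNr.
(* Up to the nonzero factor [om k], [cs k] is the derivative of the H10 function [sn k], to which
   [H10_weak_parts] applies. *)
have fcs k : L2inner f (cs k) = 0.
  have := H10_weak_parts Lf L2_0 f0 (sn_H10 k); rewrite L2inner0l oppr0.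
  have [Hs ds] := @sn_wderiv R k.
  rewrite L2innerC (L2inner_ae (L2_wderiv Hs) (L2Z _ (L2_cs k)) Lf ds) L2innerZl//.
    by rewrite L2innerC => /eqP; rewrite mulf_eq0 gt_eqF ?om_gt0//= => /eqP.
  exact: L2_cs.
pose c := L2inner f (cst 1).
have g0 : f - c *: cst 1 = 0 %[ae mu].
  apply: cs1_complete; first exact: (L2B Lf (L2Z _ (@L2_cst R 1))).
  move=> k; have h1 : L2inner (cst 1) (cs1 k) = (0%N == k)%:R :> R by exact: (@cs1_ortho R 0 k).
  rewrite L2innerBl// ?L2innerZl// ?h1; try exact: L2_cst; try exact: L2_cs1.
    case: k {h1} => [|k] /=; first by rewrite mulr1 subrr.
    by rewrite fcs mulr0 subrr.
  exact: (L2Z _ (@L2_cst R 1)).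
have cg : continuous (f - c *: cst 1).
  have -> : c *: cst 1 = cst c :> (R -> R) by apply/funext => y; exact: mulr1.
  by move=> y; apply: cvgB; [exact: cf|exact: cvg_cst].
have fc (y : R) : 0 < y < 1 -> c + H y = d y.
  move=> y01; have := continuous_zero_ae cg g0 y01.
  rewrite /f !fctE/= clE// /GRing.scale/= mulr1.
  by move: (d y) (H y) (c) => p q r; lra.
have nr : \forall y \near x, (cst c + H) y = d y.
  by apply: filterS (near_in01 x01) => y /fc <-.
apply: (near_eq_is_derive nr).
have x01' : 0 <= x <= 1 by case/andP: x01 => *; rewrite !ltW.
have := is_deriveD (is_derive_cst c x 1) (dH x x01').
by rewrite add0r /= clE.
Qed.

End calculus.

(** * The dual space *)

Section duality.
Context {R : realType}.
Local Notation mu := (mu01 R).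
Implicit Types (f g h : R -> R) (l : (R -> R) -> R).

Lemma H1normBC f g : H1 f -> H1 g -> H1norm (f - g) = H1norm (g - f).
Proof.
move=> Hf Hg; have [H _] := H1B Hf Hg; have := H1normZ_sqr (-1) H.
have -> : -1 *: (f - g) = g - f by rewrite scaleN1r opprB.
rewrite sqrrN expr1n mul1r => /(congr1 Num.sqrt).
by rewrite !sqrtr_sqr (ger0_norm (H1norm_ge0 (g - f))) (ger0_norm (H1norm_ge0 (f - g))).
Qed.

Lemma H1norm_dist f g : H1 f -> H1 g -> `|H1norm f - H1norm g| <= H1norm (f - g).
Proof.
move=> Hf Hg; have [H _] := H1B Hf Hg; have [H' _] := H1B Hg Hf.
have h1 := H1normD H Hg; have h2 := H1normD H' Hf.
rewrite subrK in h1; rewrite subrK H1normBC// in h2.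
move: h1 h2; move: (H1norm f) (H1norm g) (H1norm (f - g)) => a b c h1 h2.
by rewrite ler_norml; apply/andP; split; lra.
Qed.

Lemma H1norm0 : H1norm (0 : R -> R) = 0.
Proof.
have [H d] := @H1_0 R; rewrite /H1norm (L2norm_ae (L2_wderiv H) (@L2_0 R) d) L2norm0.
by rewrite expr0n addr0 sqrtr0.
Qed.

Lemma H10_B f g : H10 f -> H10 g -> H10 (f - g).
Proof. by move=> hf hg; rewrite addrC -scaleN1r; exact: H10_lin. Qed.

Lemma H10_Z (a : R) f : H10 f -> H10 (a *: f).
Proof. by move=> hf; rewrite -[_ *: _]addr0 -(subrr f); exact: (H10_lin a hf (H10_B hf hf)). Qed.

Lemma H10_0 : H10 (0 : R -> R).
Proof. by rewrite -(scale0r (sn 0)); apply: H10_Z; exact: sn_H10. Qed.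

Lemma Hm1_sub l l' : Hm1 l -> Hm1 l' -> Hm1 (l \- l').
Proof.
move=> [lin [C hC]] [lin' [C' hC']]; split=> [a f g hf hg|].
  by rewrite /= lin// lin'//; move: (l f) (l g) (l' f) (l' g) => p q r s; ring.
exists (C + C') => f hf; rewrite /= mulrDl.
by apply: le_trans (ler_normB _ _) _; apply: lerD; [exact: hC|exact: hC'].
Qed.

Lemma Hm1_comb n (c : 'I_n -> R) (l : 'I_n -> (R -> R) -> R) :
  (forall i, Hm1 (l i)) -> Hm1 (fun f => \sum_(i < n) c i * l i f).
Proof.
move=> hl; split=> [a f g hf hg|].
  rewrite mulr_sumr -big_split/=; apply: eq_bigr => i _.
  by rewrite (hl i).1//; move: (l i f) (l i g) => p q; ring.
have /boolp.choice[C hC] : forall i : 'I_n, exists C : R, forall f, H10 f -> `|l i f| <= C * H1norm f.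
  by move=> i; exact: (hl i).2.
exists (\sum_(i < n) `|c i| * C i) => f hf.
apply: le_trans (ler_norm_sum _ _ _) _; rewrite mulr_suml; apply: ler_sum => i _.
by rewrite normrM -mulrA ler_wpM2l// hC.
Qed.

Lemma Hm1_linearZ l (a : R) f : Hm1 l -> H10 f -> l (a *: f) = a * l f.
Proof.
move=> [lin _] hf.
have l0 : l 0 = 0.
  have := lin 1 0 0 H10_0 H10_0; rewrite (_ : (fun y => _) = 0); last first.
    by apply/funext => y; rewrite mulr0 addr0.
  by rewrite mul1r => /eqP; rewrite -subr_eq subrr => /eqP <-.
rewrite -[RHS]addr0 -l0 -(lin a f 0 hf H10_0); congr l.
by apply/funext => y; rewrite addr0.
Qed.

Lemma Hm1norm_le l (M : R) : (forall f, H10 f -> H1norm f <= 1 -> `|l f| <= M) ->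
  Hm1norm l <= M.
Proof.
move=> h; apply: ge_sup.
  exists `|l 0|; exists 0 => //; split; first exact: H10_0.
  by rewrite H1norm0.
by move=> _ [f [hf f1] <-]; exact: h.
Qed.

Lemma Hm1norm_ub l f : Hm1 l -> H10 f -> H1norm f <= 1 -> `|l f| <= Hm1norm l.
Proof.
move=> [_ [C hC]] hf f1; apply: ub_le_sup; last by exists f.
exists `|C| => _ [g [hg g1] <-]; apply: le_trans (hC g hg) _.
apply: (@le_trans _ _ (`|C| * H1norm g)); first by rewrite ler_wpM2r ?H1norm_ge0// ler_norm.
by rewrite -[leRHS]mulr1 ler_wpM2l.
Qed.

Lemma Hm1norm_ge0 l : Hm1 l -> 0 <= Hm1norm l.
Proof.
move=> hl; apply: le_trans (normr_ge0 (l 0)) _; by apply: Hm1norm_ub => //; [exact: H10_0|rewrite H1norm0].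
Qed.

Lemma Hm1_bound l f : Hm1 l -> H10 f -> `|l f| <= Hm1norm l * H1norm f.
Proof.
move=> hl hf; have [f0|f0] := eqVneq (H1norm f) 0.
  have [C hC] := hl.2; have := hC f hf; rewrite f0 !mulr0 => h.
  by apply: le_trans h _.
have fp : 0 < H1norm f by rewrite lt0r f0 H1norm_ge0.
rewrite -ler_pdivrMr//.
have -> : `|l f| / H1norm f = `|l ((H1norm f)^-1 *: f)|.
  by rewrite Hm1_linearZ// normrM gtr0_norm ?invr_gt0// mulrC.
apply: (Hm1norm_ub hl (H10_Z _ hf)).
rewrite -ler_sqr ?nnegrE ?H1norm_ge0 ?ler01// (H1normZ_sqr _ (H10_H1 hf)).
by rewrite exprVn mulVf ?expr1n// expf_neq0.
Qed.

Lemma Hm1norm_dist l l' (M : R) : Hm1 l -> Hm1 l' ->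
  (forall f, H10 f -> H1norm f <= 1 -> `|l f - l' f| <= M) ->
  `|Hm1norm l - Hm1norm l'| <= M.
Proof.
move=> hl hl' h.
have h1 : Hm1norm l <= Hm1norm l' + M.
  apply: Hm1norm_le => f hf f1; rewrite -(subrK (l' f) (l f)) addrC.
  by apply: le_trans (ler_normD _ _) _; apply: lerD; [exact: Hm1norm_ub|exact: h].
have h2 : Hm1norm l' <= Hm1norm l + M.
  apply: Hm1norm_le => f hf f1; rewrite -(subrK (l f) (l' f)) addrC.
  apply: le_trans (ler_normD _ _) _; apply: lerD; first exact: Hm1norm_ub.
  by rewrite distrC; exact: h.
move: h1 h2; move: (Hm1norm l) (Hm1norm l') => a b h1 h2.
by rewrite ler_norml; apply/andP; split; lra.
Qed.

(** Sine sums converge to [f] in the H1 norm, for which [l] is bounded. This reduces identities in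
    H^-1 to their coordinates. *)
Lemma Hm1_eq0 l f : Hm1 l -> (forall k, l (sn k) = 0) -> H10 f -> l f = 0.
Proof.
move=> hl lsn hf; pose a k := L2inner f (sn k).
have [lin [C hC]] := hl; have Hf := H10_H1 hf; have Lf := H1_L2 Hf.
have pH n : H10 (psum sn a n) by have [] := psum_H10 a n.
have lp n : l (psum sn a n) = 0.
  elim: n => [|n IH].
    by have := Hm1_linearZ 0 hl H10_0; rewrite mul0r scale0r /psum big_ord0.
  have -> : psum sn a n.+1 = (fun y => a n * sn n y + psum sn a n y).
    by rewrite /psum big_ord_recr/= addrC.
  by rewrite (lin (a n) (sn n) _ (sn_H10 n) (pH n)) IH lsn mulr0 addr0.
have [w0 wk] := H10_coef hf.
apply: (@eq0_norm_le_small _ _ `|C|) => e e0.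
have [n hn] := H1_coef_approx Hf w0 wk e0.
have -> : l f = l (f - psum sn a n).
  have := lin (-1) (psum sn a n) f (pH n) hf; rewrite lp mulr0 add0r => <-.
  by congr l; apply/funext => y; rewrite !fctE mulN1r addrC.
apply: le_trans (hC _ (H10_B hf (pH n))) _.
by apply: le_trans (ler_wpM2r (H1norm_ge0 _) (ler_norm C)) _; rewrite ler_wpM2l.
Qed.

End duality.

(** * Existence and uniqueness *)

Lemma derive_lipschitz {R : realType} (f f' : R -> R) (A : R) :
  (forall x : R, 0 <= x <= 1 -> is_derive x 1 f (f' x)) ->
  (forall x : R, 0 <= x <= 1 -> `|f' x| <= A) ->
  forall x y : R, 0 <= x <= 1 -> 0 <= y <= 1 -> `|f y - f x| <= A * `|y - x|.
Proof.
move=> df fA.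
suff W (x y : R) : 0 <= x -> x <= y -> y <= 1 -> `|f y - f x| <= A * `|y - x|.
  move=> x y /andP[x0 x1] /andP[y0 y1]; have [xy|/ltW yx] := leP x y; first exact: W.
  by rewrite distrC [`|y - x|]distrC; exact: W.
move=> x0 xy y1; rewrite (@ger0_norm _ (y - x)) ?subr_ge0// ler_norml.
have h1 := derive_le_slope df (fun x h => le_trans (ler_norm _) (fA x h)) x0 xy y1.
have dN (z : R) : 0 <= z <= 1 -> is_derive z 1 (- f) (- f' z).
  by move=> z01; apply: is_deriveN; exact: df.
have fN (z : R) : 0 <= z <= 1 -> - f' z <= A.
  by move=> z01; apply: le_trans (fA z z01); rewrite -normrN ler_norm.
have := derive_le_slope dN fN x0 xy y1.
rewrite h1 andbT !fctE; move: (f x) (f y) (A * _) => p q s; lra.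
Qed.

Lemma Rintegral_mu01_bound {R : realType} (f : R -> R) (M : R) : measurable_fun setT f ->
  (forall x : R, 0 < x < 1 -> `|f x| <= M) -> `|\int[mu01 R]_x f x| <= M.
Proof.
move=> mf fM.
have hf := bounded_integrable_mu01 mf fM.
have hc (c : R) : (mu01 R).-integrable setT (EFin \o cst c).
  by apply: (@bounded_integrable_mu01 R _ `|c|).
rewrite ler_norml; apply/andP; split.
  rewrite -[leLHS]Rintegral_mu01_cst; apply: le_Rintegral_mu01 => // x /fM.
  by rewrite ler_norml => /andP[].
rewrite -[leRHS]Rintegral_mu01_cst; apply: le_Rintegral_mu01 => // x /fM.
by rewrite ler_norml => /andP[].
Qed.

(** * The operator P in coordinates and synthesis of a weak solution *)

Section wave_operator.
Context {R : realType}.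
Local Notation mu := (mu01 R).
Implicit Types (f g h : R -> R) (a : nat -> R).

(** An inverse of the map from H10 to the coefficients b_k, which fix the function up to equality
    almost everywhere. Outside [ell2] no candidate exists, by Bessel, and the default 0 is
    returned. *)
Definition synth a : R -> R :=
  xget 0 [set f | H10 f /\ forall k, om k * L2inner f (sn k) = a k].

Lemma synthP a : ell2 a -> H10 (synth a) /\ forall k, om k * L2inner (synth a) (sn k) = a k.
Proof.
move=> [M hM]; have [f hf] := H10_synth hM.
exact: (xgetPex 0 (ex_intro _ f hf : exists f, [set f | H10 f /\ forall k, om k * L2inner f (sn k) = a k] f)).
Qed.

Definition sine_synth a : R -> R :=
  xget 0 [set f | L2 f /\ forall k, L2inner f (sn k) = a k].

Lemma sine_synthP a : ell2 a -> L2 (sine_synth a) /\ forall k, L2inner (sine_synth a) (sn k) = a k.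
Proof.
move=> [M hM].
have [f [Lf cf _]] := @riesz_fischer R (sn : nat -> R -> R) (@L2_sn R) (@sn_ortho R) a M hM.
exact: (xgetPex 0 (ex_intro _ f (conj Lf cf) : exists f, [set f | L2 f /\ forall k, L2inner f (sn k) = a k] f)).
Qed.

Lemma sn_parseval_le f (M : R) : L2 f ->
  (forall n, \sum_(k < n) L2inner f (sn k) ^+ 2 <= M) -> L2norm f ^+ 2 <= M.
Proof.
apply: (@parseval_le R (sn : nat -> R -> R) (@L2_sn R) (@sn_ortho R)).
exact: sn_complete.
Qed.

Section stable.
Variables (P : (R -> R) -> (R -> R)) (C : R).
Hypothesis linP : linear_H1_L2 P.
Hypothesis C0 : 0 <= C.
Hypothesis boundP : forall f, H1 f -> L2norm (P f) <= C * H1norm f.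

Lemma L2_P f : H1 f -> L2 (P f). Proof. exact: linP.1. Qed.

Lemma P_dist f g : H1 f -> H1 g -> L2norm (P f - P g) <= C * H1norm (f - g).
Proof.
move=> hf hg; have [H _] := H1B hf hg.
have := linP.2 (-1) g f hg hf.
rewrite (_ : (fun y => -1 * g y + f y) = f - g); last first.
  by apply/funext => y; rewrite !fctE mulN1r addrC.
move=> e0; have e : P (f - g) = P f - P g %[ae mu].
  by apply: filterS e0 => y h _; rewrite (h I) !fctE mulN1r addrC.
rewrite -(L2norm_ae (L2_P H) (L2B (L2_P hf) (L2_P hg)) e).
exact: boundP.
Qed.

(** By [H10_norm_le] the squared H1 distance is at most 2 M, the bound on P turns this into 2 C^2 M,
    and Bessel passes to coefficients. The extra 1 keeps the constant positive even for C = 0. *)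
Lemma P_coef_dist f g (M : R) : H10 f -> H10 g ->
  (forall n, \sum_(k < n) (om k * L2inner f (sn k) - om k * L2inner g (sn k)) ^+ 2 <= M) ->
  forall n, \sum_(k < n) (L2inner (P f) (sn k) - L2inner (P g) (sn k)) ^+ 2 <= (2 * C ^+ 2 + 1) * M.
Proof.
move=> hf hg hM n; have [Hf Hg] := (H10_H1 hf, H10_H1 hg).
have [Lf Lg] := (H1_L2 Hf, H1_L2 Hg); have [LPf LPg] := (L2_P Hf, L2_P Hg).
have M0 : 0 <= M by have := hM 0%N; rewrite big_ord0.
have [] := H10_norm_le (M := M) (H10_B hf hg).
  move=> m; apply: le_trans (hM m); apply: ler_sum => k _.
  by rewrite L2innerBl ?mulrBr//; exact: L2_sn.
move=> _ h2.
have h1 : \sum_(k < n) L2inner (P f - P g) (sn k) ^+ 2 <= L2norm (P f - P g) ^+ 2.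
  exact: (@bessel R (sn : nat -> R -> R) (@L2_sn R) (@sn_ortho R) _ n (L2B LPf LPg)).
apply: (@le_trans _ _ (L2norm (P f - P g) ^+ 2)).
  apply: le_trans h1; apply: ler_sum => k _.
  by rewrite L2innerBl//; exact: L2_sn.
apply: (@le_trans _ _ ((C * H1norm (f - g)) ^+ 2)).
  by rewrite ler_sqr ?nnegrE ?mulr_ge0 ?L2norm_ge0 ?H1norm_ge0// P_dist.
rewrite exprMn; apply: le_trans (ler_wpM2l (sqr_ge0 C) h2) _.
by move: (C ^+ 2) (sqr_ge0 C) => c c0; nra.
Qed.

Definition Psn a (k : nat) : R := L2inner (P (synth a)) (sn k).

Lemma Psn_lipschitz a a' (M : R) : ell2 a -> ell2 a' ->
  (forall n, \sum_(k < n) (a k - a' k) ^+ 2 <= M) ->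
  forall n, \sum_(k < n) (Psn a k - Psn a' k) ^+ 2 <= (2 * C ^+ 2 + 1) * M.
Proof.
move=> ha ha' hM; have [hf cf] := synthP ha; have [hg cg] := synthP ha'.
by apply: P_coef_dist => // n; under eq_bigr do rewrite cf cg.
Qed.

(** The chosen representative for the zero sequence has H1 norm zero without being the zero function
    on the nose; the bound on P transfers the vanishing. *)
Lemma Psn0 k : Psn (fun=> 0) k = 0.
Proof.
have hz : ell2 (fun=> 0 : R) by exists 0 => n; rewrite big1// => i _; rewrite expr0n.
have [hf cf] := synthP hz.
have [] := H10_norm_le (M := 0) hf.
  by move=> n; rewrite big1// => i _; rewrite cf expr0n.
rewrite mulr0 => _ h; have H0 : H1norm (synth (fun=> 0)) = 0.
  by apply/eqP; rewrite -sqrf_eq0; apply/eqP/le_anti; rewrite h sqr_ge0.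
have LP := L2_P (H10_H1 hf); have := boundP (H10_H1 hf); rewrite H0 mulr0 => h1.
have := L2_cauchy_schwarz LP (@L2_sn R k); rewrite (le_anti (_ : L2norm (P _) <= 0 <= _)).
  by rewrite mul0r normr_le0 => /eqP.
by rewrite h1 L2norm_ge0.
Qed.

(** The functional u_yy - P u of H^-1, which is the value that the equation prescribes for u_xx. *)
Definition wave_form (u psi : R -> R) : R :=
  - L2inner (wderiv u) (wderiv psi) - L2inner (P u) psi.

Lemma wave_form_bound (g h psi : R -> R) (N : R) : L2 g -> L2 h -> H10 psi ->
  L2norm g <= N -> L2norm h <= C * N ->
  `|- L2inner g (wderiv psi) - L2inner h psi| <= (1 + C) * N * H1norm psi.
Proof.
move=> Lg Lh hpsi gN hN; have Hpsi := H10_H1 hpsi.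
rewrite -opprD normrN !mulrDl mul1r; apply: le_trans (ler_normD _ _) _; apply: lerD.
  apply: le_trans (L2_cauchy_schwarz Lg (L2_wderiv Hpsi)) _.
  by rewrite ler_pM ?L2norm_ge0// L2norm_wderiv_le_H1norm.
apply: le_trans (L2_cauchy_schwarz Lh (H1_L2 Hpsi)) _.
by rewrite ler_pM ?L2norm_ge0// L2norm_le_H1norm.
Qed.

Lemma wave_form_le u psi : H10 u -> H10 psi ->
  `|wave_form u psi| <= (1 + C) * H1norm u * H1norm psi.
Proof.
move=> hu hpsi; have Hu := H10_H1 hu.
apply: wave_form_bound => //; [exact: L2_wderiv|exact: L2_P|exact: L2norm_wderiv_le_H1norm|exact: boundP].
Qed.

Lemma wave_form_dist u u' psi : H10 u -> H10 u' -> H10 psi ->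
  `|wave_form u psi - wave_form u' psi| <= (1 + C) * H1norm (u - u') * H1norm psi.
Proof.
move=> hu hu' hpsi; have [Hu Hu'] := (H10_H1 hu, H10_H1 hu'); have Hpsi := H10_H1 hpsi.
have [HB dB] := H1B Hu Hu'.
have [Lu Lu'] := (L2_wderiv Hu, L2_wderiv Hu'); have [LP LP'] := (L2_P Hu, L2_P Hu').
have -> : wave_form u psi - wave_form u' psi =
    - L2inner (wderiv (u - u')) (wderiv psi) - L2inner (P u - P u') psi.
  rewrite (L2inner_ae (L2_wderiv HB) (L2B Lu Lu') (L2_wderiv Hpsi) dB).
  rewrite !L2innerBl//; try exact: L2_wderiv; try exact: H1_L2.
  by rewrite /wave_form; move: (L2inner (wderiv u) _) (L2inner (wderiv u') _)
    (L2inner (P u) _) (L2inner (P u') _) => p q r t; ring.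
apply: wave_form_bound => //; [exact: L2_wderiv|exact: L2B|exact: L2norm_wderiv_le_H1norm|].
exact: P_dist.
Qed.

Lemma wave_form_Hm1 u : H10 u -> Hm1 (wave_form u).
Proof.
move=> hu; have Hu := H10_H1 hu; split=> [a f g hf hg|].
  have [Hf Hg] := (H10_H1 hf, H10_H1 hg); have [HL dL] := H1_lin a Hf Hg.
  change (wave_form u (a *: f + g) = a * wave_form u f + wave_form u g).
  have [Lf Lg] := (L2_wderiv Hf, L2_wderiv Hg); have Lu := L2_wderiv Hu; have LP := L2_P Hu.
  rewrite /wave_form L2innerC (L2inner_ae (L2_wderiv HL) (L2_lin a Lf Lg) Lu dL).
  rewrite (L2inner_linl a Lf Lg Lu) [L2inner (P u) _]L2innerC.
  rewrite (L2inner_linl a (H1_L2 Hf) (H1_L2 Hg) LP) !(L2innerC _ (P u)) !(L2innerC _ (wderiv u)).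
  move: (L2inner _ _) (L2inner _ _) (L2inner _ _) (L2inner _ _) => p q r t; ring.
exists ((1 + C) * H1norm u) => f hf; exact: wave_form_le.
Qed.

Lemma wave_form_sn u k : H10 u ->
  wave_form u (sn k) = - (om k * (om k * L2inner u (sn k))) - L2inner (P u) (sn k).
Proof.
move=> hu; have [Hs ds] := @sn_wderiv R k; have Lu := L2_wderiv (H10_H1 hu).
rewrite /wave_form L2innerC (L2inner_ae (L2_wderiv Hs) (L2Z _ (@L2_cs R k)) Lu ds).
have [_ hcs] := H10_coef hu.
by rewrite (L2innerZl (om k) (@L2_cs R k) Lu) (L2innerC (cs k)) hcs.
Qed.

Lemma wave_form_Hm1norm_dist u u' : H10 u -> H10 u' ->
  Hm1norm (wave_form u \- wave_form u') <= (1 + C) * H1norm (u - u').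
Proof.
move=> hu hu'; apply: Hm1norm_le => f hf f1.
apply: le_trans (wave_form_dist hu hu' hf) _.
by rewrite ler_piMr// mulr_ge0 ?H1norm_ge0// addr_ge0.
Qed.

Lemma wave_form_Hm1norm u : H10 u -> Hm1norm (wave_form u) <= (1 + C) * H1norm u.
Proof.
move=> hu; apply: Hm1norm_le => f hf f1; apply: le_trans (wave_form_le hu hf) _.
by rewrite ler_piMr// mulr_ge0 ?H1norm_ge0// addr_ge0.
Qed.

Section weak_form.
Variables (b d : R -> nat -> R) (m : nat -> R) (M : R).
Let G := source Psn b.
Hypothesis db : forall (x : R) k, 0 <= x <= 1 -> is_derive x 1 (b^~ k) (om k * d x k).
Hypothesis dd : forall (x : R) k, 0 <= x <= 1 ->
  is_derive x 1 (d^~ k) (- (om k * b x k) - G x k).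
Hypothesis cG : forall k, continuous (G^~ k).
Hypothesis bdm : forall (x : R) k, 0 <= x <= 1 -> b x k ^+ 2 + d x k ^+ 2 <= m k.
Hypothesis m0 : forall k, 0 <= m k.
Hypothesis mM : forall n, \sum_(k < n) m k <= M.

Let bm (x : R) k : 0 <= x <= 1 -> b x k ^+ 2 <= m k.
Proof. by move=> x01; apply: le_trans (bdm k x01); rewrite lerDl sqr_ge0. Qed.

Let dm (x : R) k : 0 <= x <= 1 -> d x k ^+ 2 <= m k.
Proof. by move=> x01; apply: le_trans (bdm k x01); rewrite lerDr sqr_ge0. Qed.

Let wb k : {within `[0, 1], continuous (b^~ k)}.
Proof. by apply: (derive_within01 (f' := fun x => om k * d x k)) => x /db. Qed.

Let wd k : {within `[0, 1], continuous (d^~ k)}.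
Proof. by apply: (derive_within01 (f' := fun x => - (om k * b x k) - G x k)) => x /dd. Qed.

Let ellb x : ell2 (b (clamp x)).
Proof.
exists M => n; apply: le_trans (mM n); apply: ler_sum => k _.
by apply: bm; exact: clamp01.
Qed.

Let elld x : ell2 (d (clamp x)).
Proof.
exists M => n; apply: le_trans (mM n); apply: ler_sum => k _.
by apply: dm; exact: clamp01.
Qed.

Definition sol_u x := synth (b (clamp x)).
Definition sol_v x := sine_synth (d (clamp x)).
(** With u_xx defined through the equation, the equation holds for every [x]; the content moves to
    [sol_Hm1_weak_derivative], where it is shown to be the derivative of [sol_v]. *)
Definition sol_w x : (R -> R) -> R := wave_form (sol_u x).

Lemma sol_u_H10 x : H10 (sol_u x). Proof. by have [] := synthP (ellb x). Qed.

Lemma sol_u_coef x k : om k * L2inner (sol_u x) (sn k) = b (clamp x) k.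
Proof. by have [_] := synthP (ellb x). Qed.

Lemma L2_sol_v x : L2 (sol_v x). Proof. by have [] := sine_synthP (elld x). Qed.

Lemma sol_v_coef x k : L2inner (sol_v x) (sn k) = d (clamp x) k.
Proof. by have [_] := sine_synthP (elld x). Qed.

Lemma sol_u_continuous x : H1norm (sol_u t - sol_u x) @[t --> x] --> (0 : R).
Proof.
apply: sqr_cvg0 => e e0; have e2 : 0 < e / 2 by rewrite divr_gt0.
apply: filterS (ell2_cont_clamp (dominated_ell2_cont wb bm mM m0) x e2) => t ht.
have [] := H10_norm_le (M := e / 2) (H10_B (sol_u_H10 t) (sol_u_H10 x)).
  move=> n; apply: le_trans (ht n); apply: ler_sum => k _.
  rewrite L2innerBl ?mulrBr ?sol_u_coef//; try exact: L2_sn; exact: H1_L2 (H10_H1 (sol_u_H10 _)).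
by move=> _ /le_trans; apply; rewrite mulrCA divff// mulr1.
Qed.

Lemma sol_v_continuous x : L2norm (sol_v t - sol_v x) @[t --> x] --> (0 : R).
Proof.
apply: sqr_cvg0 => e e0.
apply: filterS (ell2_cont_clamp (dominated_ell2_cont wd dm mM m0) x e0) => t ht.
apply: sn_parseval_le => [|n]; first exact: L2B (L2_sol_v t) (L2_sol_v x).
apply: le_trans (ht n); apply: ler_sum => k _.
rewrite L2innerBl ?sol_v_coef//; try exact: L2_sn; exact: L2_sol_v.
Qed.

Lemma sol_u_continuous_into : continuous_into (@H10 R) (@H1norm R) sol_u.
Proof.
move=> x x01; split; first exact: sol_u_H10.
by apply: cvg_within_filter; exact: sol_u_continuous.
Qed.

Lemma sol_v_continuous_into : continuous_into (@L2 R) (@L2norm R) sol_v.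
Proof.
move=> x x01; split; first exact: L2_sol_v.
by apply: cvg_within_filter; exact: sol_v_continuous.
Qed.

(** Coordinatewise derivatives become an L2 derivative by [ell2_dominated]. The majorant 4 m_k
    combines d_k^2 <= m_k with the Lipschitz bound om k sqrt(m_k) for b_k, both coming from the
    energy bound. *)
Lemma sol_derivative : L2_derivative sol_u sol_v.
Proof.
move=> x; rewrite in_itv/= => x01; apply: sqr_cvg0 => e e0.
have Lu y : L2 (sol_u y) := H1_L2 (H10_H1 (sol_u_H10 y)).
(* Sine coefficients of the remainder of the difference quotient; division by [om k] leads from b_k
   back to the coefficients of u. *)
pose r t k := (b t k - b x k) / om k / (t - x) - d x k.
have h : \forall t \near within `[0, 1] x^', forall n, \sum_(k < n) r t k ^+ 2 <= e.
  apply: (@ell2_dominated R _ _ r (fun k => 4 * m k) (4 * M)) => //.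
  - move=> k; rewrite -(subrr (d x k)); apply: cvgB; last exact: cvg_cst.
    apply: cvg_within_filter.
    have /is_derive_slope hb := db k x01.
    have h : (om k)^-1 * ((b t k - b x k) / (t - x)) @[t --> x^'] --> (om k)^-1 * (om k * d x k).
      exact: cvgMr.
    rewrite mulKf ?gt_eqF ?om_gt0// in h; apply: cvg_trans h.
    by apply: near_eq_cvg; apply: nearW => t /=; rewrite mulrA; congr (_ / _); exact: mulrC.
  - apply: filterS (@near_withinT _ x^' `[0, 1]%classic _) => t; rewrite /= in_itv/= => t01 k.
    (* At t = x the quotient is 0 by convention, and the remainder is - d x k. *)
    have [->|tx] := eqVneq t x.
      rewrite /r !subrr !mul0r sub0r sqrrN; apply: le_trans (dm k x01) _.
      by rewrite ler_peMl// ler1n.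
    have q2 : ((b t k - b x k) / om k / (t - x)) ^+ 2 <= m k.
      have l1 := derive_lipschitz (f := b^~ k) (fun y => db k (x := y)) (A := om k * Num.sqrt (m k)).
      have {}l1 : `|b t k - b x k| <= om k * Num.sqrt (m k) * `|t - x|.
        apply: l1 => // y y01; rewrite normrM (gtr0_norm (om_gt0 k)) ler_wpM2l ?(ltW (om_gt0 k))//.
        by rewrite -(sqrtr_sqr (d y k)) ler_wsqrtr// dm.
      rewrite -(sqr_sqrtr (m0 k)) -[leLHS]real_normK ?num_real// ler_sqr ?nnegrE ?sqrtr_ge0//.
      rewrite !normrM !normfV (gtr0_norm (om_gt0 k)) ler_pdivrMr ?normr_gt0 ?subr_eq0//.
      by rewrite ler_pdivrMr ?om_gt0// [leRHS]mulrC mulrA.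
    have := dm k x01; rewrite /r.
    have := sqr_ge0 ((b t k - b x k) / om k / (t - x) + d x k); rewrite sqrrB sqrrD.
    by move: q2; move: (_ / (t - x)) (d x k) (m k) => p q s; lra.
  - by move=> n; rewrite -mulr_sumr ler_wpM2l.
  - by move=> k; rewrite mulr_ge0.
apply: filterS2 h (@near_withinT _ x^' `[0, 1]%classic _) => t ht; rewrite /= in_itv/= => t01.
have E : (fun y => (sol_u t y - sol_u x y) / (t - x) - sol_v x y) =
    (t - x)^-1 *: (sol_u t - sol_u x) - sol_v x.
  by apply/funext => y; rewrite !fctE mulrC.
have LB := L2B (Lu t) (Lu x).
rewrite E; apply: sn_parseval_le => [|n]; first exact: L2B (L2Z _ LB) (L2_sol_v x).
apply: le_trans (ht n); apply: ler_sum => k _.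
rewrite L2innerBl ?L2innerZl ?L2innerBl//; try exact: L2_sn; try exact: L2_sol_v; try exact: L2Z.
rewrite sol_v_coef (clampE x01) /r.
have := sol_u_coef t k; have := sol_u_coef x k; rewrite !clampE// => <- <-.
by rewrite -mulrBr [om k * _]mulrC mulfK ?gt_eqF ?om_gt0// mulrC.
Qed.

Lemma sol_w_Hm1norm_continuous : continuous (fun x => Hm1norm (sol_w x)).
Proof.
move=> x; apply: (cvg_dist_bound (c := 1 + C) _ (sol_u_continuous x)).
apply: nearW => t; apply: (Hm1norm_dist (wave_form_Hm1 (sol_u_H10 t)) (wave_form_Hm1 (sol_u_H10 x))).
move=> f hf f1; apply: le_trans (wave_form_dist (sol_u_H10 t) (sol_u_H10 x) hf) _.
by rewrite ler_piMr// mulr_ge0 ?H1norm_ge0// addr_ge0.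
Qed.

Lemma sol_u_bound x : H1norm (sol_u x) <= Num.sqrt (2 * M).
Proof.
have [] := H10_norm_le (M := M) (sol_u_H10 x).
  move=> n; apply: le_trans (mM n); apply: ler_sum => k _.
  by rewrite sol_u_coef; apply: bm; exact: clamp01.
move=> _ h; rewrite -(ger0_norm (H1norm_ge0 _)) -sqrtr_sqr.
exact: ler_wsqrtr.
Qed.

Lemma sol_v_bound x : L2norm (sol_v x) <= Num.sqrt M.
Proof.
have h : L2norm (sol_v x) ^+ 2 <= M.
  apply: sn_parseval_le => [|n]; first exact: L2_sol_v.
  apply: le_trans (mM n); apply: ler_sum => k _.
  by rewrite sol_v_coef; apply: dm; exact: clamp01.
by rewrite -(ger0_norm (L2norm_ge0 _)) -sqrtr_sqr; exact: ler_wsqrtr.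
Qed.

(** The simple functions freeze [sol_w] at the left ends of the half-open cells of a grid of mesh 1
    / (n + 1). The grid point below [x] tends to [x], and [sol_w] depends continuously on [x] in
    H^-1. *)
Lemma sol_w_strongly_measurable : Hm1_strongly_measurable sol_w.
Proof.
pose A n (i : 'I_n.+1) : set (measurableTypeR R) := `[i%:R / n.+1%:R, i.+1%:R / n.+1%:R[%classic.
pose s n x f := \sum_(i < n.+1) \1_(A n i) x * sol_w (i%:R / n.+1%:R) f.
exists s.
  move=> n; exists n.+1, (A n), (fun i => sol_w (i%:R / n.+1%:R)); split=> // i.
  by split; [exact: measurable_itv|exact: wave_form_Hm1 (sol_u_H10 _)].
move=> x; rewrite in_itv/= => /andP[x0 x1].
pose y n : R := (Num.truncn (x * n.+1%:R))%:R / n.+1%:R.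
have tr n : (Num.truncn (x * n.+1%:R))%:R <= x * n.+1%:R < (Num.truncn (x * n.+1%:R)).+1%:R.
  by apply: truncn_itv; rewrite mulr_ge0// ltW.
have sE n : s n x = sol_w (y n).
  have /andP[t0 t1] := tr n; set j := Num.truncn _ in t0 t1.
  have jn : (j < n.+1)%N.
    by rewrite -(ltr_nat R); apply: le_lt_trans t0 _; rewrite gtr_pMl.
  apply/funext => f; rewrite /s (bigD1 (Ordinal jn))//= big1 => [|i ij].
    rewrite indicE mem_set ?mul1r ?addr0//.
    by rewrite /A /= in_itv/= ler_pdivrMr// t0 ltr_pdivlMr.
  rewrite indicE memNset ?mul0r// /A /= in_itv/= ler_pdivrMr// ltr_pdivlMr// => /andP[i0 i1].
  move/eqP: ij; apply; apply/val_inj => /=; apply/eqP; rewrite eqn_leq.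
  have := le_lt_trans i0 t1; have := le_lt_trans t0 i1; rewrite !ltr_nat !ltnS => -> ->.
  by [].
have yx : y n @[n --> \oo] --> x.
  apply: (cvg_dist_bound (c := 1) (q := harmonic)); last exact: cvg_harmonic.
  apply: nearW => n; have /andP[t0 t1] := tr n.
  have N0 : n.+1%:R != 0 :> R by rewrite pnatr_eq0.
  rewrite mul1r /harmonic /y -[X in `|_ - X|](mulfK N0 x) -mulrBl normrM normfV [X in _ / X]ger0_norm//.
  rewrite ler_piMl ?invr_ge0//; move: t0 t1; rewrite -[(Num.truncn _).+1%:R]natr1.
  move: (x * _) (Num.truncn _)%:R => q p h1 h2.
  by rewrite ler_norml; apply/andP; split; lra.
have uy := cvg_comp _ _ yx (sol_u_continuous x).
apply: (cvg_dist_bound (c := 1 + C) _ uy); apply: nearW => n.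
rewrite subr0 sE ger0_norm; first exact: (wave_form_Hm1norm_dist (sol_u_H10 _) (sol_u_H10 _)).
by apply: Hm1norm_ge0; apply: Hm1_sub; exact: wave_form_Hm1 (sol_u_H10 _).
Qed.

Lemma sol_w_L2_Hm1 : L2_Hm1 sol_w.
Proof.
split; [by move=> x _; exact: wave_form_Hm1 (sol_u_H10 x)|exact: sol_w_strongly_measurable|].
have c2 : continuous (fun x => Hm1norm (sol_w x) ^+ 2).
  by move=> x; apply: cvg_expn; exact: sol_w_Hm1norm_continuous.
have i2 : mu.-integrable setT (EFin \o (fun x => Hm1norm (sol_w x) ^+ 2)).
  apply: (bounded_integrable_mu01 (M := ((1 + C) * Num.sqrt (2 * M)) ^+ 2)).
    exact: (continuous_measurable_fun c2).
  move=> x _; have h0 := Hm1norm_ge0 (wave_form_Hm1 (sol_u_H10 x)).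
  rewrite ger0_norm ?sqr_ge0// ler_sqr ?nnegrE ?mulr_ge0 ?addr_ge0 ?sqrtr_ge0//.
  apply: le_trans (wave_form_Hm1norm (sol_u_H10 x)) _.
  by rewrite ler_wpM2l ?addr_ge0// sol_u_bound.
exact: (integrable_lty _ i2).
Qed.

Lemma sol_v_inner_continuous psi : L2 psi -> continuous (fun x => L2inner (sol_v x) psi).
Proof.
move=> Lp x; apply: (cvg_dist_bound (c := L2norm psi) _ (sol_v_continuous x)).
apply: nearW => t; have [Lt Lx] := (L2_sol_v t, L2_sol_v x).
by rewrite -L2innerBl// mulrC; exact: (L2_cauchy_schwarz (L2B Lt Lx) Lp).
Qed.

Lemma sol_w_continuous psi : H10 psi -> continuous (fun x => sol_w x psi).
Proof.
move=> hp x; apply: (cvg_dist_bound (c := (1 + C) * H1norm psi) _ (sol_u_continuous x)).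
apply: nearW => t; rewrite mulrAC.
exact: (wave_form_dist (sol_u_H10 t) (sol_u_H10 x) hp).
Qed.

(** For fixed [phi] the defect of the identity is a bounded functional of [psi], so by [Hm1_eq0] it
    suffices to test with [sn k]. There it is an integration by parts in [x] for the coordinate
    equation. *)
Lemma sol_Hm1_weak_derivative : Hm1_weak_derivative sol_v sol_w.
Proof.
move=> phi hphi psi hpsi.
have cphi := Ccinfty_continuous hphi; have cphi' := Ccinfty_derive1_continuous hphi.
have [K1 K10 hK1] := bounded_on01 (continuous_within01 cphi').
have [K2 K20 hK2] := bounded_on01 (continuous_within01 cphi).
have c1 f : H10 f -> continuous (fun x => derive1 phi x * L2inner (sol_v x) f).
  move=> hf x; apply: cvgM; first exact: cphi'.
  exact: (sol_v_inner_continuous (H1_L2 (H10_H1 hf))).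
have c2 f : H10 f -> continuous (fun x => phi x * sol_w x f).
  by move=> hf x; apply: cvgM; [exact: cphi|exact: sol_w_continuous].
pose l f := \int[mu]_x (derive1 phi x * L2inner (sol_v x) f + phi x * sol_w x f).
have lE f : H10 f -> l f = \int[mu]_x (derive1 phi x * L2inner (sol_v x) f) +
    \int[mu]_x (phi x * sol_w x f).
  by move=> hf; rewrite /l within01_RintegralD//; apply: continuous_within01; [exact: c1|exact: c2].
have cl f : H10 f -> continuous (fun x => derive1 phi x * L2inner (sol_v x) f + phi x * sol_w x f).
  by move=> hf x; apply: cvgD; [exact: c1|exact: c2].
have hl : Hm1 l.
  split=> [a f g hf hg|].
    rewrite /l -within01_RintegralZl; last exact: continuous_within01 (cl f hf).
    rewrite -within01_RintegralD; first last.
    - exact: continuous_within01 (cl g hg).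
    - apply: within01M; last exact: continuous_within01 (cl f hf).
      by apply: continuous_within01; exact: cst_continuous.
    congr (Rintegral _ _ _); apply/funext => x.
    have -> : L2inner (sol_v x) (fun y => a * f y + g y) = a * L2inner (sol_v x) f + L2inner (sol_v x) g.
      have Lf := H1_L2 (H10_H1 hf); have Lg := H1_L2 (H10_H1 hg); have Lv := L2_sol_v x.
      by rewrite L2innerC (L2inner_linl a Lf Lg Lv) (L2innerC f) (L2innerC g).
    rewrite /sol_w (wave_form_Hm1 (sol_u_H10 x)).1//.
    move: (derive1 _ _) (phi x) (L2inner _ _) (L2inner _ _) (wave_form _ _) (wave_form _ _).
    by move=> p q r s t u; ring.
  exists (K1 * Num.sqrt M + K2 * ((1 + C) * Num.sqrt (2 * M))) => f hf.
  apply: Rintegral_mu01_bound; first exact: (continuous_measurable_fun (cl f hf)).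
  move=> x x01; have {}x01 : 0 <= x <= 1 by case/andP: x01 => *; rewrite !ltW.
  apply: le_trans (ler_normD _ _) _; rewrite mulrDl !normrM; apply: lerD; rewrite -mulrA ler_pM// ?hK1 ?hK2//.
    apply: le_trans (L2_cauchy_schwarz (L2_sol_v x) (H1_L2 (H10_H1 hf))) _.
    by rewrite ler_pM ?L2norm_ge0 ?sol_v_bound// L2norm_le_H1norm.
  apply: le_trans (wave_form_le (sol_u_H10 x) hf) _.
  by rewrite ler_wpM2r ?H1norm_ge0// ler_wpM2l ?addr_ge0// sol_u_bound.
have lsn k : l (sn k) = 0.
  have wg : {within `[0, 1], continuous (fun x => - (om k * b x k) - G x k)}.
    have wG : {within `[0, 1], continuous (G^~ k)} by apply: continuous_within01; exact: cG.
    apply: (@within01B R (fun x => - (om k * b x k)) (G^~ k)) => //.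
    by move=> x; apply: cvgN; apply: cvgMr; exact: wb.
  have dd' (x : R) : 0 < x < 1 -> is_derive x 1 (d^~ k) (- (om k * b x k) - G x k).
    by move=> /andP[x0 x1]; apply: dd; rewrite !ltW.
  have h := Ccinfty_parts hphi (@wd k) wg dd'.
  rewrite lE; last exact: sn_H10.
  have -> : \int[mu]_x (derive1 phi x * L2inner (sol_v x) (sn k)) = \int[mu]_x (derive1 phi x * d x k).
    by apply: eq_Rintegral_mu01 => x /andP[x0 x1]; rewrite sol_v_coef clampE// !ltW.
  have -> : \int[mu]_x (phi x * sol_w x (sn k)) = \int[mu]_x (phi x * (- (om k * b x k) - G x k)).
    apply: eq_Rintegral_mu01 => x /andP[x0 x1].
    by rewrite /sol_w wave_form_sn ?sol_u_coef; [rewrite clampE// !ltW|exact: sol_u_H10].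
  by rewrite h addNr.
have := Hm1_eq0 hl lsn hpsi; rewrite lE// => /eqP.
by rewrite addr_eq0 => /eqP.
Qed.

Lemma sol_weak_solution u0 : H10 u0 -> (forall k, b 0 k = om k * L2inner u0 (sn k)) ->
  (forall k, d 0 k = 0) -> weak_solution P u0 sol_u.
Proof.
move=> h0 b00 d00; exists sol_v, sol_w; split.
- split; [exact: sol_u_continuous_into|split; [exact: sol_derivative|exact: sol_v_continuous_into]|].
  by split; [exact: sol_Hm1_weak_derivative|exact: sol_w_L2_Hm1].
- move=> psi _; apply: ae_mu01 => x _; rewrite /sol_w /wave_form.
  by move: (L2inner _ _) (L2inner _ _) => p q; ring.
have z01 : 0 <= (0 : R) <= 1 by rewrite lexx ler01.
split.
  have [Lu L0] := (H1_L2 (H10_H1 (sol_u_H10 0)), H1_L2 (H10_H1 h0)).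
  have : sol_u 0 - u0 = 0 %[ae mu].
    apply: sn_complete; first exact: L2B.
    move=> k; have := sol_u_coef 0 k; rewrite clampE// b00 L2innerBl//; last exact: L2_sn.
    by move/(mulfI (lt0r_neq0 (om_gt0 k))) => ->; rewrite subrr.
  by apply: filterS => y h _; apply/eqP; rewrite -subr_eq0; apply/eqP; exact: h.
have : sol_v 0 = 0 %[ae mu].
  apply: sn_complete; first exact: L2_sol_v.
  by move=> k; rewrite sol_v_coef clampE.
exact.
Qed.

End weak_form.
End stable.
End wave_operator.

(** * Existence and uniqueness of weak solutions for a bounded operator *)

Section well_posedness.
Context {R : realType}.
Local Notation mu := (mu01 R).
Variables (P : (R -> R) -> (R -> R)) (C : R).
Hypothesis linP : linear_H1_L2 P.
Hypothesis C0 : 0 <= C.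
Hypothesis boundP : forall f, H1 f -> L2norm (P f) <= C * H1norm f.
Implicit Types (u v : R -> R -> R) (f g h psi : R -> R).

Let K0 : 0 < 2 * C ^+ 2 + 1.
Proof. by rewrite ltr_wpDl// mulr_ge0// sqr_ge0. Qed.

Lemma weak_solution_exists (u0 : R -> R) : H10 u0 -> exists u, weak_solution P u0 u.
Proof.
move=> h0; pose b0 k := om k * L2inner u0 (sn k).
have b0l2 : ell2 b0 by exists (L2norm (wderiv u0) ^+ 2) => n; exact: H10_bessel.
have lip := Psn_lipschitz linP C0 boundP.
have [c [B [cB cc fixc]]] := wave_fixpoint K0 (Psn0 linP boundP) lip b0l2.
pose G := source (Psn P) c.
have cG k : continuous (G^~ k) by move=> x; apply: (source_cont K0 lip cB cc).
have GB := source_bnd (Psn0 linP boundP) lip cB.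
have [B0 hB0] := b0l2.
have [m [m0 mM bdm]] := sol_bound cG GB hB0.
have sE : source (Psn P) (solb G b0) = G.
  apply/funext => x; rewrite /G /source; congr (Psn P _); apply/funext => k.
  by rewrite fixc ?clamp01.
(* [solb G b0] replaces the fixed point [c], with which it is known to agree only on [0, 1]: it has
   two-sided derivatives at the endpoints as well, and the clamped source does not see the
   difference. *)
exists (sol_u (solb G b0)).
apply: (@sol_weak_solution R P C linP C0 boundP (solb G b0) (sold G b0) m _ _ _ _ bdm m0 mM).
- by move=> x k /(sol_derive b0 cG k) [].
- by rewrite sE => x k /(sol_derive b0 cG k) [].
- by rewrite sE.
- exact: h0.
- by move=> k; have [] := sol0 G b0 k.
- by move=> k; have [] := sol0 G b0 k.
Qed.

Lemma cvg_within01_interior f (x l : R) : 0 < x < 1 ->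
  f t @[t --> within `[0, 1] x^'] --> l -> f t @[t --> x^'] --> l.
Proof.
move=> x01 h A /h /= hA.
have nr : \forall t \near x^', 0 < t < 1 by apply: nbhs_dnbhs; exact: near_in01.
have {}hA : \forall t \near x^', `[0, 1]%classic t -> A (f t) := hA.
apply: filterS2 nr hA => t /andP[t0 t1]; apply.
by rewrite /= in_itv/= !ltW.
Qed.

(** On ]0, 1[ the scalar function is a pointwise limit of simple ones. Measurability allows the
    equation, valid almost everywhere in [x], to be substituted under an integral. *)
Lemma Hm1_measurable (w : R -> (R -> R) -> R) psi : L2_Hm1 w -> H10 psi ->
  measurable_fun (`]0, 1[%classic : set (measurableTypeR R)) (fun x => w x psi).
Proof.
move=> [hw [s ss sw] _] hpsi.
apply: (@measurable_fun_cvg _ _ _ _ (fun n x => s n x psi)).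
  move=> n; have [N [A [l [Al sE]]]] := ss n.
  rewrite (_ : (fun x => s n x psi) = (fun x => \sum_(i < N) \1_(A i) x * l i psi)); last first.
    by apply/funext => x; rewrite sE.
  apply: measurable_sum => i; apply: measurable_funM; last exact: measurable_cst.
  by apply: measurable_indic; have [] := Al i.
move=> x x01; have {}x01 : x \in `]0, 1[ by [].
apply: (cvg_dist_bound (c := H1norm psi) _ (sw x x01)); apply: nearW => n.
have [N [A [l [Al sE]]]] := ss n.
have hs : Hm1 (s n x).
  have -> : s n x = (fun f => \sum_(i < N) \1_(A i) x * l i f) by apply/funext => f; rewrite sE.
  by apply: Hm1_comb => i; have [] := Al i.
by rewrite mulrC; exact: (Hm1_bound (Hm1_sub hs (hw x x01)) hpsi).
Qed.

Definition sine_coef u (x : R) (k : nat) : R := om k * L2inner (u x) (sn k).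

(** The equation identifies u_xx tested with [sn k], almost everywhere, with a function continuous
    in [x]: P is bounded on H1 and u is continuous into H10. The weak derivative of the coefficient
    of u_x is therefore a classical one. *)
Lemma weak_solution_wave (u0 : R -> R) v : L2 u0 -> weak_solution P u0 v ->
  [/\ forall x : R, 0 <= x <= 1 -> H10 (v x),
      exists M, ell2_bnd (sine_coef v) M,
      forall k, sine_coef v 0 k = om k * L2inner u0 (sn k) &
      exists2 d, wave (sine_coef v) d (fun x k => L2inner (P (v x)) (sn k)) &
        forall k, d 0 k = 0].
Proof.
move=> L0 [vx [vxx [[cv [dv cvx] [wv hv]] pde [v0 vx0]]]].
have i01 (x : R) : 0 <= x <= 1 -> x \in `[0, 1] by rewrite in_itv.
have Hv (x : R) : 0 <= x <= 1 -> H10 (v x) by move=> /i01 /cv [].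
have Lv (x : R) : 0 <= x <= 1 -> L2 (v x) by move=> /Hv /H10_H1 /H1_L2.
have Lvx (x : R) : 0 <= x <= 1 -> L2 (vx x) by move=> /i01 /cvx [].
have z01 : 0 <= (0 : R) <= 1 by rewrite lexx ler01.
have near01 (x : R) (Q : R -> Prop) : (forall t, 0 <= t <= 1 -> Q t) ->
    \forall t \near within `[0, 1] (nbhs x), Q t.
  move=> hQ; apply: filterS (@near_withinT _ (nbhs x) `[0, 1]%classic _) => t.
  by rewrite /= in_itv/=; exact: hQ.
have within_of (f : R -> R) (g : R -> R -> R) (c : R) :
    (forall x t : R, 0 <= x <= 1 -> 0 <= t <= 1 -> `|f t - f x| <= c * g x t) ->
    (forall x : R, 0 <= x <= 1 -> g x t @[t --> within `[0, 1] (nbhs x)] --> (0 : R)) ->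
    {within `[0, 1], continuous f}.
  move=> hf hg; apply/subspace_continuousP => x; rewrite /= in_itv/= => x01.
  apply: (cvg_dist_bound (c := c) _ (hg x x01)); apply: near01 => t t01; exact: hf.
have cvH (x : R) : 0 <= x <= 1 -> H1norm (v t \- v x) @[t --> within `[0, 1] (nbhs x)] --> (0 : R).
  by move=> /i01 /cv [].
have cvL (x : R) : 0 <= x <= 1 -> L2norm (vx t \- vx x) @[t --> within `[0, 1] (nbhs x)] --> (0 : R).
  by move=> /i01 /cvx [].
have wa k : {within `[0, 1], continuous (sine_coef v ^~ k)}.
  apply: (@within_of _ _ (om k * L2norm (sn k : R -> R)) _ cvH) => x t x01 t01.
  have [Lt Lx] := (Lv t t01, Lv x x01); have Ls := @L2_sn R k.
  rewrite /sine_coef -mulrBr -(L2innerBl Lt Lx Ls) normrM (gtr0_norm (om_gt0 k)) -mulrA.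
  rewrite ler_wpM2l ?(ltW (om_gt0 k))//.
  apply: le_trans (L2_cauchy_schwarz (L2B Lt Lx) Ls) _; rewrite mulrC ler_wpM2l ?L2norm_ge0//.
  exact: L2norm_le_H1norm.
pose d (x : R) (k : nat) := L2inner (vx x) (sn k).
have wd k : {within `[0, 1], continuous (d^~ k)}.
  apply: (@within_of _ _ (L2norm (sn k : R -> R)) _ cvL) => x t x01 t01.
  have [Lt Lx] := (Lvx t t01, Lvx x x01); have Ls := @L2_sn R k.
  rewrite /d -(L2innerBl Lt Lx Ls) mulrC.
  exact: (L2_cauchy_schwarz (L2B Lt Lx) Ls).
pose G (x : R) (k : nat) := L2inner (P (v x)) (sn k).
have wG k : {within `[0, 1], continuous (G^~ k)}.
  apply: (@within_of _ _ (C * L2norm (sn k : R -> R)) _ cvH) => x t x01 t01.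
  have [Ht Hx] := (H10_H1 (Hv t t01), H10_H1 (Hv x x01)); have Ls := @L2_sn R k.
  have [Lt Lx] := (L2_P linP Ht, L2_P linP Hx).
  rewrite /G -(L2innerBl Lt Lx Ls) mulrAC.
  apply: le_trans (L2_cauchy_schwarz (L2B Lt Lx) Ls) _; rewrite ler_wpM2r ?L2norm_ge0//.
  exact: (P_dist linP boundP).
have der k (x : R) : 0 < x < 1 -> is_derive x 1 (sine_coef v ^~ k) (om k * d x k).
  move=> x01'; have x01 : 0 <= x <= 1 by case/andP: x01' => *; rewrite !ltW.
  apply/is_derive_slope; apply: cvg_within01_interior => //.
  apply: (cvg_dist_bound (c := om k * L2norm (sn k : R -> R)) _ (dv x (i01 x x01))).
  apply: filterS (@near_withinT _ x^' `[0, 1]%classic _) => t; rewrite /= in_itv/= => t01.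
  have [Lt Lx] := (Lv t t01, Lv x x01); have Ls := @L2_sn R k; have Lxx := Lvx x x01.
  have LB := L2B Lt Lx.
  have E : (fun y => (v t y - v x y) / (t - x) - vx x y) = (t - x)^-1 *: (v t - v x) - vx x.
    by apply/funext => y; rewrite !fctE mulrC.
  rewrite E.
  have -> : (sine_coef v t k - sine_coef v x k) / (t - x) - om k * d x k =
      om k * L2inner ((t - x)^-1 *: (v t - v x) - vx x) (sn k).
    rewrite (L2innerBl (L2Z _ LB) Lxx Ls) (L2innerZl _ LB Ls) (L2innerBl Lt Lx Ls).
    rewrite /sine_coef /d; move: (om k) (t - x)^-1 (L2inner _ _) (L2inner _ _) (L2inner _ _).
    by move=> o i p q s; ring.
  rewrite normrM (gtr0_norm (om_gt0 k)) -mulrA ler_wpM2l ?(ltW (om_gt0 k))// mulrC.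
  exact: (L2_cauchy_schwarz (L2B (L2Z _ LB) Lxx) Ls).
have wh k : {within `[0, 1], continuous (fun x => - (om k * sine_coef v x k) - G x k)}.
  apply: (@within01B R (fun x => - (om k * sine_coef v x k)) (G^~ k)) => //.
  by move=> x; apply: cvgN; apply: cvgMr; exact: wa.
have ded k (x : R) : 0 < x < 1 -> is_derive x 1 (d^~ k) (- (om k * sine_coef v x k) - G x k).
  apply: (du_bois_reymond (wd k) (wh k)) => phi hphi.
  rewrite (wv phi hphi _ (@sn_H10 R k)); congr (- _).
  pose h := (fun x => - (om k * sine_coef v x k) - G x k) \o clamp.
  have ch : continuous h := within01_clamp (wh k).
  (* The values of u_xx are controlled on ]0, 1[ only; extension by zero makes the integrand
     measurable on the whole line. *)
  pose w : R -> R := (fun x => vxx x (sn k)) \_ `]0, 1[%classic.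
  have mw : measurable_fun setT (w : measurableTypeR R -> R).
    apply/(measurable_restrictT _ _).1 => //; exact: Hm1_measurable hv (@sn_H10 R k).
  have inI (y : R) : 0 < y < 1 -> w y = vxx y (sn k).
    by move=> y01; rewrite /w patchE mem_set//= in_itv.
  have mphi := continuous_measurable_fun (Ccinfty_continuous hphi).
  have E1 : \int[mu]_x (phi x * vxx x (sn k)) = \int[mu]_x (phi x * w x).
    by apply: eq_Rintegral_mu01 => y /inI ->.
  have E2 : \int[mu]_x (phi x * (- (om k * sine_coef v x k) - G x k)) = \int[mu]_x (phi x * h x).
    by apply: eq_Rintegral_mu01 => y /andP[y0 y1]; rewrite /h /= clampE// !ltW.
  rewrite E1 E2; apply: ae_eq_Rintegral.
  - exact: measurable_funM mphi mw.
  - exact: measurable_funM mphi (continuous_measurable_fun ch).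
  apply: filterS2 (pde _ (@sn_H10 R k)) (@ae_in01 R) => y hy y01 _.
  have y01' : 0 <= y <= 1 by case/andP: y01 => *; rewrite !ltW.
  rewrite inI// /h /= clampE//; congr (_ * _).
  have := wave_form_sn P k (Hv y y01'); rewrite /wave_form -/(sine_coef v y k) -/(G y k) => <-.
  move: hy; rewrite -/(G y k); move: (vxx _ _) (L2inner _ _) (G y k) => p q r; lra.
split=> //.
- have cN : {within `[0, 1], continuous (fun x => H1norm (v x))}.
    apply: (@within_of _ _ 1 _ cvH) => x t x01 t01; rewrite mul1r.
    exact: (H1norm_dist (H10_H1 (Hv t t01)) (H10_H1 (Hv x x01))).
  have [M M0 hM] := bounded_on01 cN.
  exists (M ^+ 2) => x n x01; apply: le_trans (H10_bessel n (Hv x x01)) _.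
  rewrite ler_sqr ?nnegrE ?L2norm_ge0//; apply: le_trans (L2norm_wderiv_le_H1norm _) _.
  by apply: le_trans (ler_norm _) (hM x x01).
- by move=> k; rewrite /sine_coef (L2inner_ae (Lv 0 z01) L0 (@L2_sn R k) v0).
exists d => k.
  by split; [exact: wa|exact: wd|move=> x x01; split; [exact: der|exact: ded]].
by rewrite /d (L2inner_ae (Lvx 0 z01) (@L2_0 R) (@L2_sn R k) vx0) L2inner0l.
Qed.

Lemma weak_solution_unique (u0 : R -> R) u v : L2 u0 -> weak_solution P u0 u -> weak_solution P u0 v ->
  forall x : R, x \in `[0, 1] -> v x = u x %[ae mu].
Proof.
move=> L0 hu hv x; rewrite in_itv/= => x01.
have [Hu [M hM] u00 [d Wu d0]] := weak_solution_wave L0 hu.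
have [Hv [M' hM'] v00 [d' Wv d0']] := weak_solution_wave L0 hv.
have W := waveB Wv Wu.
have bnd : ell2_bnd (fun x k => sine_coef v x k - sine_coef u x k) (2 * M' + 2 * M).
  move=> y n y01; apply: le_trans (sum_sqrD_le (sine_coef v y) (fun k => - sine_coef u y k) n) _.
  apply: lerD; rewrite ler_wpM2l//; first exact: hM'.
  by under eq_bigr do rewrite sqrrN; exact: hM.
have co k : sine_coef v x k - sine_coef u x k = 0.
  apply: (wave_unique K0 W _ _ bnd _ k x01).
  - by move=> j; rewrite v00 u00 subrr.
  - by move=> j; rewrite d0 d0' subrr.
  move=> s A /andP[s0 s1]; have s01 : 0 <= s <= 1 by rewrite !ltW.
  exact: (P_coef_dist linP C0 boundP (Hv s s01) (Hu s s01)).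
have [Lu Lv] := (H1_L2 (H10_H1 (Hu x x01)), H1_L2 (H10_H1 (Hv x x01))).
have : v x - u x = 0 %[ae mu].
  apply: sn_complete; first exact: L2B.
  move=> k; rewrite (L2innerBl Lv Lu (@L2_sn R k)); apply/eqP.
  have := co k; rewrite /sine_coef -mulrBr => /eqP.
  by rewrite mulf_eq0 gt_eqF ?om_gt0.
by apply: filterS => y h _; apply/eqP; rewrite -subr_eq0; apply/eqP; exact: h.
Qed.

End well_posedness.

Theorem theorem3p4 (R : realType) (gamma beta : R -> R)
    (P : R -> (R -> R) -> (R -> R)) (u0 u0e : R -> R) (e : R)
    (gamma_ge1 : forall b, 0 < b < 1 -> 1 <= gamma b)
    (gamma_lim : gamma b @[b --> 0^'+] --> +oo)
    (beta01 : forall d, 0 < d < 1 -> 0 < beta d < 1)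
    (beta_lim : beta d @[d --> 0^'+] --> (0 : R))
    (P_stabilized : stabilized gamma beta P)
    (e01 : 0 < e < 1)
    (u0_H1 : H1 u0) (u0e_H1 : H1 u0e)
    (u0e_near : H1norm (u0e \- u0) <= e)
    (u0e_bnd : vanishes_at_endpoints u0e) :
  exists u : R -> R -> R, weak_solution (P e) u0e u /\
    forall v : R -> R -> R, weak_solution (P e) u0e v ->
      forall x, x \in `[0, 1] -> v x = u x %[ae mu01 R].
Proof.
have [linP [C1 C10 boundP]] := P_stabilized.
(* Here gamma >= 1 makes the logarithm nonnegative. For the fixed [e] the product is just the bound
   [C] of a single operator. *)
have C0 : 0 <= C1 * ln (gamma (beta e)).
  by rewrite (mulr_ge0 (ltW C10))// ln_ge0// gamma_ge1// beta01.
have [u hu] := weak_solution_exists (linP e e01) C0 (boundP e e01) (vanishing_H10 u0e_H1 u0e_bnd).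
exists u; split=> // v hv.
exact: (weak_solution_unique (linP e e01) C0 (boundP e e01) (H1_L2 u0e_H1) hu hv).
Qed.
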